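(* Let $(M^n,g)$ be a complete noncompact $n$-dimensional Riemannian manifold, $u\in C^\infty(M)$, $V=e^u$, $\lambda,\mu\in\mathbb{R}$, $D=D^{\lambda,\mu}$, and $\tau=(n+1)\lambda+\mu$. Let $\rho$ be a nonnegative function on $M$ such that $|\nabla^D\rho|=1$ and $\Delta^D\rho\ge\frac{C}{\rho}V^{\lambda-\mu}$ in the sense of distributions, where $C>0$ is a constant. Then for every compactly supported smooth function $\phi\in C_0^\infty(M\setminus\rho^{-1}\{0\})$, $$\left(\int_M\rho^2\phi^2V^{\tau+\lambda-\mu}\,dv_g\right)\left(\int_M|\nabla^D\phi|^2V^{\tau+\lambda-\mu}\,dv_g\right)\ \ge\ \frac{(C+1)^2}{4}\left(\int_M\phi^2V^{\tau+\lambda-\mu}\,dv_g\right)^2.$$ Moreover, if $C>1$, then $$\left(\int_M\rho^4\phi^2V^{\tau+\lambda-\mu}\,dv_g\right)\left(\int_M(\Delta^D\phi)^2V^{\tau+\mu-\lambda}\,dv_g\right)\ \ge\ \frac{(C+1)^4}{16}\left(\int_M\phi^2V^{\tau+\lambda-\mu}\,dv_g\right)^2.$$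
   Context: $\nabla$, $\Delta=\mathrm{div}\,\nabla$, $dv_g$ denote the Levi-Civita connection/gradient, Laplacian and Riemannian volume of $g$; $\langle\cdot,\cdot\rangle=g$ and $|\cdot|$ is the norm of $g$. The affine connection $D=D^{\lambda,\mu}$ is $D_XY=\nabla_XY+\lambda\,du(X)Y+\lambda\,du(Y)X+\mu\,g(X,Y)\nabla u$. The affine gradient of a function $f$ is $\nabla^Df=V^{\mu-\lambda}\nabla f$. The affine Laplacian is $\Delta^Df=V^{\mu-\lambda}\left[\Delta f+(2\mu+n\lambda)\langle\nabla u,\nabla f\rangle\right]$; equivalently $V^\tau\Delta^Df=\mathrm{div}(V^\tau\nabla^Df)$. Distributional conditions: ''$|\nabla^D\rho|=1$ in the sense of distributions'' means that $\rho$ is locally Lipschitz and its (weak) gradient satisfies $|\nabla^D\rho|=1$ almost everywhere. ''$\Delta^D\rho\ge\frac{C}{\rho}V^{\lambda-\mu}$ in the sense of distributions'' means that $-\int_M\langle\nabla\psi,\nabla^D\rho\rangle V^\tau\,dv_g\ge\int_M\frac{C}{\rho}\psi V^{\tau+\lambda-\mu}\,dv_g$ for all nonnegative compactly supported Lipschitz $\psi$ with support in $M\setminus\rho^{-1}\{0\}$. *)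

(* Defs.v *)
From HB Require Import structures.
From mathcomp Require Import all_boot all_order all_algebra.
From mathcomp Require Import all_classical all_reals all_analysis.

Set Implicit Arguments.
Unset Strict Implicit.
Unset Printing Implicit Defensive.

Import Order.TTheory GRing.Theory Num.Theory.
Import numFieldNormedType.Exports.

Local Open Scope classical_set_scope.
Local Open Scope ring_scope.

(* Points and vectors of R^n are rows.  The library's Jacobian 'J f x is
   transposed accordingly: its (a, c) entry is the a-th partial derivative of
   the c-th component of f, and 'd f x v = v *m 'J f x. *)

Section euclidean.
Variable R : realType.

(* C^oo on U (an open set in all uses): all iterated partial derivatives exist
   and are Frechet differentiable, hence continuous, at the points of U. *)
Definition smooth_on n (W : normedModType R) (U : set 'rV[R]_n)
    (f : 'rV[R]_n -> W) : Prop :=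
  forall (s : seq 'I_n) (x : 'rV[R]_n), U x ->
    differentiable (foldr (fun k h => 'D_(delta_mx 0 k) h) f s) x.

(* By Tonelli's theorem, the integral with respect to n-dimensional Lebesgue
   measure; it is only applied to nonnegative Borel functions. *)
Fixpoint integral_rV n : ('rV[R]_n -> \bar R) -> \bar R :=
  match n return ('rV[R]_n -> \bar R) -> \bar R with
  | 0 => fun f => f 0
  | m.+1 => fun f => (\int[@lebesgue_measure R]_t
      integral_rV (fun x : 'rV[R]_m => f (row_mx t%:M x : 'rV[R]_(1 + m))))%E
  end.

End euclidean.

(* [chart i] and [chart_inv i] are total functions, meaningful only on
   [chart_dom i] and on its image.  [chart_at] is an arbitrary choice of a chart
   around each point; it serves to write chart-independent quantities. *)
Record smooth_atlas (R : realType) (n : nat) (M : topologicalType) := SmoothAtlas {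
  chart_index : Type;
  chart_dom : chart_index -> set M;
  chart : chart_index -> M -> 'rV[R]_n;
  chart_inv : chart_index -> 'rV[R]_n -> M;
  chart_at : M -> chart_index;
  chart_atP : forall p, chart_dom (chart_at p) p;
  chart_dom_open : forall i, open (chart_dom i);
  chart_img_open : forall i, open (chart i @` chart_dom i);
  chartK : forall i p, chart_dom i p -> chart_inv i (chart i p) = p;
  chart_continuous : forall i p, chart_dom i p -> {for p, continuous (chart i)};
  chart_inv_continuous : forall i p, chart_dom i p ->
    {for chart i p, continuous (chart_inv i)};
  chart_transition_smooth : forall i j,
    smooth_on (chart i @` (chart_dom i `&` chart_dom j))
              (chart j \o chart_inv i)
}.

Notation borelType M := (g_sigma_algebraType (@open M)).

Section manifold.
Variables (R : realType) (n : nat) (M : topologicalType).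
Variable A : smooth_atlas R n M.

Let I := chart_index A.

Definition transition_jacobian (i j : I) (p : M) : 'M[R]_n :=
  'J (chart j \o chart_inv i) (chart i p).

Definition smooth_function (f : M -> R) : Prop :=
  forall i : I, smooth_on (chart i @` chart_dom i) (f \o chart_inv i).

Definition partials (f : M -> R) (i : I) (p : M) : 'rV[R]_n :=
  \row_k 'D_(delta_mx 0 k) (f \o chart_inv i) (chart i p).

(* A vector field is given by its components X i p in each chart i around p,
   subject to the usual transformation law. *)
Definition vfield : Type := I -> M -> 'rV[R]_n.

Definition is_vfield (X : vfield) : Prop :=
  forall (i j : I) p, chart_dom i p -> chart_dom j p ->
    X j p = X i p *m transition_jacobian i j p.

Definition smooth_vfield (X : vfield) : Prop :=
  is_vfield X /\
  forall i : I, smooth_on (chart i @` chart_dom i) (X i \o chart_inv i).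

Definition scale_vfield (a : M -> R) (X : vfield) : vfield :=
  fun i p => a p *: X i p.

Definition fsupport (f : M -> R) : set M := closure [set p | f p != 0].

Definition vsupport (X : vfield) : set M :=
  closure [set p | X (chart_at A p) p != 0].

End manifold.

(* [gmat i p] is the matrix of the metric at p in the chart i. *)
Record riemannian_metric (R : realType) (n : nat) (M : topologicalType)
    (A : smooth_atlas R n M) := RiemannianMetric {
  gmat : chart_index A -> M -> 'M[R]_n;
  gmat_transition : forall i j p, chart_dom i p -> chart_dom j p ->
    gmat i p = transition_jacobian i j p *m gmat j p *m
               (transition_jacobian i j p)^T;
  gmat_sym : forall i p, chart_dom i p -> (gmat i p)^T = gmat i p;
  gmat_pos : forall i p (v : 'rV[R]_n), chart_dom i p -> v != 0 ->
    0 < (v *m gmat i p *m v^T) 0 0;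
  gmat_smooth : forall i,
    smooth_on (chart i @` chart_dom i) (gmat i \o chart_inv i)
}.

Section riemannian.
Variables (R : realType) (n : nat) (M : topologicalType).
Variables (A : smooth_atlas R n M) (g : riemannian_metric A).

Definition vinner (X Y : vfield A) (p : M) : R :=
  let i := chart_at A p in (X i p *m gmat g i p *m (Y i p)^T) 0 0.

Definition vnorm (X : vfield A) (p : M) : R := Num.sqrt (vinner X X p).

Definition grad (f : M -> R) : vfield A :=
  fun i p => partials f i p *m invmx (gmat g i p).

Definition vol_density (i : chart_index A) (p : M) : R :=
  Num.sqrt (\det (gmat g i p)).

(* (det g)^(-1/2) \sum_k d_k ((det g)^(1/2) X^k) *)
Definition divergence (X : vfield A) (p : M) : R :=
  let i := chart_at A p in
  (vol_density i p)^-1 *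
  \sum_(k < n) 'D_(delta_mx 0 k)
     (fun x => vol_density i (chart_inv i x) * X i (chart_inv i x) 0 k)
     (chart i p).

Definition laplacian (f : M -> R) : M -> R := divergence (grad f).

(* C^1 up to the end points of [0, 1] is expressed as C^1 near [0, 1]. *)
Definition C1_curve (c : R -> M) : Prop :=
  forall t : R, 0 <= t <= 1 ->
    {for t, continuous c} /\
    forall i : chart_index A, chart_dom i (c t) ->
      (\forall s \near t, derivable (chart i \o c) s 1) /\
      {for t, continuous (derive1 (chart i \o c))}.

Definition speed (c : R -> M) (t : R) : R :=
  let i := chart_at A (c t) in
  let v := derive1 (chart i \o c) t in
  Num.sqrt ((v *m gmat g i (c t) *m v^T) 0 0).

Definition curve_length (c : R -> M) : \bar R :=
  (\int[@lebesgue_measure R]_(t in `[0%R, 1%R]) (speed c t)%:E)%E.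

(* A piecewise C^1 curve is a list of C^1 curves placed end to end. *)
Fixpoint piecewise_C1 (x : M) (s : seq (R -> M)) (y : M) : Prop :=
  match s with
  | [::] => x = y
  | c :: s' => [/\ C1_curve c, c 0 = x & piecewise_C1 (c 1) s' y]
  end.

(* +oo between points in distinct connected components *)
Definition riemannian_dist (x y : M) : \bar R :=
  ereal_inf [set l | exists2 s, piecewise_C1 x s y &
                       l = (\sum_(c <- s) curve_length c)%E].

Definition metrically_complete : Prop :=
  forall s : nat -> M,
    (forall e : R, 0 < e -> exists N, forall k m, (N <= k)%N -> (N <= m)%N ->
       (riemannian_dist (s k) (s m) < e%:E)%E) ->
    exists p, forall e : R, 0 < e -> exists N, forall k, (N <= k)%N ->
       (riemannian_dist (s k) p < e%:E)%E.

Definition lipschitz_within (U : set M) (f : M -> R) : Prop :=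
  exists L : R, forall x y, U x -> U y ->
    ((`|f x - f y|)%:E <= L%:E * riemannian_dist x y)%E.

Definition locally_lipschitz (f : M -> R) : Prop :=
  forall p : M, exists2 U, nbhs p U & lipschitz_within U f.

End riemannian.

Section integration.
Variables (R : realType) (n : nat) (M : ptopologicalType).
Variables (A : smooth_atlas R n M) (g : riemannian_metric A).
Variable vol : {measure set (borelType M) -> \bar R}.

(* dv_g = (det g)^(1/2) dx in every chart; as the charts cover the second
   countable space M, this determines the Borel measure. *)
Definition is_riemannian_volume : Prop :=
  forall (i : chart_index A) (B : set (borelType M)),
    measurable B -> B `<=` (chart_dom i : set M) ->
    vol B = integral_rV (fun x =>
      (\1_(chart i @` (B : set M)) x * vol_density g i (chart_inv i x))%:E).

Definition locally_integrable_vfield (W : vfield A) : Prop :=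
  [/\ is_vfield W,
      forall (i : chart_index A) (k : 'I_n),
        measurable_fun (chart_dom i : set (borelType M))
          ((fun p => W i p 0 k) : borelType M -> R) &
      forall K : set M, compact K ->
        ((\int[vol]_(p in K) (vnorm g W p)%:E) < +oo)%E].

(* W is the weak (distributional) gradient of f; it is unique up to equality
   almost everywhere. *)
Definition is_weak_gradient (f : M -> R) (W : vfield A) : Prop :=
  locally_integrable_vfield W /\
  forall X : vfield A, smooth_vfield X -> compact (vsupport X) ->
    ((\int[vol]_p (f p * divergence g X p)%:E) =
     - (\int[vol]_p (vinner g W X p)%:E))%E.

End integration.

(* lam and mu are the parameters of the affine connection
   D_X Y = nabla_X Y + lam du(X) Y + lam du(Y) X + mu g(X, Y) grad u;
   its affine gradient and Laplacian are defined directly in terms of them. *)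
Section affine.
Variables (R : realType) (n : nat) (M : ptopologicalType).
Variables (A : smooth_atlas R n M) (g : riemannian_metric A).
Variable vol : {measure set (borelType M) -> \bar R}.
Variables (u : M -> R) (lam mu : R).

Definition affV (p : M) : R := expR (u p).

Definition aff_tau : R := (n%:R + 1) * lam + mu.

(* nabla^D f is [to_affine] of the gradient, or of the weak gradient, of f. *)
Definition to_affine (W : vfield A) : vfield A :=
  scale_vfield (fun p => affV p `^ (mu - lam)) W.

Definition aff_grad (f : M -> R) : vfield A := to_affine (grad g f).

Definition aff_laplacian (f : M -> R) (p : M) : R :=
  affV p `^ (mu - lam) *
  (laplacian g f p + (2 * mu + n%:R * lam) * vinner g (grad g u) (grad g f) p).

Definition aff_eikonal (rho : M -> R) : Prop :=
  locally_lipschitz g rho /\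
  exists2 W, is_weak_gradient g vol rho W &
    {ae vol, forall p, vnorm g (to_affine W) p = 1}.

(* Delta^D rho >= (C / rho) V^(lam - mu) in the sense of distributions *)
Definition aff_laplacian_ge (C : R) (rho : M -> R) : Prop :=
  forall (W : vfield A) (psi : M -> R) (Wpsi : vfield A),
    is_weak_gradient g vol rho W ->
    is_weak_gradient g vol psi Wpsi ->
    (forall p, 0 <= psi p) ->
    lipschitz_within g setT psi ->
    compact (fsupport psi) ->
    fsupport psi `<=` ~` (rho @^-1` [set 0]) ->
    (- (\int[vol]_p (vinner g Wpsi (to_affine W) p * affV p `^ aff_tau)%:E) >=
     \int[vol]_p (C / rho p * psi p * affV p `^ (aff_tau + lam - mu))%:E)%E.

End affine.

(* Main.v *)
Require Import Defs.
From HB Require Import structures.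
From mathcomp Require Import all_boot all_order all_algebra.
From mathcomp Require Import all_classical all_reals all_analysis.
From mathcomp Require Import measurable_realfun ring lra.

Set Implicit Arguments.
Unset Strict Implicit.
Unset Printing Implicit Defensive.

Import Order.TTheory GRing.Theory Num.Theory.
Import numFieldNormedType.Exports.

Local Open Scope classical_set_scope.
Local Open Scope ring_scope.

(* Write a = V^(mu - lam) and w = V^(tau + lam - mu), so that V^tau = a w.  Use
   psi = rho phi^2 as a test function in the Laplacian inequality.  Its weak
   gradient is phi^2 W + 2 rho phi grad phi, where W is that of rho, and
   a |W| = 1 almost everywhere; by AM-GM, for every s > 0,
     (C + 1) int phi^2 w <= s int rho^2 phi^2 w + s^-1 int |nabla^D phi|^2 w,
   and the first inequality follows by optimizing s.  For the second one, apply
   Cauchy-Schwarz to J = int rho^2 phi^2 w and, after Green's formula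
   int |nabla^D phi|^2 w = - int phi (Delta^D phi) V^tau, to the gradient
   integral; the first inequality then bounds their product from below.
   The divergence of a C^1 field does not depend on the chart: Green's formula
   in a chart, which rests on the translation invariance of Lebesgue measure,
   determines it. *)

(** * Borel sets and Lebesgue measure on R^n *)

Section borel.

(** The constant is C + 1 because the Laplacian inequality contributes C and the term a^2 phi^2
    |W|^2 of the pairing contributes 1. In the second inequality, squaring c I^2 <= J G and using
    J^2 <= P I and G^2 <= I Q gives c^2 I^4 <= P Q I^2, from which I^2 cancels. Most of the work
    makes rho phi^2 admissible. It must be Lipschitz for a distance that is an infimum of lengths of
    curves, while the Lipschitz constants of rho are only local; the estimate is therefore
    infinitesimal along curves and then integrated. It must also have a weak gradient, which is
    found by multiplying test fields by phi and uses the Leibniz rule for the divergence. Since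
    [divergence] is computed at each point in a chart chosen there without any regularity, its
    continuity, and Green's formula on supports larger than a chart, both rest on its independence
    of the chart. Cut-off functions occur in Green's formula only, where class C^1 suffices, so
    explicit piecewise polynomial bumps serve. *)

Lemma open_measurable_borel (T : ptopologicalType) (U : set T) :
  open U -> measurable (U : set (borelType T)).
Proof. exact: sub_sigma_algebra. Qed.

Lemma closed_measurable_borel (T : ptopologicalType) (U : set T) :
  closed U -> measurable (U : set (borelType T)).
Proof.
by move=> /closed_openC/open_measurable_borel/measurableC; rewrite setCK.
Qed.

Lemma open_preimage_setI (T T' : topologicalType) (D : set T) (f : T -> T')
    (U : set T') :
  open D -> (forall x, D x -> {for x, continuous f}) -> open U ->
  open (D `&` f @^-1` U).
Proof.
move=> oD cf oU; rewrite openE => x [Dx Ufx].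
apply: filterI; first exact: open_nbhs_nbhs.
by apply: (cf x Dx); exact: open_nbhs_nbhs.
Qed.

Lemma continuous_measurable_borel (T T' : ptopologicalType) (D : set T)
    (f : T -> T') :
  open D -> (forall x, D x -> {for x, continuous f}) ->
  measurable_fun (D : set (borelType T)) (f : borelType T -> borelType T').
Proof.
move=> oD cf; apply: (measurability _ (erefl (@measurable _ (borelType T')))).
by move=> _ [U oU <-]; apply: open_measurable_borel; exact: open_preimage_setI.
Qed.

Lemma continuous_measurable_real (R : realType) (T : ptopologicalType) (D : set T)
    (f : T -> R) :
  open D -> (forall x, D x -> {for x, continuous f}) ->
  measurable_fun (D : set (borelType T)) (f : borelType T -> R).
Proof.
move=> oD cf; apply: (measurability _ (measurable_realfun.RGenOpens.measurableE R)).
move=> _ [_ [a [b ->] <-]]; apply: open_measurable_borel.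
by apply: open_preimage_setI => //; exact: interval_open.
Qed.

End borel.

(** * Row vectors and Lebesgue measure on R^n *)

Section rowspace.
Variable R : realType.

Lemma rV_ballP n (x y : 'rV[R]_n) (e : R) : 0 < e ->
  ball x e y <-> forall k, `|x 0 k - y 0 k| < e.
Proof.
move=> e0; split=> [[_ h] k|h]; first exact: h.
by split=> // i k; rewrite ord1; exact: h.
Qed.

Lemma rV_near_rat n (x : 'rV[R]_n) (e : R) : 0 < e ->
  exists q : 'rV[rat]_n, ball x e (map_mx ratr q).
Proof.
move=> e0.
have h k : exists q : rat, `|x 0 k - ratr q| < e.
  have /rat_in_itvoo[q /itvP qre] : x 0 k < x 0 k + e by rewrite ltrDl.
  exists q; rewrite distrC ger0_norm ?subr_ge0 ?qre// ltrBlDl.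
  by rewrite qre.
have [q hq] := choice h.
exists (\row_k q k); apply/rV_ballP => // k.
by rewrite !mxE.
Qed.

Lemma continuous_rV (T : topologicalType) n (f : T -> 'rV[R]_n) (x : T) :
  (forall k, {for x, continuous (fun y => f y 0 k)}) -> {for x, continuous f}.
Proof.
move=> cf; apply/cvgrPdist_lt => e e0.
have : \forall y \near x, forall k, `|f x 0 k - f y 0 k| < e.
  apply: filter_forall => k; have /cvgrPdist_lt := cf k; exact.
apply: filterS => y hy.
have : ball (f x) e (f y) by apply/rV_ballP.
by rewrite -ball_normE.
Qed.

Lemma row_mx_continuous n :
  continuous (fun z : R * 'rV[R]_n => row_mx z.1%:M z.2 : 'rV[R]_n.+1).
Proof.
move=> z; apply: continuous_rV => k.
case: (split_ordP (k : 'I_(1 + n))) => j ->.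
- rewrite (_ : (fun _ => _) = fst); first exact: cvg_fst.
  by apply/funext => y; rewrite (@row_mxEl _ 1 1 n) mxE ord1 eqxx.
- rewrite (_ : (fun _ => _) = (fun v : 'rV[R]_n => v 0 j) \o snd).
    apply: continuous_comp; first exact: cvg_snd.
    exact: coord_continuous.
  by apply/funext => y; rewrite (@row_mxEr _ 1 1 n).
Qed.

(** Continuity alone does not give this, because the source carries the product sigma-algebra: an
    open preimage is written as a countable union of rational boxes, which are measurable
    rectangles. *)
Lemma row_mx_measurable n :
  measurable_fun [set: measurableTypeR R * borelType 'rV[R]_n]
    (fun z : R * 'rV[R]_n => (row_mx z.1%:M z.2 : borelType 'rV[R]_n.+1)).
Proof.
apply: (measurability _ (erefl (@measurable _ (borelType 'rV[R]_n.+1)))).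
move=> _ [U oU <-]; rewrite setTI.
set f := (f in f @^-1` U).
pose box (w : rat * 'rV[rat]_n * nat) : set (R * 'rV[R]_n) :=
  ball (ratr w.1.1 : R) w.2.+1%:R^-1 `*` ball (map_mx ratr w.1.2 : 'rV[R]_n) w.2.+1%:R^-1.
have -> : f @^-1` U = \bigcup_(w in [set w | box w `<=` f @^-1` U]) box w.
  apply/seteqP; split=> [[t x] /= Utx|z [w hw]]; last exact: hw.
  have : nbhs (t, x) (f @^-1` U).
    by move/(_ _ (open_nbhs_nbhs (conj oU Utx))): (@row_mx_continuous n (t, x)).
  move=> [[P Q] [/= /nbhs_ballP[e /= e0 eP] /nbhs_ballP[d /= d0 dQ]] PQU].
  (* The box contains [(t, x)] without being centred there, so its points are only within twice its
     radius of [(t, x)]; hence half of [Num.min e d]. *)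
  have m0 : 0 < Num.min e d / 2 by rewrite divr_gt0// lt_min e0.
  have [N _ hN] := near_infty_natSinv_lt (PosNum m0).
  have {hN} hN := hN N (leqnn N).
  have N0 : 0 < N.+1%:R^-1 :> R by rewrite invr_gt0.
  have Nm : N.+1%:R^-1 + N.+1%:R^-1 <= Num.min e d.
    by rewrite [leRHS]splitr lerD// ltW.
  have [|q0 /itvP hq0] := @rat_in_itvoo R t (t + N.+1%:R^-1); first by rewrite ltrDl.
  have [q hq] := rV_near_rat x N0.
  have tq : ball (ratr q0 : R) N.+1%:R^-1 t.
    by rewrite -ball_normE /ball_ /= ger0_norm ?subr_ge0 ?hq0// ltrBlDl hq0.
  exists (q0, q, N); last by split => //=; apply: ball_sym.
  move=> [s y] [/= sq yq]; apply: PQU; split => /=.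
    apply: eP; apply: (@le_ball _ _ _ (N.+1%:R^-1 + N.+1%:R^-1)).
      by apply: (le_trans Nm); rewrite ge_min lexx.
    by apply: ball_triangle sq; exact: ball_sym.
  apply: dQ; apply: (@le_ball _ _ _ (N.+1%:R^-1 + N.+1%:R^-1)).
    by apply: (le_trans Nm); rewrite ge_min lexx orbT.
  by apply: ball_triangle yq.
rewrite bigcup_mkcond; apply: countable_bigcupT_measurable => [|w].
  exact: countableP.
case: ifP => // _; apply: measurableX; first by apply: open_measurable; exact: ball_open.
by apply: open_measurable_borel; exact: ball_open.
Qed.


(* [integral_rV] is only an iterated integral; a measure representing it gives
   access to the theorems of Lebesgue integration. *)
Definition is_lebesgue_rV n
    (L : {measure set (borelType 'rV[R]_n) -> \bar R}) : Prop :=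
  (forall f : 'rV[R]_n -> \bar R,
     measurable_fun [set: borelType 'rV[R]_n] (f : borelType _ -> \bar R) ->
     (forall x, (0 <= f x)%E) -> integral_rV f = \int[L]_x f x)%E /\
  (forall (c : 'rV[R]_n) (r : R), 0 < r -> L (ball c r) = ((2 * r) ^+ n)%:E).

Lemma sigma_finite_balls n (L : {measure set (borelType 'rV[R]_n) -> \bar R}) :
  is_lebesgue_rV L -> sigma_finite setT L.
Proof.
move=> [_ Lb]; exists (fun k => ball (0 : 'rV[R]_n) k.+1%:R).
  apply/seteqP; split=> x //= _.
  exists (Num.truncn `|x|) => //=.
  by rewrite -ball_normE /ball_/= sub0r normrN truncnS_gt.
move=> k; split; last by rewrite Lb ?ltry.
by apply: open_measurable_borel; exact: ball_open.
Qed.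

(** Induction on n: the product of Lebesgue measure on R with the measure in dimension n, pushed
    forward along [row_mx], represents the iterated integral by Tonelli's theorem. The volume of
    balls is carried along because it yields the sigma-finiteness that Tonelli's theorem asks for;
    balls of the sup norm are cubes, so their volumes multiply. *)
Lemma lebesgue_rV_exists n : exists L : {measure set (borelType 'rV[R]_n) -> \bar R},
  is_lebesgue_rV L.
Proof.
elim: n => [|n [L /[dup] /sigma_finite_balls sfL [intL ballL]]].
  (* R^0 is a point, with a unit mass. *)
  exists (@dirac _ (borelType 'rV[R]_0) 0 R : {measure set _ -> \bar R}).
  split=> [f mf f0 /=|c r r0 /=].
    by rewrite integral_dirac// diracT mul1e.
  by rewrite expr0 diracE mem_set//; apply/rV_ballP => // -[].
pose sigma_mixin := isSigmaFinite.Build _ _ _ (Measure.sort L) sfL.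
pose sfin_mixin := isSFinite.Build _ _ _ (Measure.sort L)
  (sfinite_measure_sigma_finite sfL).
pose L' : {sigma_finite_measure set (borelType 'rV[R]_n) -> \bar R} :=
  HB.pack (Measure.sort L) sigma_mixin sfin_mixin.
pose mr0 (z : (measurableTypeR R * borelType 'rV[R]_n)%type) : borelType 'rV[R]_n.+1 :=
  row_mx z.1%:M z.2.
have mr : measurable_fun [set: measurableTypeR R * borelType 'rV[R]_n] mr0.
  exact: row_mx_measurable.
exists (pushforward (@lebesgue_measure R \x L')%E mr0).
split.
- move=> f mf f0; rewrite (@ge0_integral_pushforward _ _ _ _ _ mr0 mr)//= preimage_setT.
  have mfr : measurable_fun setT (f \o mr0) by exact: measurableT_comp.
  rewrite -[RHS]/(\int[(@lebesgue_measure R \x L')%E]_z (f \o mr0) z)%E.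
  rewrite (@fubini_tonelli1 _ _ _ _ _ (@lebesgue_measure R) L' (f \o mr0))//; last by move=> z; exact: f0.
  apply: eq_integral => t _; rewrite intL//.
  + rewrite (_ : (fun _ => _) = (f \o mr0) \o pair t)//.
    by apply: measurableT_comp => //; exact: measurable_pair1.
- move=> c r r0 /=.
  have l0 : lshift n (0 : 'I_1) = 0 :> 'I_n.+1 by exact: val_inj.
  rewrite /pushforward (_ : _ @^-1` _ =
      ball (c 0 0 : R) r `*` ball (\row_k c 0 (rshift 1 k) : 'rV[R]_n) r); last first.
    apply/seteqP; split=> [[t x] hx|[t x] [/= ct cx]].
      have h : forall k : 'I_(1 + n), `|c 0 k - (row_mx t%:M x : 'rV[R]_(1 + n)) 0 k| < r.
        exact: ((@rV_ballP (1 + n) c (row_mx t%:M x) r r0).1 hx).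
      split=> /=.
        by have := h (lshift n (0 : 'I_1)); rewrite (@row_mxEl _ 1 1 n) mxE eqxx mulr1n l0 -ball_normE.
      apply/rV_ballP => // k.
      by have := h (rshift 1 k); rewrite (@row_mxEr _ 1 1 n) mxE.
    apply: ((@rV_ballP (1 + n) c (row_mx t%:M x) r r0).2) => k.
    case: (split_ordP (k : 'I_(1 + n))) => j ->.
      by rewrite (@row_mxEl _ 1 1 n) mxE ord1 eqxx mulr1n l0; move: ct; rewrite -ball_normE.
    rewrite (@row_mxEr _ 1 1 n).
    by have /(_ j) := (rV_ballP _ _ r0).1 cx; rewrite mxE.
  have mB1 : measurable (ball (c 0 0 : R) r).
    by apply: open_measurable; exact: ball_open.
  have mB2 : measurable (ball (\row_k c 0 (rshift 1 k)) r : set (borelType 'rV[R]_n)).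
    by apply: open_measurable_borel; exact: ball_open.
  have := @product_measure1E _ _ _ _ _ (@lebesgue_measure R) L' _ _ mB1 mB2.
  rewrite /= => ->; rewrite ballL// lebesgue_measure_ball ?ltW// -EFinM exprS.
  by rewrite mulr_natl.
Unshelve. exact: mr.
Qed.


(** The image measure agrees with Lebesgue measure on half-open intervals, and these characterise
    it. *)
Lemma lebesgue_measure_shift (c : R) (A : set R) : measurable A ->
  lebesgue_measure ((fun t : R => t + c) @^-1` A) = lebesgue_measure A.
Proof.
move=> mA.
pose S (t : measurableTypeR R) : measurableTypeR R := t + c.
have mS : measurable_fun setT S by apply: measurable_funD.
apply/esym; rewrite -[RHS]/(pushforward lebesgue_measure S A).
apply: lebesgue_measure_unique => //= _ [[a b]] _ <-.
rewrite /pushforward.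
have -> : S @^-1` `]a, b] = `]a - c, b - c]%classic.
  by apply/seteqP; split=> t /=; rewrite !in_itv/= ltrBlDr lerBrDr.
rewrite !lebesgue_measure_itv/= !lte_fin ltrD2r.
by case: ifP => // _; rewrite -!EFinD; congr EFin; lra.
Qed.

Lemma ge0_integral_shift (c : R) (f : R -> \bar R) :
  measurable_fun [set: R] f -> (forall t, 0 <= f t)%E ->
  (\int[@lebesgue_measure R]_t f (t + c)%R = \int[@lebesgue_measure R]_t f t)%E.
Proof.
move=> mf f0.
pose S (t : measurableTypeR R) : measurableTypeR R := t + c.
have mS : measurable_fun setT S by apply: measurable_funD.
have := @ge0_integral_pushforward _ _ _ _ _ S mS lebesgue_measure setT f.
rewrite preimage_setT => <-//.
by apply: eq_measure_integral => A mA _; exact: lebesgue_measure_shift.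
Qed.

Lemma measurable_rV_shift n (v : 'rV[R]_n) :
  measurable_fun [set: borelType 'rV[R]_n]
    ((fun x => x + v) : borelType 'rV[R]_n -> borelType 'rV[R]_n).
Proof.
apply: continuous_measurable_borel => [|x _]; first exact: openT.
by apply: (@continuousD _ _ _ id (cst v)); [exact: cvg_id|exact: cst_continuous].
Qed.

Lemma measurable_row_mx_section n (t : R) (f : 'rV[R]_n.+1 -> \bar R) :
  measurable_fun [set: borelType 'rV[R]_n.+1] (f : borelType _ -> \bar R) ->
  measurable_fun [set: borelType 'rV[R]_n]
    ((fun x => f (row_mx t%:M x)) : borelType _ -> \bar R).
Proof.
move=> mf.
pose mr (z : (measurableTypeR R * borelType 'rV[R]_n)%type) : borelType 'rV[R]_n.+1 :=
  row_mx z.1%:M z.2.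
have mfr : measurable_fun setT (f \o mr).
  by apply: measurableT_comp => //; exact: row_mx_measurable.
rewrite (_ : (fun _ => _) = (f \o mr) \o pair t)//.
by apply: measurableT_comp => //; exact: measurable_pair1.
Qed.

Lemma measurable_integral_rV n (f : 'rV[R]_n.+1 -> \bar R) :
  measurable_fun [set: borelType 'rV[R]_n.+1] (f : borelType _ -> \bar R) ->
  (forall x, (0 <= f x)%E) ->
  measurable_fun [set: R]
    (fun t : R => integral_rV (fun x : 'rV[R]_n => f (row_mx t%:M x))).
Proof.
move=> mf f0; have [L /[dup] /sigma_finite_balls sfL [intL _]] := lebesgue_rV_exists n.
pose sigma_mixin := isSigmaFinite.Build _ _ _ (Measure.sort L) sfL.
pose sfin_mixin := isSFinite.Build _ _ _ (Measure.sort L)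
  (sfinite_measure_sigma_finite sfL).
pose L' : {sigma_finite_measure set (borelType 'rV[R]_n) -> \bar R} :=
  HB.pack (Measure.sort L) sigma_mixin sfin_mixin.
rewrite (_ : (fun t => _) = (fun t => \int[L']_x f (row_mx t%:M x))%E); last first.
  by apply/funext => t; rewrite intL//; exact: measurable_row_mx_section.
pose mr (z : (measurableTypeR R * borelType 'rV[R]_n)%type) : borelType 'rV[R]_n.+1 :=
  row_mx z.1%:M z.2.
have mfr : measurable_fun setT (f \o mr).
  by apply: measurableT_comp => //; exact: row_mx_measurable.
apply: (@measurable_fun_fubini_tonelli_F _ _ _ _ _ L' (f \o mr)) => //.
by move=> z; exact: f0.
Qed.

(** An iterated integral can be translated one coordinate at a time: the inductive hypothesis moves
    the last n coordinates under the outer integral, and translation invariance on R moves the first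
    one. *)
Lemma integral_rV_shift n (v : 'rV[R]_n) (f : 'rV[R]_n -> \bar R) :
  measurable_fun [set: borelType 'rV[R]_n] (f : borelType _ -> \bar R) ->
  (forall x, (0 <= f x)%E) ->
  integral_rV (fun x => f (x + v)) = integral_rV f.
Proof.
elim: n v f => [|n IH] v f mf f0 /=.
  by congr f; apply/rowP => -[].
pose v0 := v 0 0; pose v' : 'rV[R]_n := \row_k v 0 (rshift 1 k).
transitivity (\int[@lebesgue_measure R]_t
  integral_rV (fun x : 'rV[R]_n => f (row_mx (t + v0)%:M x : 'rV[R]_n.+1)))%E.
  apply: eq_integral => t _.
  rewrite -(IH v' (fun x : 'rV[R]_n => f (row_mx (t + v0)%:M x : 'rV[R]_n.+1)))//.
  - congr integral_rV; apply/funext => x; congr f; apply/rowP => k.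
    have l0 : lshift n (0 : 'I_1) = 0 :> 'I_n.+1 by exact: val_inj.
    rewrite mxE; case: (split_ordP (k : 'I_(1 + n))) => j ->.
      by rewrite !(@row_mxEl _ 1 1 n) !mxE ord1 eqxx !mulr1n l0.
    by rewrite !(@row_mxEr _ 1 1 n) !mxE.
  - exact: measurable_row_mx_section.
rewrite (@ge0_integral_shift v0 (fun t => integral_rV (fun x : 'rV[R]_n =>
   f (row_mx t%:M x : 'rV[R]_n.+1))))//; first exact: measurable_integral_rV.
move=> t; have [L [intL _]] := lebesgue_rV_exists n.
by rewrite intL//; [exact: integral_ge0|exact: measurable_row_mx_section].
Qed.

Lemma ge0_integral_lebesgue_rV_shift n
    (L : {measure set (borelType 'rV[R]_n) -> \bar R})
    (v : 'rV[R]_n) (f : 'rV[R]_n -> \bar R) : is_lebesgue_rV L ->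
  measurable_fun [set: borelType 'rV[R]_n] (f : borelType _ -> \bar R) ->
  (forall x, (0 <= f x)%E) ->
  (\int[L]_x f (x + v)%R = \int[L]_x f x)%E.
Proof.
move=> [intL _] mf f0; rewrite -!intL//; first exact: integral_rV_shift.
exact: (measurableT_comp mf (@measurable_rV_shift n v)).
Qed.

Lemma integral_lebesgue_rV_shift n
    (L : {measure set (borelType 'rV[R]_n) -> \bar R})
    (v : 'rV[R]_n) (f : 'rV[R]_n -> \bar R) : is_lebesgue_rV L ->
  measurable_fun [set: borelType 'rV[R]_n] (f : borelType _ -> \bar R) ->
  (\int[L]_x f (x + v)%R = \int[L]_x f x)%E.
Proof.
move=> LL mf; rewrite integralE [RHS]integralE.
congr (_ - _)%E.
- rewrite -(@ge0_integral_lebesgue_rV_shift n L v (f^\+)%E LL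
    (measurable_funepos mf) (funepos_ge0 f)).
  by apply: eq_integral => x _; rewrite ?funeposE ?funenegE.
- rewrite -(@ge0_integral_lebesgue_rV_shift n L v (f^\-)%E LL
    (measurable_funeneg mf) (funeneg_ge0 f)).
  by apply: eq_integral => x _; rewrite ?funeposE ?funenegE.
Qed.

End rowspace.

(** * Functions of class C^1 on R^n *)

Section calculus.
Variable R : realType.

Lemma differentiable_littleo (V W : normedModType R) (f : V -> W) (x : V) :
  differentiable f x -> forall e, 0 < e ->
    \forall h \near (0 : V), `|f (h + x) - f x - 'd f x h| <= e * `|h|.
Proof.
move=> /diff_locally/eqaddoP/(_ _ _) h e e0.
have := h e e0; apply: filterS => y.
by rewrite /= opprD addrA.
Qed.

Lemma differentiable_near_eq (V W : normedModType R) (f g : V -> W) (x : V) :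
  (\forall y \near x, f y = g y) -> differentiable f x -> differentiable g x.
Proof.
move=> fg df.
have dfc : continuous ('d f x) by exact: diff_continuous.
have fgx : f x = g x by exact: (nbhs_singleton fg).
have gE : g \o shift x = cst (g x) + 'd f x +o_ 0 id.
  apply/eqaddoP => e e0.
  have h1 := differentiable_littleo df e0.
  have h2 : \forall h \near (0 : V), f (h + x) = g (h + x).
    by move: fg; rewrite (near_shift 0 x); apply: filterS => y /=; rewrite subr0.
  near=> h.
  have -> : (g \o shift x - (cst (g x) + 'd f x)) h = f (h + x) - f x - 'd f x h.
    rewrite fgx; have -> : f (h + x) = g (h + x) by near: h.
    by rewrite -addrA -opprD.
  by near: h.
apply/diff_locallyP; rewrite (diff_unique dfc gE); split => //.
Unshelve. all: by end_near. Qed.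

Lemma continuous_near_eq (T U : topologicalType) (f g : T -> U) (x : T) :
  (\forall y \near x, f y = g y) -> {for x, continuous f} -> {for x, continuous g}.
Proof.
move=> fg cf; have fgx : f x = g x by exact: (nbhs_singleton fg).
rewrite /prop_for /continuous_at -fgx.
by apply: cvg_trans cf; apply: near_eq_cvg; apply: filterS fg => y ->.
Qed.

(** Differentiability is asked near x, so that the formulas for partial derivatives of products and
    composites hold on a neighbourhood; continuity of the partials is asked at x only. This is
    stable under the usual operations and local enough to be checked in a chart. *)
Definition C1at n (f : 'rV[R]_n -> R) (x : 'rV[R]_n) : Prop :=
  (\forall y \near x, differentiable f y) /\
  forall k, {for x, continuous ('D_(delta_mx 0 k) f)}.

Lemma C1at_differentiable n (f : 'rV[R]_n -> R) x : C1at f x -> differentiable f x.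
Proof. by move=> [/nbhs_singleton]. Qed.

Lemma C1at_continuous n (f : 'rV[R]_n -> R) x : C1at f x -> {for x, continuous f}.
Proof. by move=> /C1at_differentiable/differentiable_continuous. Qed.

Lemma C1at_near_eq n (f g : 'rV[R]_n -> R) x :
  (\forall y \near x, f y = g y) -> C1at f x -> C1at g x.
Proof.
move=> /nbhs_interior fg [df cf]; split=> [|k].
  near=> y; apply: (@differentiable_near_eq _ _ f); by near: y.
apply: continuous_near_eq (cf k).
near=> y; apply: near_eq_derive; by near: y.
Unshelve. all: by end_near. Qed.

Lemma C1at_near n (f : 'rV[R]_n -> R) x (U : set 'rV[R]_n) : open U ->
  U x -> (forall y, U y -> differentiable f y) ->
  (forall k, {for x, continuous ('D_(delta_mx 0 k) f)}) -> C1at f x.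
Proof.
move=> oU Ux df cf; split => //.
by apply: (filterS df); exact: open_nbhs_nbhs.
Qed.

Lemma C1at_cst n (a : R) (x : 'rV[R]_n) : C1at (cst a) x.
Proof.
split=> [|k]; first by near=> y; exact: differentiable_cst.
rewrite (_ : 'D_ _ _ = cst 0); first exact: cst_continuous.
by apply/funext => y; rewrite derive_cst.
Unshelve. all: by end_near. Qed.

Lemma C1atD n (f g : 'rV[R]_n -> R) x : C1at f x -> C1at g x ->
  C1at (fun y => f y + g y) x.
Proof.
move=> [df cf] [dg cg]; split=> [|k].
  by near=> y; apply: differentiableD; near: y.
apply: (@continuous_near_eq _ _
    (fun y => 'D_(delta_mx 0 k) f y + 'D_(delta_mx 0 k) g y)).
  near=> y; rewrite -deriveD//; apply: diff_derivable; by near: y.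
by apply: continuousD; [exact: cf|exact: cg].
Unshelve. all: by end_near. Qed.

Lemma C1atM n (f g : 'rV[R]_n -> R) x : C1at f x -> C1at g x ->
  C1at (fun y => f y * g y) x.
Proof.
move=> /[dup] Cf [df cf] /[dup] Cg [dg cg]; split=> [|k].
  by near=> y; apply: differentiableM; near: y.
apply: (@continuous_near_eq _ _ (fun y =>
    f y * 'D_(delta_mx 0 k) g y + g y * 'D_(delta_mx 0 k) f y)).
  near=> y; rewrite -[LHS]deriveM//; apply: diff_derivable; by near: y.
apply: continuousD; apply: continuousM; first exact: C1at_continuous.
- exact: cg.
- exact: C1at_continuous.
- exact: cf.
Unshelve. all: by end_near. Qed.

Lemma C1at_sum n (I : Type) (s : seq I) (P : pred I) (f : I -> 'rV[R]_n -> R) x :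
  (forall i, P i -> C1at (f i) x) -> C1at (fun y => \sum_(i <- s | P i) f i y) x.
Proof.
move=> Cf; elim: s => [|i s IH].
  rewrite (_ : (fun y => _) = cst 0); first exact: C1at_cst.
  by apply/funext => y; rewrite big_nil.
rewrite (_ : (fun y => _) = (fun y => if P i then f i y + \big[+%R/0]_(j <- s | P j) f j y
    else \big[+%R/0]_(j <- s | P j) f j y)); last first.
  by apply/funext => y; rewrite big_cons.
by case: (boolP (P i)) => // Pi; apply: C1atD => //; exact: Cf.
Qed.

Lemma C1at_prod n (I : Type) (s : seq I) (P : pred I) (f : I -> 'rV[R]_n -> R) x :
  (forall i, P i -> C1at (f i) x) -> C1at (fun y => \prod_(i <- s | P i) f i y) x.
Proof.
move=> Cf; elim: s => [|i s IH].
  rewrite (_ : (fun y => _) = cst 1); first exact: C1at_cst.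
  by apply/funext => y; rewrite big_nil.
rewrite (_ : (fun y => _) = (fun y => if P i then f i y * \big[*%R/1]_(j <- s | P j) f j y
    else \big[*%R/1]_(j <- s | P j) f j y)); last first.
  by apply/funext => y; rewrite big_cons.
by case: (boolP (P i)) => // Pi; apply: C1atM => //; exact: Cf.
Qed.

Lemma continuous_sum (T : topologicalType) (I : Type) (s : seq I) (P : pred I)
    (f : I -> T -> R) x :
  (forall i, P i -> {for x, continuous (f i)}) ->
  {for x, continuous (fun y => \sum_(i <- s | P i) f i y)}.
Proof.
move=> cf; elim: s => [|i s IH].
  rewrite (_ : (fun y => _) = cst 0); first exact: cst_continuous.
  by apply/funext => y; rewrite big_nil.
rewrite (_ : (fun y => _) = (fun y => if P i then f i y + \big[+%R/0]_(j <- s | P j) f j y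
    else \big[+%R/0]_(j <- s | P j) f j y)); last first.
  by apply/funext => y; rewrite big_cons.
by case: (boolP (P i)) => // Pi; apply: continuousD => //; exact: cf.
Qed.

Lemma derive_comp_real n (f : 'rV[R]_n -> R) (h : R -> R) (x v : 'rV[R]_n) :
  differentiable f x -> derivable h (f x) 1 ->
  'D_v (h \o f) x = h^`()%classic (f x) * 'D_v f x.
Proof.
move=> df /[dup] dh /derivable1_diffP dh'.
rewrite !deriveE//; last exact: differentiable_comp.
by rewrite diff_comp//= deriv1E//= mulrC.
Qed.

Lemma C1at_comp_real n (f : 'rV[R]_n -> R) (h : R -> R) (x : 'rV[R]_n) :
  C1at f x -> (\forall t \near f x, derivable h t 1) ->
  {for f x, continuous (h^`()%classic)} -> C1at (h \o f) x.
Proof.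
move=> /[dup] Cf [df cf] dh ch.
have dhf : \forall y \near x, derivable h (f y) 1 by have h1 := C1at_continuous Cf; have := h1 _ dh.
split=> [|k].
  near=> y; apply: differentiable_comp; first by near: y.
  by apply/derivable1_diffP; near: y.
apply: (@continuous_near_eq _ _ (fun y =>
    h^`()%classic (f y) * 'D_(delta_mx 0 k) f y)).
  by near=> y; rewrite derive_comp_real//; near: y.
apply: continuousM; last exact: cf.
by apply: continuous_comp => //; exact: C1at_continuous.
Unshelve. all: by end_near. Qed.

Lemma derive_coord m n (f : 'rV[R]_m -> 'rV[R]_n) x v (l : 'I_n) :
  derivable f x v -> 'D_v f x 0 l = 'D_v (fun y => f y 0 l) x.
Proof. by move=> df; rewrite derive_mx// mxE. Qed.

Lemma diff_partials n (f : 'rV[R]_n -> R) x v : differentiable f x ->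
  'd f x v = \sum_k v 0 k * 'D_(delta_mx 0 k) f x.
Proof.
move=> df; rewrite {1}[v]row_sum_delta linear_sum.
by apply: eq_bigr => k _; rewrite linearZ/= deriveE.
Qed.

Lemma derive_partials n (f : 'rV[R]_n -> R) x v : differentiable f x ->
  'D_v f x = \sum_k v 0 k * 'D_(delta_mx 0 k) f x.
Proof. by move=> df; rewrite deriveE// diff_partials. Qed.

Lemma differentiable_coord_comp (V : normedModType R) m n (f : V -> 'M[R]_(m, n)) x i l :
  differentiable f x -> differentiable (fun y => f y i l) x.
Proof.
move=> df; apply: (@differentiable_comp _ _ _ _ f (fun M => M i l)) => //.
exact: differentiable_coord.
Qed.

Lemma derive_comp_rV m n (f : 'rV[R]_n -> R) (T : 'rV[R]_m -> 'rV[R]_n) x v :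
  differentiable T x -> differentiable f (T x) ->
  'D_v (f \o T) x = \sum_l 'D_v (fun y => T y 0 l) x * 'D_(delta_mx 0 l) f (T x).
Proof.
move=> dT df; rewrite deriveE; last exact: differentiable_comp.
rewrite diff_comp//= diff_partials//; apply: eq_bigr => l _.
rewrite -(derive_coord l); last exact: diff_derivable.
by rewrite (deriveE v dT).
Qed.

Lemma C1at_comp m n (f : 'rV[R]_n -> R) (T : 'rV[R]_m -> 'rV[R]_n) x :
  (\forall y \near x, differentiable T y) ->
  (forall l k, {for x, continuous ('D_(delta_mx 0 k) (fun y => T y 0 l))}) ->
  C1at f (T x) -> C1at (f \o T) x.
Proof.
move=> dT cT /[dup] Cf [df cf].
have Tc : {for x, continuous T}.
  by apply: differentiable_continuous; exact: (nbhs_singleton dT).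
have dfT : \forall y \near x, differentiable f (T y) by have := Tc _ df.
split=> [|k].
  by near=> y; apply: differentiable_comp; near: y.
apply: (@continuous_near_eq _ _ (fun y =>
   \sum_l 'D_(delta_mx 0 k) (fun y => T y 0 l) y * 'D_(delta_mx 0 l) f (T y))).
  near=> y; rewrite [RHS](@derive_comp_rV _ _ f T)//; by near: y.
apply: continuous_sum => l _.
apply: continuousM; first exact: cT.
exact: (@continuous_comp _ _ _ T ('D_(delta_mx 0 l) f) x Tc (cf l)).
Unshelve. all: by end_near. Qed.

End calculus.

(** * Boundedness and integrability on compact sets *)

Section compact_support.
Variable R : realType.

Lemma compact_continuous_bounded (T : topologicalType) (K : set T) (f : T -> R) :
  compact K -> (forall x, K x -> {for x, continuous f}) ->
  exists2 B, 0 <= B & forall x, K x -> `|f x| <= B.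
Proof.
move=> cK cf.
have [->|/set0P K0] := eqVneq K set0; first by exists 0.
have cnf : {within K, continuous (fun x => `|f x| : R)}.
  apply: continuous_in_subspaceT => x /set_mem Kx.
  by apply: continuous_comp; [exact: cf|exact: norm_continuous].
have [c _ hc] := compact_EVT_max K0 cK cnf.
by exists `|f c| => // x Kx; apply: hc; rewrite inE.
Qed.

Lemma integrable_bounded_support d (T : measurableType d)
    (mu : {measure set T -> \bar R}) (K : set T) (f : T -> R) (B : R) :
  measurable K -> (mu K < +oo)%E -> measurable_fun setT f ->
  (forall x, K x -> `|f x| <= B) -> (forall x, ~ K x -> f x = 0) ->
  mu.-integrable setT (EFin \o f).
Proof.
move=> mK muK mf fB f0.
have -> : EFin \o f = (EFin \o f) \_ K.
  apply/funext => x; rewrite /patch; case: ifPn => //.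
  by move=> /negP; rewrite inE => /f0 /= ->.
apply/(integrable_mkcond _ mK).
apply: measurable_bounded_integrable => //; first exact: measurable_funTS.
exists B; split; first exact: num_real.
by move=> x Bx y Ky /=; rewrite (le_trans (fB _ Ky))// ltW.
Qed.

End compact_support.

Section lines.
Variable R : realType.

Lemma is_derive_line (V W : normedModType R) (F : V -> W) (x v : V) (t : R) :
  derivable F (x + t *: v) v ->
  is_derive t (1 : R) (fun s => F (x + s *: v)) ('D_v F (x + t *: v)).
Proof.
move=> dF.
have E : (fun h : R => h^-1 *: (((fun s => F (x + s *: v)) \o shift t) (h *: 1) -
      F (x + t *: v))) =
    (fun h => h^-1 *: ((F \o shift (x + t *: v)) (h *: v) - F (x + t *: v))).
  apply/funext => h /=; congr (_ *: (F _ - _)).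
  by rewrite scalerDl addrCA [h *: 1]mulr1.
by split; rewrite /derivable /derive E.
Qed.

End lines.

(** * Integrals of partial derivatives *)

Section integral_derive.
Variables (R : realType) (n : nat).
Variable L : {measure set (borelType 'rV[R]_n) -> \bar R}.
Hypothesis LL : is_lebesgue_rV L.

Lemma line_continuous (F : 'rV[R]_n -> R) (x v : 'rV[R]_n) :
  continuous F -> continuous (fun s : R => F (x + s *: v)).
Proof.
move=> cF s; apply: (@continuous_comp _ _ _ (fun s : R => x + s *: v) F); last exact: cF.
apply: (@continuousD _ _ _ (cst x) (fun s : R => s *: v)); first exact: cst_continuous.
exact: scalel_continuous.
Qed.

(* The difference quotients of F have integral 0 by translation invariance, and
   they converge dominatedly. *)
Lemma integral_derive0 (F : 'rV[R]_n -> R) (k : 'I_n) (r : R) :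
  (forall x, C1at F x) -> (forall x, r < `|x| -> F x = 0) ->
  L.-integrable setT (fun x => ('D_(delta_mx 0 k) F x)%:E) /\
  (\int[L]_x ('D_(delta_mx 0 k) F x)%:E = 0)%E.
Proof.
move=> CF F0; set v : 'rV[R]_n := delta_mx 0 k.
wlog r0 : r F0 / 0 < r.
  move=> wl; apply: (wl (`|r| + 1)); last by rewrite ltr_wpDl.
  by move=> x xr; apply: F0; rewrite (le_lt_trans (ler_norm r))// (lt_trans _ xr)// ltrDl.
have cF : continuous F by move=> x; exact: C1at_continuous.
have cDF : continuous ('D_v F) by move=> x; have [_] := CF x; exact.
have v1 : `|v| <= 1.
  rewrite [leLHS]/Num.norm/= mx_normrE; apply/bigmax_leP; split => // ij _.
  by rewrite mxE normr_nat lern1 leq_b1.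
have DF0 x : r < `|x| -> 'D_v F x = 0.
  move=> rx; rewrite (@near_eq_derive _ _ _ F (cst 0)) ?derive_cst//.
  have h1 : \forall t \near `|x|, r < t by exact: lt_nbhsr.
  have h2 := @norm_continuous _ _ x _ h1.
  by near=> y; rewrite F0//; near: y.
(* F vanishes beyond radius r and the translations below have length at most 1, so all the
   difference quotients vanish off this ball. *)
pose K := closed_ball (0 : 'rV[R]_n) (r + 2).
have KE x : K x <-> `|x| <= r + 2.
  by rewrite /K closed_ballE ?addr_gt0// /closed_ball_/= sub0r normrN.
have cK : compact K.
  apply: bounded_closed_compact; last exact: closed_ball_closed.
  exists (r + 2); split; first exact: num_real.
  by move=> y ry x /KE xr; apply: (le_trans xr); exact: ltW.
have mK : measurable (K : set (borelType 'rV[R]_n)).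
  by apply: closed_measurable_borel; exact: closed_ball_closed.
have LK : (L K < +oo)%E.
  have [_ Lb] := LL; apply: (@le_lt_trans _ _ (L (ball (0 : 'rV[R]_n) (r + 3)))).
    apply: le_measure; rewrite ?inE//.
      by apply: open_measurable_borel; exact: ball_open.
    move=> x /KE xr; rewrite -ball_normE /ball_/= sub0r normrN (le_lt_trans xr)//.
    by rewrite ltrD2l ltr_nat.
  by rewrite Lb ?ltry// addr_gt0.
have [B B0 DFB] : exists2 B, 0 <= B & forall x, K x -> `|'D_v F x| <= B.
  by apply: compact_continuous_bounded => // x _; exact: cDF.
have {}DFB x : `|'D_v F x| <= B.
  case: (leP `|x| (r + 2)) => [/KE/DFB//|xr].
  by rewrite DF0 ?normr0// (le_lt_trans _ xr)// lerDl.
have mDF : measurable_fun [set: borelType 'rV[R]_n] ('D_v F : borelType 'rV[R]_n -> R).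
  by apply: continuous_measurable_real => [|x _]; [exact: openT|exact: cDF].
have mF : measurable_fun [set: borelType 'rV[R]_n] (F : borelType 'rV[R]_n -> R).
  by apply: continuous_measurable_real => [|x _]; [exact: openT|exact: cF].
have [BF _ FB] : exists2 B, 0 <= B & forall x, K x -> `|F x| <= B.
  by apply: compact_continuous_bounded => // x _; exact: cF.
have iF : L.-integrable setT (EFin \o F).
  apply: (integrable_bounded_support mK LK mF FB) => x Kx.
  by apply: F0; rewrite ltNge; apply/negP => xr; apply/Kx/KE; rewrite (le_trans xr)// lerDl.
pose h (m : nat) : R := m.+1%:R^-1.
have h0 m : 0 < h m by rewrite invr_gt0.
have h1 m : h m <= 1 by rewrite invf_le1// ler1n.
pose q m x := (h m)^-1 * (F (x + h m *: v) - F x).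
have mFs m : measurable_fun [set: borelType 'rV[R]_n]
    ((fun x => F (x + h m *: v)) : borelType 'rV[R]_n -> R).
  exact: (measurableT_comp mF (@measurable_rV_shift R n (h m *: v))).
have mq m : measurable_fun [set: borelType 'rV[R]_n] (q m : borelType 'rV[R]_n -> R).
  by apply: measurable_funM => //; apply: measurable_funB.
(* By the mean value theorem on a segment in the direction v, the quotient is a value of ['D_v F],
   hence a bound uniform in m. *)
have qB m x : `|q m x| <= B.
  have dline t : is_derive t (1 : R) (fun s => F (x + s *: v)) ('D_v F (x + t *: v)).
    by apply: is_derive_line; apply: diff_derivable; exact: C1at_differentiable.
  have [c _] := @MVT_segment R (fun s => F (x + s *: v)) (fun s => 'D_v F (x + s *: v))
    0 (h m) (ltW (h0 m)) (fun t _ => dline t)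
    (continuous_subspaceT (line_continuous cF)).
  rewrite scale0r addr0 subr0 /q => ->.
  by rewrite mulrC mulfK ?gt_eqF.
have q0 m x : ~ K x -> q m x = 0.
  move=> nK; have xr : r + 2 < `|x| by rewrite ltNge; apply/negP => /KE.
  have := ler_normD (x + h m *: v) (- (h m *: v)); rewrite addrK normrN => hn.
  have hv : `|h m *: v| <= 1.
    by rewrite normrZ (gtr0_norm (h0 m)) mulr_ile1// ltW.
  by rewrite /q !F0 ?subrr ?mulr0//; lra.
have iq m : (\int[L]_x (q m x)%:E = 0)%E.
  have E : (fun x => (q m x)%:E) = (fun x => (h m)^-1%:E *
      ((F (x + h m *: v))%:E - (F x)%:E))%E by [].
  have iFs : L.-integrable setT (fun x => (F (x + h m *: v))%:E).
    apply/integrableP; split; first exact/measurable_EFinP.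
    have /integrableP[_] := iF; apply: le_lt_trans.
    rewrite (@ge0_integral_lebesgue_rV_shift R n L (h m *: v)
      (fun x => `|(F x)%:E|)%E)//.
    by apply: measurableT_comp => //; exact/measurable_EFinP.
  rewrite E integralZl//; last exact: integrableB.
  rewrite integralB// (@integral_lebesgue_rV_shift R n L (h m *: v) (EFin \o F))//.
    by rewrite subee ?mule0//; exact: integrable_fin_num.
  exact/measurable_EFinP.
pose g x : \bar R := (B * \1_K x)%:E.
have ig : L.-integrable setT g.
  apply: (@integrable_bounded_support R _ _ L K (fun x => B * \1_K x) B) => //.
  - by apply: measurable_funM => //; exact: measurable_indic.
  - by move=> x Kx; rewrite indicE mem_set// mulr1 ger0_norm.
  - by move=> x Kx; rewrite indicE memNset// mulr0.
have cq x : q ^~ x @ \oo --> 'D_v F x.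
  have dFx : derivable F x v by apply: diff_derivable; exact: C1at_differentiable.
  have hh : h @ \oo --> 0^'.
    move=> A; rewrite /dnbhs/= /within/= => A0.
    suff : \forall m \near \oo, A (h m) by [].
    have A1 : \forall m \near \oo, h m != 0 -> A (h m) := @cvg_harmonic R _ A0.
    by apply: filterS A1 => m; apply; rewrite gt_eqF.
  have := cvg_comp h _ hh dFx; apply: cvg_trans; apply: near_eq_cvg.
  by near=> m; rewrite /q /= [x + _]addrC.
have [] := @dominated_convergence _ _ _ L setT measurableT (fun m x => (q m x)%:E)
  (fun x => ('D_v F x)%:E) g.
- by move=> m; exact/measurable_EFinP.
- exact/measurable_EFinP.
- by apply: aeW => x _; apply: cvg_EFin; [exact: nearW|exact: cq].
- exact: ig.
- apply: aeW => x m _; rewrite /g lee_fin indicE.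
  have [Kx|Kx] := pselect (K x); first by rewrite mem_set// mulr1.
  by rewrite memNset// q0// normr0 mulr0.
move=> iD _ cI; split; first exact: iD.
have {}cI := cvg_lim (@ereal_hausdorff R) cI; rewrite -cI.
rewrite (_ : (fun m => _) = cst 0%E); last by apply/funext => m; rewrite iq.
by apply: cvg_lim; [exact: ereal_hausdorff|exact: cvg_cst].
Unshelve. all: by end_near. Qed.

End integral_derive.

(** * Smooth functions on R^n *)

Section smooth.
Variable R : realType.

Lemma smooth_on_differentiable n (W : normedModType R) (U : set 'rV[R]_n)
    (f : 'rV[R]_n -> W) x : smooth_on U f -> U x -> differentiable f x.
Proof. by move=> sf Ux; have := sf [::] x Ux. Qed.

Lemma smooth_on_derive n (W : normedModType R) (U : set 'rV[R]_n)
    (f : 'rV[R]_n -> W) k : smooth_on U f -> smooth_on U ('D_(delta_mx 0 k) f).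
Proof. by move=> sf s x Ux; have := sf (rcons s k) x Ux; rewrite foldr_rcons. Qed.

Lemma smooth_on_C1 n (U : set 'rV[R]_n) (f : 'rV[R]_n -> R) x :
  open U -> smooth_on U f -> U x -> C1at f x.
Proof.
move=> oU sf Ux; apply: (C1at_near oU Ux) => [y|k].
  exact: smooth_on_differentiable.
apply: differentiable_continuous.
exact: (smooth_on_differentiable (smooth_on_derive k sf) Ux).
Qed.

Lemma smooth_on_C1_mx n m p (U : set 'rV[R]_n) (f : 'rV[R]_n -> 'M[R]_(m, p)) x i l :
  open U -> smooth_on U f -> U x -> C1at (fun y => f y i l) x.
Proof.
move=> oU sf Ux; apply: (C1at_near oU Ux) => [y Uy|k].
  by apply: differentiable_coord_comp; exact: (smooth_on_differentiable sf).
apply: (@continuous_near_eq _ _ (fun y => ('D_(delta_mx 0 k) f y) i l)).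
  apply: (filterS _ (open_nbhs_nbhs (conj oU Ux))) => y Uy.
  rewrite derive_mx ?mxE//; apply: diff_derivable.
  exact: (smooth_on_differentiable sf).
apply: differentiable_continuous.
apply: (@differentiable_coord_comp _ _ _ _ ('D_(delta_mx 0 k) f)).
exact: (smooth_on_differentiable (smooth_on_derive k sf) Ux).
Qed.

(* Allows induction on the order of differentiation. *)
Definition smooth_upto N n (W : normedModType R) (U : set 'rV[R]_n)
    (f : 'rV[R]_n -> W) : Prop :=
  forall (s : seq 'I_n) (x : 'rV[R]_n), (size s <= N)%N -> U x ->
    differentiable (foldr (fun k h => 'D_(delta_mx 0 k) h) f s) x.

Lemma smooth_uptoP n (W : normedModType R) (U : set 'rV[R]_n) (f : 'rV[R]_n -> W) :
  smooth_on U f <-> forall N, smooth_upto N U f.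
Proof.
split=> [sf N s x _|sf s x]; first exact: sf.
by apply: (sf (size s)).
Qed.

Lemma smooth_uptoS N n (W : normedModType R) (U : set 'rV[R]_n) (f : 'rV[R]_n -> W) :
  smooth_upto N.+1 U f <->
  (forall x, U x -> differentiable f x) /\
  (forall k, smooth_upto N U ('D_(delta_mx 0 k) f)).
Proof.
split=> [sf|[df sf] s x].
  split=> [x Ux|k s x sN Ux]; first exact: (sf [::]).
  by have := sf (rcons s k) x; rewrite size_rcons foldr_rcons => /(_ sN Ux).
elim/last_ind: s => [_ Ux|s k _]; first exact: df.
by rewrite size_rcons foldr_rcons; exact: sf.
Qed.

Lemma eq_derive_on n (W : normedModType R) (U : set 'rV[R]_n)
    (f g : 'rV[R]_n -> W) k : open U -> (forall x, U x -> f x = g x) ->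
  forall x, U x -> 'D_(delta_mx 0 k) f x = 'D_(delta_mx 0 k) g x.
Proof.
move=> oU fg x Ux; apply: near_eq_derive.
by apply: (filterS _ (open_nbhs_nbhs (conj oU Ux))).
Qed.

Lemma eq_smooth_upto N n (W : normedModType R) (U : set 'rV[R]_n)
    (f g : 'rV[R]_n -> W) : open U -> (forall x, U x -> f x = g x) ->
  smooth_upto N U f -> smooth_upto N U g.
Proof.
move=> oU; elim: N f g => [|N IH] f g fg sf.
  move=> [|//] x _ Ux; apply: (@differentiable_near_eq _ _ _ f).
    by apply: (filterS _ (open_nbhs_nbhs (conj oU Ux))).
  exact: (sf [::]).
apply/smooth_uptoS; have [df sDf] := (smooth_uptoS _ _ _).1 sf.
split=> [x Ux|k].
  apply: (@differentiable_near_eq _ _ _ f); last exact: df.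
  by apply: (filterS _ (open_nbhs_nbhs (conj oU Ux))).
by apply: (IH _ _ _ (sDf k)); exact: eq_derive_on.
Qed.

Lemma smooth_uptoD N n (W : normedModType R) (U : set 'rV[R]_n)
    (f g : 'rV[R]_n -> W) : open U ->
  smooth_upto N U f -> smooth_upto N U g -> smooth_upto N U (fun x => f x + g x).
Proof.
move=> oU; elim: N f g => [|N IH] f g sf sg.
  move=> [|//] x _ Ux; apply: differentiableD; first exact: (sf [::]).
  exact: (sg [::]).
have [df sDf] := (smooth_uptoS _ _ _).1 sf.
have [dg sDg] := (smooth_uptoS _ _ _).1 sg.
apply/smooth_uptoS; split=> [x Ux|k].
  by apply: differentiableD; [exact: df|exact: dg].
apply: (eq_smooth_upto oU _ (IH _ _ (sDf k) (sDg k))) => x Ux.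
rewrite -deriveD//; apply: diff_derivable; [exact: df|exact: dg].
Qed.

Lemma differentiable_scale_rV (V : normedModType R) m (f : V -> R)
    (v : V -> 'rV[R]_m) x :
  differentiable f x -> differentiable v x -> differentiable (fun y => f y *: v y) x.
Proof.
move=> df dv.
rewrite (_ : (fun y => _) = \sum_l (fun y => (f y * v y 0 l) *: delta_mx 0 l)).
  apply: differentiable_sum => l.
  apply: (@differentiableZl _ _ _ (fun y => f y * v y 0 l)).
  by apply: differentiableM => //; exact: differentiable_coord_comp.
apply/funext => y; rewrite fct_sumE {1}[v y]row_sum_delta scaler_sumr.
by apply: eq_bigr => l _; rewrite scalerA.
Qed.

Lemma derive_scale_rV (V : normedModType R) m (f : V -> R)
    (v : V -> 'rV[R]_m) x w : differentiable f x -> differentiable v x ->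
  'D_w (fun y => f y *: v y) x = 'D_w f x *: v x + f x *: 'D_w v x.
Proof.
move=> df dv; rewrite derive_mx; last first.
  by apply: diff_derivable; exact: differentiable_scale_rV.
rewrite [in RHS]derive_mx; last exact: diff_derivable.
apply/rowP => l; rewrite !mxE.
rewrite (_ : (fun t => _) = f * (fun y => v y 0 l)); last first.
  by apply/funext => y; rewrite mxE.
rewrite deriveM; last 2 first.
- exact: diff_derivable.
- by apply: diff_derivable; exact: differentiable_coord_comp.
by rewrite [LHS]addrC; congr (_ + _); exact: mulrC.
Qed.

(** The Leibniz rule turns a derivative of the product into a sum of two products of the same kind
    with other factors, so the induction on the order quantifies over all pairs of smooth
    factors. *)
Lemma smooth_on_scale n m (U : set 'rV[R]_n) (f : 'rV[R]_n -> R)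
    (v : 'rV[R]_n -> 'rV[R]_m) : open U ->
  smooth_on U f -> smooth_on U v -> smooth_on U (fun x => f x *: v x).
Proof.
move=> oU /smooth_uptoP sf /smooth_uptoP sv; apply/smooth_uptoP => N.
elim: N f v sf sv => [|N IH] f v sf sv.
  by move=> [|//] x _ Ux; apply: differentiable_scale_rV;
    [exact: (sf 0 [::])|exact: (sv 0 [::])].
have df x : U x -> differentiable f x by exact: (sf 0 [::]).
have dv x : U x -> differentiable v x by exact: (sv 0 [::]).
apply/smooth_uptoS; split=> [x Ux|k].
  by apply: differentiable_scale_rV; [exact: df|exact: dv].
have sDf N' : smooth_upto N' U ('D_(delta_mx 0 k) f).
  by have [_] := (smooth_uptoS N' U f).1 (sf _); exact.
have sDv N' : smooth_upto N' U ('D_(delta_mx 0 k) v).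
  by have [_] := (smooth_uptoS N' U v).1 (sv _); exact.
apply: (eq_smooth_upto oU _ (smooth_uptoD oU (IH _ _ sDf sv) (IH _ _ sf sDv))).
by move=> x Ux; rewrite derive_scale_rV//; [exact: df|exact: dv].
Qed.

End smooth.

(** * Matrix-valued functions and positive definite matrices *)

Section matrix_calculus.
Variable R : realType.

Lemma C1atV n (f : 'rV[R]_n -> R) x : C1at f x -> f x != 0 ->
  C1at (fun y => (f y)^-1) x.
Proof.
move=> /[dup] Cf [df cf] fx0; have cfx := C1at_continuous Cf.
have f0 : \forall y \near x, f y != 0.
  exact: (cvgr_neq0 _ cfx fx0).
split=> [|k].
  by near=> y; apply: differentiableV; near: y.
apply: (@continuous_near_eq _ _ (fun y => - (f y)^-1 ^+ 2 * 'D_(delta_mx 0 k) f y)).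
  near=> y; rewrite deriveV ?exprVn//; first by near: y.
  by apply: diff_derivable; near: y.
apply: continuousM; last exact: cf.
apply: continuousN; rewrite /=.
have cV : {for x, continuous (fun y => (f y)^-1)} by exact: continuousV.
by apply: (@continuousM _ _ (fun y => (f y)^-1) (fun y => (f y)^-1)).
Unshelve. all: by end_near. Qed.

Lemma C1at_sqrt n (f : 'rV[R]_n -> R) x : C1at f x -> 0 < f x ->
  C1at (fun y => Num.sqrt (f y)) x.
Proof.
move=> Cf fx0; apply: (@C1at_comp_real _ _ _ Num.sqrt) => //.
  near=> t; have t0 : 0 < t by near: t; exact: lt_nbhsr.
  by have [] := is_derive1_sqrt t0.
apply: (@continuous_near_eq _ _ (fun t : R => (2 * Num.sqrt t)^-1)).
  near=> t; have t0 : 0 < t by near: t; exact: lt_nbhsr.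
  by rewrite derive1E derive_sqrt.
apply: continuousV; first by rewrite mulf_neq0 ?pnatr_eq0// gt_eqF// sqrtr_gt0.
apply: continuousM; first exact: cst_continuous.
exact: sqrt_continuous.
Unshelve. all: by end_near. Qed.

Lemma C1at_expR n (f : 'rV[R]_n -> R) x : C1at f x ->
  C1at (fun y => expR (f y)) x.
Proof.
move=> Cf; apply: (@C1at_comp_real _ _ _ expR) => //.
  by near=> t; exact: derivable_expR.
rewrite (_ : (expR^`())%classic = expR); first exact: continuous_expR.
by apply/funext => t; rewrite derive1E; have [] := is_derive_expR t.
Unshelve. all: by end_near. Qed.

Lemma C1at_det n m (A : 'rV[R]_n -> 'M[R]_m) x :
  (forall i j, C1at (fun y => A y i j) x) -> C1at (fun y => \det (A y)) x.
Proof.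
move=> CA; apply: C1at_sum => s _; apply: C1atM; first exact: C1at_cst.
by apply: C1at_prod => i _; exact: CA.
Qed.

(** Cramer's rule: near x, where the determinant stays nonzero, an entry of the inverse is a
    cofactor divided by the determinant, both polynomial in the entries. *)
Lemma C1at_invmx n m (A : 'rV[R]_n -> 'M[R]_m) x i j :
  (forall i j, C1at (fun y => A y i j) x) -> \det (A x) != 0 ->
  C1at (fun y => invmx (A y) i j) x.
Proof.
move=> CA dA; have Cdet := C1at_det CA.
apply: (@C1at_near_eq _ _ (fun y => (\det (A y))^-1 * ((-1) ^+ (j + i) *
    \det (row' j (col' i (A y)))))).
  have h2 : \forall y \near x, \det (A y) != 0 
    by exact: (cvgr_neq0 _ (C1at_continuous Cdet) dA).
  near=> y; rewrite /invmx.
  have dAy : \det (A y) != 0 by near: y.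
  have -> : A y \in unitmx by rewrite unitmxE unitfE.
  by rewrite mxE mxE.
apply: C1atM; first exact: C1atV.
apply: C1atM; first exact: C1at_cst.
apply: C1at_det => i' j'.
rewrite (_ : (fun y => _) = (fun y => A y (lift j i') (lift i j'))); first exact: CA.
by apply/funext => y; rewrite !mxE.
Unshelve. all: by end_near. Qed.

Lemma continuous_prod (T : topologicalType) (I : Type) (s : seq I) (P : pred I)
    (f : I -> T -> R) x :
  (forall i, P i -> {for x, continuous (f i)}) ->
  {for x, continuous (fun y => \prod_(i <- s | P i) f i y)}.
Proof.
move=> cf; elim: s => [|i s IH].
  rewrite (_ : (fun y => _) = cst 1); first exact: cst_continuous.
  by apply/funext => y; rewrite big_nil.
rewrite (_ : (fun y => _) = (fun y => if P i then f i y * \big[*%R/1]_(j <- s | P j) f j y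
    else \big[*%R/1]_(j <- s | P j) f j y)); last first.
  by apply/funext => y; rewrite big_cons.
by case: (boolP (P i)) => // Pi; apply: continuousM => //; exact: cf.
Qed.

Lemma continuous_det (T : topologicalType) m (A : T -> 'M[R]_m) x :
  (forall i j, {for x, continuous (fun y => A y i j)}) ->
  {for x, continuous (fun y => \det (A y))}.
Proof.
move=> CA; apply: continuous_sum => s _; apply: continuousM; first exact: cst_continuous.
by apply: continuous_prod => i _; exact: CA.
Qed.

Lemma norm_sq_ge0 m (v : 'rV[R]_m) : 0 <= (v *m v^T) 0 0.
Proof.
rewrite mxE; apply: sumr_ge0 => i _.
by rewrite mxE -expr2 sqr_ge0.
Qed.

Lemma norm_sq_gt0 m (v : 'rV[R]_m) : v != 0 -> 0 < (v *m v^T) 0 0.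
Proof.
move=> v0; rewrite lt0r norm_sq_ge0 andbT; apply: contra v0 => /eqP h.
apply/eqP/rowP => k; rewrite mxE.
move: h; rewrite mxE => /psumr_eq0P h.
apply/eqP; rewrite -sqrf_eq0 expr2; apply/eqP.
have := h _ k isT; rewrite mxE; apply => l _.
by rewrite mxE -expr2 sqr_ge0.
Qed.

(* The determinant does not vanish on the segment from [G] to the identity. *)
Lemma posdef_det_gt0 m (G : 'M[R]_m) :
  (forall v : 'rV[R]_m, v != 0 -> 0 < (v *m G *m v^T) 0 0) -> 0 < \det G.
Proof.
move=> Gp; rewrite ltNge; apply/negP => dG.
pose A (t : R) := (1 - t)%:M + t *: G.
have cA : continuous (fun t => \det (A t)).
  move=> t; apply: continuous_det => i j.
  rewrite (_ : (fun y => _) = (fun y => (1 - y) * (i == j)%:R + y * G i j)); last first.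
    by apply/funext => y; rewrite !mxE mulr_natr.
  apply: continuousD; apply: continuousM; try exact: cst_continuous; last exact: cvg_id.
  by apply: continuousB; [exact: cst_continuous|exact: cvg_id].
have [||c] := @IVT R (fun t => \det (A t)) 0 1 0 ler01.
- exact: continuous_subspaceT.
- rewrite /A subr0 scale0r addr0 det1 subrr scale1r.
  rewrite (_ : 0%:M = 0 :> 'M[R]_m); last by apply/matrixP => i j; rewrite !mxE mul0rn.
  by rewrite add0r ge_min dG orbT le_max ler01.
rewrite in_itv/= => /andP[c0 c1] /eqP/det0P[v v0 vA].
(* Pairing the kernel vector with itself makes (1 - c) |v|^2 + c (v G v^T) vanish, although it is
   positive for c between 0 and 1. *)
have /(congr1 (fun M : 'rV[R]_m => (M *m v^T) 0 0)) := vA.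
rewrite /A mulmxDr mulmxDl mul_mx_scalar -scalemxAr -!scalemxAl mul0mx !mxE.
have := Gp v v0; have := norm_sq_gt0 v0; rewrite !mxE => n0 g0 e0.
have [c00|cn0] := eqVneq c 0.
  by move: e0; rewrite c00 subr0 mul1r mul0r addr0 => e0; rewrite e0 ltxx in n0.
have : 0 < (1 - c) * (\sum_j v 0 j * v^T j 0) + c * (\sum_j (v *m G) 0 j * v^T j 0).
  apply: ltr_wpDl; first by rewrite mulr_ge0 ?subr_ge0// ltW.
  by rewrite mulr_gt0// lt0r cn0.
by rewrite e0 ltxx.
Qed.

End matrix_calculus.

(** * Changes of charts *)

Section charts.
Variables (R : realType) (n : nat) (M : topologicalType).
Variable A : smooth_atlas R n M.
Implicit Types (i j : chart_index A) (p : M) (f : M -> R).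

Definition chart_img i : set 'rV[R]_n := chart i @` chart_dom i.

Lemma chart_imgP i p : chart_dom i p -> chart_img i (chart i p).
Proof. by exists p. Qed.

Lemma chart_inv_dom i x : chart_img i x -> chart_dom i (chart_inv i x).
Proof. by move=> [p ip <-]; rewrite chartK. Qed.

Lemma chart_invK i x : chart_img i x -> chart i (chart_inv i x) = x.
Proof. by move=> [p ip <-]; rewrite chartK. Qed.

Lemma chart_inv_cts i x : chart_img i x -> {for x, continuous (chart_inv i)}.
Proof. by move=> [p ip <-]; exact: chart_inv_continuous. Qed.

Lemma chart_image_subset i (B : set M) : B `<=` chart_dom i ->
  chart i @` B = chart_img i `&` chart_inv i @^-1` B.
Proof.
move=> Bi; apply/seteqP; split=> [_ [p Bp <-]|x [ix Bx]].
  by split; [exact/chart_imgP/Bi|rewrite /= chartK//; exact: Bi].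
by exists (chart_inv i x) => //; exact: chart_invK.
Qed.

Lemma open_chart_image i (O : set M) : open O -> O `<=` chart_dom i ->
  open (chart i @` O).
Proof.
move=> oO Oi; rewrite chart_image_subset//.
apply: open_preimage_setI => //; first exact: chart_img_open.
by move=> x; exact: chart_inv_cts.
Qed.

Lemma near_chart i p (P : set M) : chart_dom i p -> (\forall q \near p, P q) ->
  \forall x \near chart i p, chart_img i x /\ P (chart_inv i x).
Proof.
move=> ip Pp; apply: filterI.
  apply: open_nbhs_nbhs; split; first exact: chart_img_open.
  exact: chart_imgP.
by apply: (chart_inv_continuous ip); rewrite chartK.
Qed.

Definition overlap i j : set 'rV[R]_n := chart i @` (chart_dom i `&` chart_dom j).

Lemma open_overlap i j : open (overlap i j).
Proof.
apply: open_chart_image; last by move=> p [].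
by apply: openI; exact: chart_dom_open.
Qed.

Lemma overlapP i j p : chart_dom i p -> chart_dom j p -> overlap i j (chart i p).
Proof. by exists p. Qed.

Lemma transition_differentiable i j x : overlap i j x ->
  differentiable (chart j \o chart_inv i) x.
Proof. by move=> ox; exact: (smooth_on_differentiable (@chart_transition_smooth _ _ _ A i j) ox). Qed.

Lemma transition_C1 i j x l : overlap i j x ->
  C1at (fun y => (chart j \o chart_inv i) y 0 l) x.
Proof.
by move=> ox; exact: (smooth_on_C1_mx 0 l (@open_overlap i j) (@chart_transition_smooth _ _ _ A i j) ox).
Qed.

Lemma transition_jacobianE i j p a l : chart_dom i p -> chart_dom j p ->
  transition_jacobian i j p a l =
  'D_(delta_mx 0 a) (fun y => (chart j \o chart_inv i) y 0 l) (chart i p).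
Proof.
move=> ip jp; have dT := transition_differentiable (overlapP ip jp).
rewrite -derive_coord; last exact: diff_derivable.
by rewrite /transition_jacobian deriveEjacobian// -rowE [RHS]mxE.
Qed.

Lemma C1at_transition f i j p : chart_dom i p -> chart_dom j p ->
  C1at (f \o chart_inv i) (chart i p) -> C1at (f \o chart_inv j) (chart j p).
Proof.
move=> ip jp Cf; have oji := @open_overlap j i; have xji := overlapP jp ip.
apply: (@C1at_near_eq _ _ ((f \o chart_inv i) \o (chart i \o chart_inv j))).
  apply: (filterS _ (open_nbhs_nbhs (conj oji xji))) => _ [q [jq iq] <-] /=.
  by rewrite (chartK jq) (chartK iq).
apply: C1at_comp.
- apply: (filterS _ (open_nbhs_nbhs (conj oji xji))) => y.
  exact: transition_differentiable.
- by move=> l k; have [_] := transition_C1 l xji; exact.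
- by rewrite /= chartK.
Qed.

(** The chain rule. A differential is a covector, hence the transposed Jacobian and the direction
    opposite to that of [is_vfield]. *)
Lemma partials_transition f i j p : chart_dom i p -> chart_dom j p ->
  differentiable (f \o chart_inv j) (chart j p) ->
  partials f i p = partials f j p *m (transition_jacobian i j p)^T.
Proof.
move=> ip jp df; have oij := @open_overlap i j; have xij := overlapP ip jp.
apply/rowP => a; rewrite !mxE.
rewrite (@near_eq_derive _ _ _ _ ((f \o chart_inv j) \o (chart j \o chart_inv i))); last first.
  apply: (filterS _ (open_nbhs_nbhs (conj oij xij))) => _ [q [iq jq] <-] /=.
  by rewrite (chartK iq) (chartK jq).
rewrite derive_comp_rV; last 2 first.
- exact: transition_differentiable.
- by rewrite /= chartK.
apply: eq_bigr => l _; rewrite [X in _ = X * _]mxE [X in _ = _ * X]mxE transition_jacobianE// mulrC.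
by rewrite /= chartK.
Qed.

Definition C1_function f : Prop :=
  forall i p, chart_dom i p -> C1at (f \o chart_inv i) (chart i p).

Definition C1_vfield (X : vfield A) : Prop := is_vfield X /\
  forall i p k, chart_dom i p -> C1at (fun x => X i (chart_inv i x) 0 k) (chart i p).

Lemma smooth_function_C1 f : smooth_function A f -> C1_function f.
Proof.
move=> sf i p ip; apply: (smooth_on_C1 _ (sf i)); last exact: chart_imgP.
exact: chart_img_open.
Qed.

Lemma smooth_vfield_C1 (X : vfield A) : smooth_vfield X -> C1_vfield X.
Proof.
move=> [vX sX]; split => // i p k ip.
apply: (smooth_on_C1_mx 0 k _ (sX i)); last exact: chart_imgP.
exact: chart_img_open.
Qed.

Lemma continuous_chart (T : topologicalType) (f : M -> T) (F : 'rV[R]_n -> T) i p :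
  chart_dom i p -> (forall q, chart_dom i q -> f q = F (chart i q)) ->
  {for chart i p, continuous F} -> {for p, continuous f}.
Proof.
move=> ip fF cF; apply: (@continuous_near_eq _ _ (F \o chart i)).
  have : \forall q \near p, chart_dom i q.
    by apply: open_nbhs_nbhs; split => //; exact: chart_dom_open.
  by apply: filterS => q iq; rewrite /= fF.
exact: (continuous_comp (chart_continuous ip) cF).
Qed.

Lemma C1_function_continuous f : C1_function f -> continuous f.
Proof.
move=> Cf p; have ip := chart_atP A p.
apply: (continuous_chart ip (F := f \o chart_inv (chart_at A p))).
  by move=> q iq; rewrite /= chartK.
exact/C1at_continuous/Cf.
Qed.

Lemma C1_functionM f h : C1_function f -> C1_function h ->
  C1_function (fun p => f p * h p).
Proof. by move=> Cf Ch i p ip; apply: C1atM; [exact: Cf|exact: Ch]. Qed.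

Lemma partials_C1 f i p k : smooth_function A f -> chart_dom i p ->
  C1at (fun x => partials f i (chart_inv i x) 0 k) (chart i p).
Proof.
move=> sf ip; have oU : open (chart_img i) by exact: chart_img_open.
apply: (@C1at_near_eq _ _ ('D_(delta_mx 0 k) (f \o chart_inv i))).
  apply: (filterS _ (open_nbhs_nbhs (conj oU (chart_imgP ip)))) => x ix.
  by rewrite mxE chart_invK.
apply: (smooth_on_C1 oU _ (chart_imgP ip)).
exact: smooth_on_derive (sf i).
Qed.

Lemma partialsM f h i p : chart_dom i p ->
  C1at (f \o chart_inv i) (chart i p) -> C1at (h \o chart_inv i) (chart i p) ->
  partials (fun p => f p * h p) i p = f p *: partials h i p + h p *: partials f i p.
Proof.
move=> ip /C1at_differentiable Cf /C1at_differentiable Ch; apply/rowP => k; rewrite !mxE.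
rewrite (_ : _ \o _ = (f \o chart_inv i) * (h \o chart_inv i))//.
by rewrite deriveM ?(chartK ip)//=; [rewrite chartK|exact: diff_derivable|exact: diff_derivable].
Qed.

Lemma partials_eq0 f i p : chart_dom i p -> (\forall q \near p, f q = 0) ->
  partials f i p = 0.
Proof.
move=> ip f0; apply/rowP => k; rewrite !mxE.
rewrite (@near_eq_derive _ _ _ _ (cst 0)) ?derive_cst//.
by apply: filterS (near_chart ip f0) => x [_].
Qed.

End charts.

(** * The metric and gradients in an arbitrary chart *)

Section metric.
Variables (R : realType) (n : nat) (M : topologicalType).
Variables (A : smooth_atlas R n M) (g : riemannian_metric A).
Implicit Types (i j : chart_index A) (p : M) (f : M -> R) (X Y : vfield A).

Lemma gmat_det_gt0 i p : chart_dom i p -> 0 < \det (gmat g i p).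
Proof. by move=> ip; apply: posdef_det_gt0 => v; exact: gmat_pos. Qed.

Lemma gmat_unit i p : chart_dom i p -> gmat g i p \in unitmx.
Proof. by move=> ip; rewrite unitmxE unitfE gt_eqF// gmat_det_gt0. Qed.

(** The Jacobian is a factor of the invertible matrix [gmat g i p]. *)
Lemma transition_unit i j p : chart_dom i p -> chart_dom j p ->
  transition_jacobian i j p \in unitmx.
Proof.
move=> ip jp; have := gmat_unit ip; rewrite (gmat_transition g ip jp).
by rewrite !unitmx_mul => /andP[/andP[]].
Qed.

Definition inner_at i p (v w : 'rV[R]_n) : R := (v *m gmat g i p *m w^T) 0 0.

Lemma inner_at_transition i j p v w : chart_dom i p -> chart_dom j p ->
  inner_at j p (v *m transition_jacobian i j p) (w *m transition_jacobian i j p) =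
  inner_at i p v w.
Proof.
move=> ip jp; rewrite /inner_at (gmat_transition g ip jp) trmx_mul.
by rewrite !mulmxA.
Qed.

Lemma inner_atC i p v w : chart_dom i p -> inner_at i p v w = inner_at i p w v.
Proof.
move=> ip; rewrite /inner_at -[in LHS](trmxK (v *m gmat g i p *m w^T)) mxE.
by rewrite !trmx_mul trmxK gmat_sym// mulmxA.
Qed.

Lemma inner_atDl i p v1 v2 w :
  inner_at i p (v1 + v2) w = inner_at i p v1 w + inner_at i p v2 w.
Proof. by rewrite /inner_at !mulmxDl mxE. Qed.

Lemma inner_atDr i p v w1 w2 :
  inner_at i p v (w1 + w2) = inner_at i p v w1 + inner_at i p v w2.
Proof. by rewrite /inner_at linearD/= mulmxDr mxE. Qed.

Lemma inner_atZl i p a v w : inner_at i p (a *: v) w = a * inner_at i p v w.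
Proof. by rewrite /inner_at -!scalemxAl mxE. Qed.

Lemma inner_atZr i p a v w : inner_at i p v (a *: w) = a * inner_at i p v w.
Proof. by rewrite /inner_at linearZ/= -scalemxAr mxE. Qed.

Lemma inner_at_ge0 i p v : chart_dom i p -> 0 <= inner_at i p v v.
Proof.
move=> ip; have [->|v0] := eqVneq v 0; first by rewrite /inner_at !mul0mx mxE.
exact/ltW/gmat_pos.
Qed.

Lemma cauchy_schwarz_at i p v w : chart_dom i p ->
  `|inner_at i p v w| <= Num.sqrt (inner_at i p v v) * Num.sqrt (inner_at i p w w).
Proof.
move=> ip; set a := inner_at i p v v; set b := inner_at i p v w.
set c := inner_at i p w w.
have a0 : 0 <= a by exact: inner_at_ge0.
have c0 : 0 <= c by exact: inner_at_ge0.
have h (t : R) : 0 <= a + 2 * t * b + t ^+ 2 * c.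
  have := inner_at_ge0 (v + t *: w) ip.
  rewrite inner_atDl !inner_atDr !inner_atZl !inner_atZr (inner_atC w v ip).
  rewrite -/a -/b -/c => /le_trans; apply.
  by rewrite le_eqVlt; apply/orP; left; apply/eqP; ring.
rewrite -sqrtrM// -sqrtr_sqr ler_wsqrtr//.
have [c00|cn0] := eqVneq c 0.
  have [->|bn0] := eqVneq b 0; first by rewrite expr0n/= mulr_ge0.
  (* For c = 0 the polynomial is affine with slope 2b, and this is the point where it takes the
     value -1. *)
  have := h (- (a + 1) / (2 * b)); rewrite c00 mulr0 addr0.
  have -> : a + 2 * (- (a + 1) / (2 * b)) * b = -1 by field.
  by rewrite lerNr oppr0 ler10.
have cp : 0 < c by rewrite lt0r cn0.
have := h (- b / c).
have -> : a + 2 * (- b / c) * b + (- b / c) ^+ 2 * c = (a * c - b ^+ 2) / c by field.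
by rewrite pmulr_lge0 ?invr_gt0// subr_ge0.
Qed.

Lemma norm_at_triangle i p v w : chart_dom i p ->
  Num.sqrt (inner_at i p (v + w) (v + w)) <=
  Num.sqrt (inner_at i p v v) + Num.sqrt (inner_at i p w w).
Proof.
move=> ip; set a := Num.sqrt _; set b := Num.sqrt _; set c := Num.sqrt _.
rewrite -(@ler_pXn2r _ 2)// ?nnegrE ?addr_ge0 ?sqrtr_ge0//.
rewrite sqr_sqrtr; last exact: inner_at_ge0.
rewrite inner_atDl !inner_atDr (inner_atC w v ip) sqrrD !sqr_sqrtr; try exact: inner_at_ge0.
have := cauchy_schwarz_at v w ip; rewrite -/b -/c => h.
have := ler_norm (inner_at i p v w); move: h; set s := inner_at _ _ _ _.
rewrite mulr2n; lra.
Qed.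

Lemma vinnerE X Y i p : is_vfield X -> is_vfield Y -> chart_dom i p ->
  vinner g X Y p = inner_at i p (X i p) (Y i p).
Proof.
move=> vX vY ip; have jp := chart_atP A p.
by rewrite /vinner (vX i _ p ip jp) (vY i _ p ip jp) -(inner_at_transition _ _ ip jp).
Qed.

Lemma vinner_at X Y p : vinner g X Y p = inner_at (chart_at A p) p
  (X (chart_at A p) p) (Y (chart_at A p) p).
Proof. by []. Qed.

(** With J the Jacobian from chart i to chart j and G the metric in chart j, the covector law and
    the law of the metric give components d J^T (J G J^T)^-1 in chart i, where d stands for the
    partials in chart j; multiplying by J leaves d G^-1. *)
Lemma grad_is_vfield f : (forall i p, chart_dom i p ->
    differentiable (f \o chart_inv i) (chart i p)) -> is_vfield (grad g f).
Proof.
move=> df i j p ip jp; rewrite /grad (partials_transition ip jp (df j p jp)).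
rewrite (gmat_transition g ip jp).
have Ju := transition_unit ip jp; have gu := gmat_unit jp.
set J := transition_jacobian i j p in Ju *; set G := gmat g j p in gu *.
have GJu : G *m J^T \in unitmx by rewrite unitmx_mul gu unitmx_tr.
have JGu : J *m G *m J^T \in unitmx by rewrite -mulmxA unitmx_mul Ju.
apply: (can_inj (mulmxK GJu)).
rewrite -[X in X = _]mulmxA (mulKmx gu) -!mulmxA.
by rewrite [J *m (G *m J^T)]mulmxA (mulVmx JGu) mulmx1.
Qed.

Lemma inner_grad f i p (w : 'rV[R]_n) : chart_dom i p ->
  inner_at i p (grad g f i p) w = (partials f i p *m w^T) 0 0.
Proof. by move=> ip; rewrite /inner_at /grad mulmxKV ?gmat_unit. Qed.

Lemma C1_function_differentiable f : C1_function A f ->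
  forall i p, chart_dom i p -> differentiable (f \o chart_inv i) (chart i p).
Proof. by move=> Cf i p ip; exact/C1at_differentiable/Cf. Qed.

Lemma gmat_C1 i p a b : chart_dom i p ->
  C1at (fun x => gmat g i (chart_inv i x) a b) (chart i p).
Proof.
move=> ip; apply: (@smooth_on_C1_mx _ _ _ _ (chart_img i) (gmat g i \o chart_inv i)).
- exact: chart_img_open.
- exact: gmat_smooth.
- exact: chart_imgP.
Qed.

Lemma gmat_inv_C1 i p a b : chart_dom i p ->
  C1at (fun x => invmx (gmat g i (chart_inv i x)) a b) (chart i p).
Proof.
move=> ip; apply: C1at_invmx; first by move=> *; exact: gmat_C1.
by rewrite gt_eqF// gmat_det_gt0// chartK.
Qed.

Lemma vol_density_gt0 i p : chart_dom i p -> 0 < vol_density g i p.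
Proof. by move=> ip; rewrite sqrtr_gt0 gmat_det_gt0. Qed.

Lemma vol_density_C1 i p : chart_dom i p ->
  C1at (fun x => vol_density g i (chart_inv i x)) (chart i p).
Proof.
move=> ip; apply: C1at_sqrt; last by rewrite chartK// gmat_det_gt0.
by apply: C1at_det => a b; exact: gmat_C1.
Qed.

Lemma grad_C1 f : smooth_function A f -> C1_vfield (grad g f).
Proof.
move=> sf; split.
  by apply: grad_is_vfield; exact/C1_function_differentiable/smooth_function_C1.
move=> i p k ip.
rewrite (_ : (fun x => _) = (fun x => \sum_l partials f i (chart_inv i x) 0 l *
    invmx (gmat g i (chart_inv i x)) l k)); last by apply/funext => x; rewrite mxE.
apply: C1at_sum => l _; apply: C1atM; first exact: partials_C1.
exact: gmat_inv_C1.
Qed.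

Lemma inner_at_C1 i p (v w : 'rV[R]_n -> 'rV[R]_n) : chart_dom i p ->
  (forall k, C1at (fun x => v x 0 k) (chart i p)) ->
  (forall k, C1at (fun x => w x 0 k) (chart i p)) ->
  C1at (fun x => inner_at i (chart_inv i x) (v x) (w x)) (chart i p).
Proof.
move=> ip Cv Cw.
rewrite (_ : (fun x => _) = (fun x => \sum_l (\sum_k v x 0 k *
    gmat g i (chart_inv i x) k l) * w x 0 l)); last first.
  by apply/funext => x; rewrite /inner_at mxE; apply: eq_bigr => l _; rewrite !mxE.
apply: C1at_sum => l _; apply: C1atM => //.
by apply: C1at_sum => k _; apply: C1atM => //; exact: gmat_C1.
Qed.

Lemma vinner_C1 X Y : C1_vfield X -> C1_vfield Y -> C1_function A (vinner g X Y).
Proof.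
move=> [vX CX] [vY CY] i p ip.
apply: (@C1at_near_eq _ _ (fun x => inner_at i (chart_inv i x)
    (X i (chart_inv i x)) (Y i (chart_inv i x)))).
  have oU : open (chart_img i) by exact: chart_img_open.
  apply: (filterS _ (open_nbhs_nbhs (conj oU (chart_imgP ip)))) => x ix.
  by rewrite /= (vinnerE vX vY (chart_inv_dom ix)).
by apply: inner_at_C1 => // k; [exact: CX|exact: CY].
Qed.

Lemma vnorm_continuous X : C1_vfield X -> continuous (vnorm g X).
Proof.
move=> CX p; apply: continuous_comp; last exact: sqrt_continuous.
exact: (C1_function_continuous (vinner_C1 CX CX)).
Qed.

End metric.

(** * The Riemannian volume in charts *)

Section transfer.
Local Open Scope ereal_scope.
Context d1 d2 (T1 : measurableType d1) (T2 : measurableType d2) (R : realType).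
Variables (mu1 : {measure set T1 -> \bar R}) (mu2 : {measure set T2 -> \bar R}).
Variables (D1 : set T1) (D2 : set T2) (phi : T2 -> T1) (w : T2 -> R).
Hypotheses (mD1 : measurable D1) (mD2 : measurable D2).
Hypotheses (mphi : measurable_fun D2 phi) (phiD : forall x, D2 x -> D1 (phi x)).
Hypotheses (mw : measurable_fun D2 w) (w0 : forall x, (0 <= w x)%R).
Hypothesis muE : forall B, measurable B -> B `<=` D1 ->
  mu1 B = \int[mu2]_(x in D2) (\1_B (phi x) * w x)%:E.

Import HBNNSimple.

Lemma measurable_indic_comp (B : set T1) : measurable B ->
  measurable_fun D2 (fun x => \1_B (phi x) : R).
Proof.
by move=> mB; apply: measurableT_comp => //; exact: measurable_indic.
Qed.

(** Hypothesis [muE] is this change of variables for indicators. Linearity extends it here to simple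
    functions; monotone convergence and the splitting into positive and negative parts then extend
    it to all measurable functions, integrable or not. *)
Lemma nnsfun_transfer (h : {nnsfun T1 >-> R}) :
  \int[mu1]_(x in D1) (h x)%:E = \int[mu2]_(x in D2) (h (phi x) * w x)%:E.
Proof.
have mB k : measurable (h @^-1` [set k]) by [].
have mBw k : measurable_fun D2 (fun x => (\1_(h @^-1` [set k]) (phi x) * w x)%:E).
  by apply/measurable_EFinP/measurable_funM => //; exact: measurable_indic_comp.
under eq_integral do rewrite fimfunE -fsumEFin//.
rewrite ge0_integral_fsum//; last 2 first.
  - by move=> y; exact/measurable_EFinP/measurable_funM.
  - by move=> y x _; rewrite nnfun_muleindic_ge0.
transitivity (\sum_(k \in range h)
    \int[mu2]_(x in D2) (k * (\1_(h @^-1` [set k]) (phi x) * w x))%:E).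
  apply: eq_fsbigr => r /set_mem[x _ hx]; rewrite integralZl_indic_nnsfun//.
  rewrite integral_indic// muE//; last first.
    exact: measurableI.
  under [RHS]eq_integral do rewrite EFinM.
  rewrite ge0_integralZl//; last 2 first.
  - by move=> y _; rewrite lee_fin mulr_ge0.
  - by rewrite -hx lee_fin.
  congr (_ * _); apply: eq_integral => y /set_mem D2y.
  by rewrite !indicE in_setI [phi y \in D1]mem_set ?andbT//; exact: phiD.
rewrite -ge0_integral_fsum//.
- apply: eq_integral => x _; rewrite fsumEFin//; congr EFin.
  rewrite [in RHS]fimfunE !fsbig_finite//= mulr_suml.
  by apply: eq_bigr => k _; rewrite mulrA.
- move=> k; under eq_fun do rewrite EFinM.
  by apply: emeasurable_funM => //; exact: measurable_cst.
- move=> k x _; rewrite mulrA; have := nnfun_muleindic_ge0 h k (phi x).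
  by rewrite !lee_fin => hk; rewrite mulr_ge0.
Qed.

Lemma ge0_integral_transfer (f : T1 -> R) : measurable_fun D1 f ->
  (forall x, D1 x -> (0 <= f x)%R) ->
  \int[mu1]_(x in D1) (f x)%:E = \int[mu2]_(x in D2) (f (phi x) * w x)%:E.
Proof.
move=> mf f0; have mEf : measurable_fun D1 (EFin \o f) by exact/measurable_EFinP.
pose f_ := nnsfun_approx mD1 mEf.
have cf x : D1 x -> (f_ n x)%:E @[n --> \oo] --> (f x)%:E.
  by move=> D1x; apply: cvg_nnsfun_approx => // y D1y; rewrite lee_fin f0.
have c1 : \int[mu1]_(x in D1) (f_ n x)%:E @[n --> \oo] --> \int[mu1]_(x in D1) (f x)%:E.
  rewrite (@eq_integral _ _ _ mu1 D1 (fun x => limn (fun n => (f_ n x)%:E))); last first.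
    by move=> x /set_mem D1x; apply/esym/cvg_lim => //; exact: cf.
  apply: cvg_monotone_convergence => //.
  - by move=> n; exact/measurable_EFinP/measurable_funP.
  - by move=> n y _; rewrite lee_fin.
  - by move=> y _ m n mn; rewrite lee_fin; exact/lefP/nd_nnsfun_approx.
have c2 : \int[mu2]_(x in D2) (f_ n (phi x) * w x)%:E @[n --> \oo] -->
    \int[mu2]_(x in D2) (f (phi x) * w x)%:E.
  rewrite (@eq_integral _ _ _ mu2 D2 (fun x => limn (fun n => (f_ n (phi x) * w x)%:E))); last first.
    move=> x /set_mem D2x; apply/esym/cvg_lim => //.
    rewrite EFinM; under eq_fun do rewrite EFinM.
    by apply: cvgeZr => //; exact/cf/phiD.
  apply: cvg_monotone_convergence => //.
  - move=> n; apply/measurable_EFinP/measurable_funM => //.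
    by apply: measurableT_comp => //; exact: measurable_funP.
  - by move=> n y _; rewrite lee_fin mulr_ge0.
  - move=> y _ m n mn; rewrite lee_fin ler_wpM2r//.
    exact/lefP/nd_nnsfun_approx.
have E : (fun n => \int[mu1]_(x in D1) (f_ n x)%:E) =
    (fun n => \int[mu2]_(x in D2) (f_ n (phi x) * w x)%:E).
  by apply/funext => n; exact: nnsfun_transfer.
by move/(cvg_lim (@ereal_hausdorff R)): c1 => <-; rewrite E; exact: (cvg_lim _ c2).
Qed.

Lemma integral_transfer (f : T1 -> R) : measurable_fun D1 f ->
  \int[mu1]_(x in D1) (f x)%:E = \int[mu2]_(x in D2) (f (phi x) * w x)%:E.
Proof.
move=> mf; rewrite integralE [RHS]integralE; congr (_ - _).
- rewrite (eq_integral (fun x => (Num.max (f x) 0)%:E)); last first.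
    by move=> x _; rewrite funeposE EFin_max.
  rewrite ge0_integral_transfer//; last 2 first.
  + by apply: measurable_maxr.
  + by move=> x _; rewrite le_max lexx orbT.
  apply: eq_integral => x _; rewrite funeposE -EFin_max; congr EFin.
  by rewrite maxr_pMl// mul0r.
- rewrite (eq_integral (fun x => (Num.max (- f x) 0)%:E)); last first.
    by move=> x _; rewrite funenegE EFin_max.
  rewrite ge0_integral_transfer//; last 2 first.
  + by apply: measurable_maxr => //; exact: measurable_funN.
  + by move=> x _; rewrite le_max lexx orbT.
  apply: eq_integral => x _; rewrite funenegE -EFin_max; congr EFin.
  by rewrite maxr_pMl// mul0r mulNr.
Qed.

End transfer.

Lemma compact_pointwise_cover (M : ptopologicalType) (K : set M) (U : M -> set M) :
  compact K -> (forall p, K p -> open (U p) /\ U p p) ->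
  exists2 s : seq M, (forall p, p \in s -> K p) &
    K `<=` \bigcup_(p in [set` s]) U p.
Proof.
move=> cK KU; have := cK; rewrite compact_cover => /(_ M K U) [].
- by move=> p /KU[].
- by move=> p Kp; exists p => //; have [] := KU p Kp.
move=> D DK KD; exists (finmap.enum_fset D).
  by move=> p pD; have := DK p pD; rewrite inE.
by move=> p /KD[q qD Uq]; exists q.
Qed.

Section volume.
Variables (R : realType) (n : nat) (M : ptopologicalType).
Variables (A : smooth_atlas R n M) (g : riemannian_metric A).
Variable vol : {measure set (borelType M) -> \bar R}.
Hypothesis vol_g : is_riemannian_volume g vol.
Variable L : {measure set (borelType 'rV[R]_n) -> \bar R}.
Hypothesis LL : is_lebesgue_rV L.
Implicit Types (i : chart_index A) (p : M).

Lemma measurable_chart_dom i : measurable (chart_dom i : set (borelType M)).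
Proof. by apply: open_measurable_borel; exact: chart_dom_open. Qed.

Lemma measurable_chart_img i : measurable (chart_img i : set (borelType 'rV[R]_n)).
Proof. by apply: open_measurable_borel; exact: chart_img_open. Qed.

Lemma measurable_chart_inv i : measurable_fun (chart_img i : set (borelType 'rV[R]_n))
  (chart_inv i : borelType 'rV[R]_n -> borelType M).
Proof.
apply: continuous_measurable_borel; first exact: chart_img_open.
by move=> x; exact: chart_inv_cts.
Qed.

Definition chart_density i (x : 'rV[R]_n) : R := vol_density g i (chart_inv i x).

Lemma chart_density_ge0 i x : 0 <= chart_density i x.
Proof. exact: sqrtr_ge0. Qed.

Lemma chart_density_gt0 i x : chart_img i x -> 0 < chart_density i x.
Proof. by move=> ix; apply/vol_density_gt0/chart_inv_dom. Qed.

Lemma chart_density_C1 i x : chart_img i x -> C1at (chart_density i) x.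
Proof. by move=> [p ip <-]; exact: vol_density_C1. Qed.

Lemma measurable_chart_density i :
  measurable_fun (chart_img i : set (borelType 'rV[R]_n))
    (chart_density i : borelType 'rV[R]_n -> R).
Proof.
apply: continuous_measurable_real; first exact: chart_img_open.
by move=> x ix; apply: C1at_continuous; exact: chart_density_C1.
Qed.

Lemma volume_chart i (B : set (borelType M)) :
  measurable B -> B `<=` (chart_dom i : set M) ->
  (vol B = \int[L]_(x in chart_img i) (\1_B (chart_inv i x) * chart_density i x)%:E)%E.
Proof.
move=> mB Bi; rewrite (vol_g mB Bi); have [intL _] := LL.
have BE := chart_image_subset Bi.
have mcB : measurable (chart i @` (B : set M) : set (borelType 'rV[R]_n)).
  rewrite BE; exact: (@measurable_chart_inv i (measurable_chart_img i) _ mB).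
have E : (fun x => (\1_(chart i @` (B : set M)) x * vol_density g i (chart_inv i x))%:E) =
    (EFin \o chart_density i) \_ (chart i @` (B : set M)).
  apply/funext => x; rewrite /patch indicE.
  by case: ifP => _; rewrite ?mul1r ?mul0r.
rewrite intL; last 2 first.
- rewrite E; apply/(measurable_restrictT _ _).1 => //.
  apply/measurable_EFinP; apply: (@measurable_funS _ _ _ _ (chart_img i : set (borelType _))).
  + exact: measurable_chart_img.
  + by rewrite BE => x [].
  + exact: measurable_chart_density.
- by move=> x; rewrite lee_fin mulr_ge0// ?sqrtr_ge0.
rewrite E -integral_mkcond BE integral_mkcondr.
apply: eq_integral => x _; rewrite /patch indicE.
have -> : (x \in chart_inv i @^-1` B) = (chart_inv i x \in B).
  by apply/idP/idP; rewrite !inE.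
by case: ifP => _; rewrite ?mul1r ?mul0r.
Qed.

Lemma integral_chart i (f : M -> R) :
  measurable_fun (chart_dom i : set (borelType M)) (f : borelType M -> R) ->
  (\int[vol]_(p in chart_dom i) (f p)%:E =
   \int[L]_(x in chart_img i) (f (chart_inv i x) * chart_density i x)%:E)%E.
Proof.
apply: (@integral_transfer _ _ _ _ _ vol L (chart_dom i) (chart_img i) (chart_inv i)
  (chart_density i)).
- exact: measurable_chart_dom.
- exact: measurable_chart_img.
- exact: measurable_chart_inv.
- exact: chart_inv_dom.
- exact: measurable_chart_density.
- exact: chart_density_ge0.
- exact: volume_chart.
Qed.

Lemma chart_ball_open i x (e : R) : ball x e `<=` chart_img i ->
  open (chart_inv i @` ball x e).
Proof.
move=> xi; rewrite (_ : _ @` _ = chart_dom i `&` chart i @^-1` ball x e).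
  apply: open_preimage_setI; first exact: chart_dom_open.
  + by move=> p; exact: chart_continuous.
  + exact: ball_open.
apply/seteqP; split=> [_ [y xy <-]|p [ip xp]].
  by split; [exact/chart_inv_dom/xi|rewrite /= chart_invK//; exact: xi].
by exists (chart i p) => //; exact: chartK.
Qed.

Lemma chart_ball_dom i x (e : R) : ball x e `<=` chart_img i ->
  chart_inv i @` ball x e `<=` chart_dom i.
Proof. by move=> xi _ [y /xi iy <-]; exact: chart_inv_dom. Qed.

Lemma volume_chart_ball i x (e : R) : ball x e `<=` chart_img i ->
  (vol (chart_inv i @` ball x e) = \int[L]_(y in ball x e) (chart_density i y)%:E)%E.
Proof.
move=> xi; rewrite (@volume_chart i); last 2 first.
- by apply: open_measurable_borel; exact: chart_ball_open.
- exact: chart_ball_dom.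
rewrite -(setIidr xi) integral_mkcondr; apply: eq_integral => y /set_mem iy.
rewrite /patch setIidr// indicE; case: ifPn => [/set_mem xy|/negP nxy].
  by rewrite mem_set ?mul1r//; exists y.
rewrite memNset ?mul0r// => -[z xz zy]; apply: nxy; rewrite inE.
by rewrite -(chart_invK iy) -zy chart_invK//; exact: xi.
Qed.

(** By continuity the density stays near p between d / 2 and d + 1, where d > 0 is its value at p;
    the volume of a small coordinate cube is thus pinched between positive multiples of its Lebesgue
    measure. The lower bound makes open sets non-negligible, the upper one makes compact sets of
    finite volume. *)
Lemma chart_ball_volume p (N : set M) : nbhs p N ->
  exists i (e : R), [/\ 0 < e, ball (chart i p) e `<=` chart_img i,
    chart_inv i @` ball (chart i p) e `<=` N,
    chart_dom i p & (0 < vol (chart_inv i @` ball (chart i p) e) < +oo)%E].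
Proof.
move=> Np; have ip := chart_atP A p; set i := chart_at A p in ip *.
set x := chart i p; have ix : chart_img i x by exact: chart_imgP.
have d0 := chart_density_gt0 ix; set d := chart_density i x in d0.
have cd : {for x, continuous (chart_density i)}.
  by apply: C1at_continuous; exact: chart_density_C1.
have h1 : \forall y \near x, chart_density i y < d + 1.
  have h : \forall t \near d, t < d + 1 by apply: lt_nbhsl; rewrite ltrDl.
  exact: (cd _ h).
have h2 : \forall y \near x, d / 2 < chart_density i y.
  have h : \forall t \near d, d / 2 < t by apply: lt_nbhsr; lra.
  exact: (cd _ h).
have h3 := near_chart ip Np.
have : \forall y \near x, [/\ chart_density i y < d + 1, d / 2 < chart_density i y,
    chart_img i y & N (chart_inv i y)] by near=> y; split; near: y => //;
  apply: filterS h3 => ? [].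
move=> /nbhs_ballP[e /= e0 he].
exists i, e; split => //.
- by move=> y /he[].
- by move=> _ [y /he[_ _ _ Ny] <-].
have xi : ball x e `<=` chart_img i by move=> y /he[].
have mb : measurable (ball x e : set (borelType 'rV[R]_n)).
  by apply: open_measurable_borel; exact: ball_open.
have md : measurable_fun (ball x e : set (borelType 'rV[R]_n))
    (EFin \o chart_density i : borelType 'rV[R]_n -> \bar R).
  apply/measurable_EFinP; apply: (@measurable_funS _ _ _ _ (chart_img i : set (borelType _))) => //.
  + exact: measurable_chart_img.
  + exact: measurable_chart_density.
rewrite (volume_chart_ball xi); have [_ Lb] := LL; apply/andP; split.
  apply: (@lt_le_trans _ _ (\int[L]_(y in ball x e) (cst (d / 2)%:E y))%E).
    rewrite integral_cst// Lb// -EFinM lte_fin mulr_gt0 ?divr_gt0// exprn_gt0//.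
    by rewrite mulr_gt0.
  apply: ge0_le_integral => //.
  + by move=> y _ /=; rewrite lee_fin divr_ge0// ltW.
  + by move=> y /he[_ h _ _]; rewrite /= lee_fin ltW.
apply: (@le_lt_trans _ _ (\int[L]_(y in ball x e) (cst (d + 1)%:E y))%E).
  apply: ge0_le_integral => //.
  + by move=> y _; rewrite lee_fin chart_density_ge0.
  + by move=> y /he[h _ _ _]; rewrite /= lee_fin ltW.
by rewrite integral_cst// Lb// -EFinM ltry.
Unshelve. all: by end_near. Qed.

End volume.

Section volume_bounds.
Variables (R : realType) (n : nat) (M : ptopologicalType).
Variables (A : smooth_atlas R n M) (g : riemannian_metric A).
Variable vol : {measure set (borelType M) -> \bar R}.
Hypothesis vol_g : is_riemannian_volume g vol.

Lemma volume_open_gt0 (O : set M) : open O -> O !=set0 ->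
  (0 < vol (O : set (borelType M)))%E.
Proof.
move=> oO [p Op]; have [L LL] := lebesgue_rV_exists R n.
have [i [e [e0 xi sO ip /andP[v0 _]]]] := chart_ball_volume vol_g LL (open_nbhs_nbhs (conj oO Op)).
apply: (lt_le_trans v0); apply: le_measure => //; rewrite inE.
  by apply: open_measurable_borel; exact: chart_ball_open.
exact: open_measurable_borel.
Qed.

Lemma volume_compact_lty (K : set M) : closed K -> compact K ->
  (vol (K : set (borelType M)) < +oo)%E.
Proof.
move=> clK cK; have [L LL] := lebesgue_rV_exists R n.
have h p : exists U : set M, [/\ open U, U p & (vol (U : set (borelType M)) < +oo)%E].
  have [i [e [e0 xi _ ip /andP[_ v1]]]] := chart_ball_volume vol_g LL (@filterT _ (nbhs p) _).
  exists (chart_inv i @` ball (chart i p) e); split => //.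
  - exact: chart_ball_open.
  - by exists (chart i p); [exact: ballxx|exact: chartK].
have [U hU] := choice h.
have [|s sK KU] := @compact_pointwise_cover M K U cK.
  by move=> p _; have [] := hU p.
pose B (s : seq M) : set (borelType M) := \big[setU/set0]_(p <- s) U p.
have mU p : measurable (U p : set (borelType M)).
  by apply: open_measurable_borel; have [] := hU p.
have mB s' : measurable (B s') by apply: bigsetU_measurable => p _.
have : (vol (B s) < +oo)%E.
  elim: (s) => [|p s' IH]; first by rewrite /B big_nil measure0.
  rewrite /B big_cons; apply: (le_lt_trans (measureU2 _ (mU p) (mB s'))).
  by rewrite lte_add_pinfty//; have [] := hU p.
apply: le_lt_trans; apply: le_measure; rewrite ?inE//; first exact: closed_measurable_borel.
by move=> p /KU[q /= qs Uq]; rewrite /B -bigcup_seq; exists q.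
Qed.

End volume_bounds.

(** * Bump functions and Green's formula *)

Section bump.
Variable R : realType.

(** Squaring makes the positive part continuously differentiable, which is all that Green's formula
    asks of a cut-off function. *)
Definition sq_pos (t : R) : R := Num.max t 0 ^+ 2.

Lemma is_derive_sq_pos (t : R) : is_derive t (1 : R) sq_pos (2 * Num.max t 0).
Proof.
have [t0|t0|->] := ltgtP t 0.
- apply: (@near_eq_is_derive _ _ _ (cst 0)); last first.
    by rewrite mulr0; exact: is_derive_cst.
  have : \forall s \near t, s < 0 by exact: lt_nbhsl.
  by apply: filterS => s s0; rewrite /sq_pos max_r ?expr0n// ltW.
- apply: (@near_eq_is_derive _ _ _ (fun s : R => s ^+ 2)); last first.
    have := @exprn_derivable R 2 t 1 => d2; split; first exact: d2.
    by rewrite exp_derive expr1 [_ *: 1]mulr1.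
  have : \forall s \near t, 0 < s by exact: lt_nbhsr.
  by apply: filterS => s s0; rewrite /sq_pos max_l// ltW.
- rewrite ?maxxx mulr0.
  have c0 : (fun h : R => h^-1 *: ((sq_pos \o shift 0) (h *: 1) - sq_pos 0)) @ 0^' --> (0 : R).
    apply/cvgrPdist_lt => e e0; near=> h.
    have he : `|h| < e by near: h; exact: dnbhs0_lt.
    have hn0 : h != 0 by near: h; exact: nbhs_dnbhs_neq.
    rewrite /= /sq_pos maxxx expr0n subr0 addr0 [h *: 1]mulr1 sub0r normrN.
    rewrite normrM normfV normrX ltr_pdivrMl ?normr_gt0//.
    apply: (@le_lt_trans _ _ (`|h| ^+ 2)).
      rewrite ler_pXn2r ?nnegrE// /Num.max; case: ifP => _ //.
      by rewrite normr0.
    by rewrite expr2 ltr_pM2l ?normr_gt0.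
  split; first by apply/cvg_ex; exists 0.
  exact: cvg_lim c0.
Unshelve. all: by end_near. Qed.

Lemma C1at_sq_pos n (f : 'rV[R]_n -> R) x : C1at f x -> C1at (fun y => sq_pos (f y)) x.
Proof.
move=> Cf; apply: (@C1at_comp_real _ _ _ sq_pos) => //.
  by near=> t; have [] := is_derive_sq_pos t.
have -> : (sq_pos^`())%classic = (fun t => 2 * Num.max t 0).
  by apply/funext => t; rewrite derive1E; have [] := is_derive_sq_pos t.
apply: continuousM; first exact: cst_continuous.
by apply: continuous_max; [exact: cvg_id|exact: cst_continuous].
Unshelve. all: by end_near. Qed.

Lemma C1at_coord n (k : 'I_n) (x : 'rV[R]_n) : C1at (fun y : 'rV[R]_n => y 0 k) x.
Proof.
split=> [|l]; first by near=> y; exact: differentiable_coord.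
rewrite (_ : 'D_ _ _ = cst ((delta_mx 0 l : 'rV[R]_n) 0 k)); first exact: cst_continuous.
apply/funext => y; rewrite -(@derive_coord _ _ _ id); last exact: derivable_id.
by rewrite derive_id.
Unshelve. all: by end_near. Qed.

Lemma C1atB n (f h : 'rV[R]_n -> R) x : C1at f x -> C1at h x ->
  C1at (fun z => f z - h z) x.
Proof.
move=> Cf Ch; rewrite (_ : (fun z => _) = (fun z => f z + -1 * h z)).
  by apply: C1atD => //; apply: C1atM => //; exact: C1at_cst.
by apply/funext => z; rewrite mulN1r.
Qed.

Definition bump_rV n (c : 'rV[R]_n) (r : R) (x : 'rV[R]_n) : R :=
  sq_pos (r ^+ 2 - \sum_k (x 0 k - c 0 k) ^+ 2).

Lemma bump_rV_C1 n (c : 'rV[R]_n) r x : C1at (bump_rV c r) x.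
Proof.
apply: C1at_sq_pos; apply: C1atB; first exact: C1at_cst.
apply: C1at_sum => k _.
rewrite (_ : (fun y => _) = (fun y : 'rV[R]_n => (y 0 k - c 0 k) * (y 0 k - c 0 k))).
  by apply: C1atM; apply: C1atB; (exact: C1at_coord || exact: C1at_cst).
by apply/funext => y; rewrite expr2.
Qed.

Lemma bump_rV_ge0 n (c : 'rV[R]_n) r x : 0 <= bump_rV c r x.
Proof. exact: sqr_ge0. Qed.

Lemma bump_rV_center n (c : 'rV[R]_n) r : 0 < r -> 0 < bump_rV c r c.
Proof.
move=> r0; rewrite /bump_rV big1 ?subr0; last by move=> k _; rewrite subrr expr0n.
by rewrite /sq_pos exprn_gt0// lt_max exprn_gt0.
Qed.

(** The bump is supported in a Euclidean ball, while [closed_ball] is a cube: outside the cube, the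
    coordinate that realises the sup norm alone makes the sum of squares at least r^2. *)
Lemma bump_rV_out n (c : 'rV[R]_n) r x : 0 < r -> ~ closed_ball c r x ->
  bump_rV c r x = 0.
Proof.
move=> r0; rewrite closed_ballE// /closed_ball_/= => /negP; rewrite -ltNge => rx.
have [[i k] /= nE] : exists ij : 'I_1 * 'I_n, `|c - x| = `|(c - x) ij.1 ij.2|.
  by apply: mx_norm_neq0; rewrite -[mx_norm _]/(`|c - x|) gt_eqF// (lt_trans r0).
move: rx; rewrite nE ord1 !mxE => rx.
rewrite /bump_rV /sq_pos max_r ?expr0n// subr_le0.
rewrite (bigD1 k)//= -[leLHS]addr0 lerD ?sumr_ge0//; last by move=> *; exact: sqr_ge0.
rewrite -[leRHS]real_normK ?num_real// distrC.
by apply: lerXn2r; rewrite ?nnegrE ?normr_ge0//; exact: ltW.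
Qed.

End bump.

Section bump_manifold.
Variables (R : realType) (n : nat) (M : ptopologicalType).
Variable A : smooth_atlas R n M.
Hypothesis M_hausdorff : hausdorff_space M.

(** A point outside the domain of chart i lies in the open complement of K, where f vanishes
    identically. *)
Lemma zero_outside_C1 (f : M -> R) (i : chart_index A) (K : set M) : closed K ->
  (forall p, chart_dom i p -> C1at (f \o chart_inv i) (chart i p)) ->
  K `<=` chart_dom i -> (forall p, ~ K p -> f p = 0) -> C1_function A f.
Proof.
move=> clK Cf Ki f0 j p jp.
have [ip|nip] := pselect (chart_dom i p).
  by apply: C1at_transition (Cf p ip).
have nKp : (~` K) p by move=> /Ki.
have oK : open (~` K) by exact: closed_openC.
apply: (@C1at_near_eq _ _ (cst 0)); last exact: C1at_cst.
apply: filterS (near_chart jp (open_nbhs_nbhs (conj oK nKp))) => x [_ nK].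
by rewrite /= f0.
Qed.

(** N confines the support to the place where two charts are compared; for the partition of
    functions it is all of M. *)
Lemma bump_exists p (N : set M) : nbhs p N ->
  exists (b : M -> R) (K : set M) (i : chart_index A),
  [/\ compact K, K `<=` chart_dom i, K `<=` N & C1_function A b] /\
  [/\ forall q, 0 <= b q, 0 < b p & forall q, ~ K q -> b q = 0].
Proof.
move=> Np; have ip := chart_atP A p; set i := chart_at A p in ip *.
have /nbhs_ballP[e /= e0 he] := near_chart ip Np.
have e20 : 0 < e / 2 by rewrite divr_gt0.
set x := chart i p in he.
pose K := chart_inv i @` closed_ball x (e / 2).
have xe y : closed_ball x (e / 2) y -> ball x e y.
  rewrite closed_ballE// /closed_ball_ -ball_normE /ball_/= => h.
  by rewrite (le_lt_trans h)// gtr_pMr// invf_lt1// ltr1n.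
have cK : compact K.
  apply: continuous_compact.
    apply: continuous_in_subspaceT => y /set_mem/xe/he[iy _].
    exact: chart_inv_cts.
  apply: bounded_closed_compact; last exact: closed_ball_closed.
  exists (`|x| + e / 2); split; first exact: num_real.
  move=> a xa y; rewrite closed_ballE// /closed_ball_/= => h.
  apply: le_trans (ltW xa); rewrite -[y in leLHS](subKr x).
  by apply: (le_trans (ler_normB _ _)); rewrite lerD2l.
have Ki : K `<=` chart_dom i by move=> _ [y /xe/he[iy _] <-]; exact: chart_inv_dom.
pose b q := if `[< chart_dom i q >] then bump_rV x (e / 2) (chart i q) else 0.
have bE q : chart_dom i q -> b q = bump_rV x (e / 2) (chart i q).
  by move=> iq; rewrite /b asboolT.
have b0 q : ~ K q -> b q = 0.
  rewrite /b; case: asboolP => // iq nK; apply: bump_rV_out => // h; apply: nK.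
  by exists (chart i q) => //; exact: chartK.
exists b, K, i; split; split => //.
- by move=> _ [y /xe/he[_ Ny] <-].
- apply: (@zero_outside_C1 b i K) => //; first exact: compact_closed.
  move=> q iq; apply: (@C1at_near_eq _ _ (bump_rV x (e / 2))); last exact: bump_rV_C1.
  have oU : open (chart_img i) by exact: chart_img_open.
  apply: (filterS _ (open_nbhs_nbhs (conj oU (chart_imgP iq)))) => y iy.
  by rewrite /= bE ?chart_invK//; exact: chart_inv_dom.
- by move=> q; rewrite /b; case: asboolP => // _; exact: bump_rV_ge0.
- by rewrite bE//; exact: bump_rV_center.
Qed.

End bump_manifold.

(** * Green's formula inside one chart *)

Section green_chart.
Variables (R : realType) (n : nat) (M : ptopologicalType).
Variables (A : smooth_atlas R n M) (g : riemannian_metric A).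
Variable vol : {measure set (borelType M) -> \bar R}.
Hypothesis vol_g : is_riemannian_volume g vol.
Implicit Types (i : chart_index A) (p : M) (X : vfield A) (b : M -> R).

(** The expression of the divergence in a given chart, as opposed to the chart chosen at p in
    [divergence]. *)
Definition div_at i (X : vfield A) p : R :=
  (vol_density g i p)^-1 *
  \sum_(k < n) 'D_(delta_mx 0 k)
     (fun x => vol_density g i (chart_inv i x) * X i (chart_inv i x) 0 k) (chart i p).

(** The derivative of b along X, that is the inner product of grad b and X written without the
    metric. *)
Definition dir_at i (b : M -> R) (X : vfield A) p : R :=
  (partials b i p *m (X i p)^T) 0 0.

Lemma div_at_continuous i X p : chart_dom i p ->
  (forall k q, chart_dom i q -> C1at (fun x => X i (chart_inv i x) 0 k) (chart i q)) ->
  {for p, continuous (div_at i X)}.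
Proof.
move=> ip CX.
apply: (continuous_chart ip (F := fun x => (chart_density g i x)^-1 *
  \sum_(k < n) 'D_(delta_mx 0 k)
     (fun x => chart_density g i x * X i (chart_inv i x) 0 k) x)).
  by move=> q iq; rewrite /chart_density chartK.
apply: continuousM.
  apply: continuousV; first by rewrite gt_eqF// chart_density_gt0//; exact: chart_imgP.
  by apply: C1at_continuous; exact: vol_density_C1.
apply: continuous_sum => k _.
by have [_] := C1atM (vol_density_C1 g ip) (CX k p ip); exact.
Qed.

Lemma dir_at_continuous i b X p : chart_dom i p ->
  C1at (b \o chart_inv i) (chart i p) ->
  (forall k q, chart_dom i q -> C1at (fun x => X i (chart_inv i x) 0 k) (chart i q)) ->
  {for p, continuous (dir_at i b X)}.
Proof.
move=> ip Cb CX.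
apply: (continuous_chart ip (F := fun x => \sum_k
   'D_(delta_mx 0 k) (b \o chart_inv i) x * X i (chart_inv i x) 0 k)).
  move=> q iq; rewrite /dir_at mxE; apply: eq_bigr => k _.
  by rewrite !mxE chartK.
apply: continuous_sum => k _; apply: continuousM; first by have [_] := Cb; exact.
by apply: C1at_continuous; exact: CX.
Qed.

(** The integrand is the divergence of b X. Multiplied by the density of the volume it becomes a sum
    of partial derivatives of compactly supported C^1 functions on R^n, each of integral 0. *)
Lemma green_chart i (X : vfield A) (b : M -> R) (K : set M) :
  (forall k p, chart_dom i p -> C1at (fun x => X i (chart_inv i x) 0 k) (chart i p)) ->
  (forall p, chart_dom i p -> C1at (b \o chart_inv i) (chart i p)) ->
  compact K -> K `<=` chart_dom i -> (forall p, chart_dom i p -> ~ K p -> b p = 0) ->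
  (\int[vol]_(p in chart_dom i) (b p * div_at i X p + dir_at i b X p)%:E = 0)%E.
Proof.
move=> CX Cb cK Ki b0; have [L LL] := lebesgue_rV_exists R n.
have oU : open (chart_img i) by exact: chart_img_open.
have mf : measurable_fun (chart_dom i : set (borelType M))
    ((fun p => b p * div_at i X p + dir_at i b X p) : borelType M -> R).
  apply: continuous_measurable_real; first exact: chart_dom_open.
  move=> p ip; apply: continuousD; last exact: dir_at_continuous (Cb p ip) CX.
  apply: continuousM; last exact: div_at_continuous.
  apply: (continuous_chart ip (F := b \o chart_inv i)).
    by move=> q iq; rewrite /= chartK.
  exact/C1at_continuous/Cb.
rewrite (integral_chart vol_g LL mf).
(* Extension by zero: as K is compact inside the chart, F k is C^1 on the whole of R^n, and
   [chart_inv] is meaningless off the image. *)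
pose F k x := if `[< chart_img i x >] then
  b (chart_inv i x) * (chart_density g i x * X i (chart_inv i x) 0 k) else 0.
pose Kx := chart i @` K.
have cKx : compact Kx.
  apply: continuous_compact => //; apply: continuous_in_subspaceT => p /set_mem/Ki ip.
  exact: chart_continuous.
have clKx : closed Kx by apply: compact_closed => //; exact: norm_hausdorff.
have F0 k x : ~ Kx x -> F k x = 0.
  move=> nK; rewrite /F; case: asboolP => // ix.
  rewrite b0 ?mul0r//; first exact: chart_inv_dom.
  by move=> Kx'; apply: nK; exists (chart_inv i x) => //; exact: chart_invK.
have nF0 k x : ~ Kx x -> \forall y \near x, F k y = 0.
  move=> nK; apply: (filterS _ (open_nbhs_nbhs (conj (closed_openC clKx) nK))).
  by move=> y; exact: F0.
have FE k x : chart_img i x -> \forall y \near x,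
    b (chart_inv i y) * (chart_density g i y * X i (chart_inv i y) 0 k) = F k y.
  move=> ix; apply: (filterS _ (open_nbhs_nbhs (conj oU ix))) => y iy.
  by rewrite /F asboolT.
have CF k x : C1at (F k) x.
  have [ix|nix] := pselect (chart_img i x).
    apply: C1at_near_eq (FE k x ix) _.
    case: ix => p ip <-; apply: C1atM; first exact: Cb.
    by apply: C1atM; [exact: vol_density_C1|exact: CX].
  have nK : ~ Kx x by move=> [p /Ki ip px]; apply: nix; exists p.
  apply: (@C1at_near_eq _ _ (cst 0)); last exact: C1at_cst.
  by apply: filterS (nF0 k x nK) => y ->.
have [r Fr] : exists r, forall k x, r < `|x| -> F k x = 0.
  have [r [_ hr]] := compact_bounded cKx; exists (r + 1) => k x xr.
  apply: F0 => Kxx; have r1 : r < r + 1 by rewrite ltrDl.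
  by have /= := hr _ r1 x Kxx; rewrite leNgt xr.
have DF0 k x : ~ chart_img i x -> 'D_(delta_mx 0 k) (F k) x = 0.
  move=> nix; rewrite (@near_eq_derive _ _ _ (F k) (cst 0)) ?derive_cst//.
  by apply: nF0 => -[p /Ki ip px]; apply: nix; exists p.
(* The Leibniz rule for b times (density times X^k); the density cancels its inverse in [div_at]. *)
rewrite (eq_integral (fun x : borelType 'rV[R]_n => (\sum_k 'D_(delta_mx 0 k) (F k) x)%:E)); last first.
  move=> x /set_mem ix; congr EFin.
  have idom := chart_inv_dom ix.
  pose B y := b (chart_inv i y).
  pose G k y := chart_density g i y * X i (chart_inv i y) 0 k.
  have [p ip px] := ix.
  have dB : differentiable B x by apply: C1at_differentiable; rewrite -px; exact: Cb.
  have dG k : differentiable (G k) x.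
    apply: C1at_differentiable; rewrite -px.
    by apply: C1atM; [exact: vol_density_C1|exact: CX].
  have DFE k : 'D_(delta_mx 0 k) (F k) x =
      B x * 'D_(delta_mx 0 k) (G k) x + G k x * 'D_(delta_mx 0 k) B x.
    rewrite -(near_eq_derive _ (FE k x ix)).
    by rewrite -[LHS]/('D_(delta_mx 0 k) (B * G k) x) deriveM//; exact: diff_derivable.
  under [RHS]eq_bigr do rewrite DFE.
  rewrite big_split/= -mulr_sumr mulrDl; congr (_ + _).
    rewrite /div_at chart_invK// -/(chart_density g i x) -mulrA; congr (_ * _).
    by rewrite mulrAC mulVf ?mul1r// gt_eqF// chart_density_gt0.
  rewrite /dir_at mxE mulr_suml; apply: eq_bigr => k _.
  by rewrite !mxE chart_invK// /G /chart_density mulrC mulrA mulrAC.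
have -> : (\int[L]_(x in chart_img i) (\sum_k 'D_(delta_mx 0 k) (F k) (x : 'rV[R]_n))%:E =
    \int[L]_x \sum_(k <- index_enum 'I_n) ('D_(delta_mx 0 k) (F k) (x : 'rV[R]_n))%:E)%E.
  rewrite integral_mkcond; apply: eq_integral => x _; rewrite /patch sumEFin.
  case: ifPn => // /negP; rewrite inE => nix.
  by rewrite big1// => k _; exact: DF0.
have DF k := integral_derive0 LL k (CF k) (Fr k).
rewrite integral_sum//; last by move=> k; have [] := DF k.
by apply: big1 => k _; have [] := DF k.
Qed.

End green_chart.

(** * Chart independence of the divergence and the global Green formula *)

Section divergence.
Variables (R : realType) (n : nat) (M : ptopologicalType).
Variables (A : smooth_atlas R n M) (g : riemannian_metric A).
Variable vol : {measure set (borelType M) -> \bar R}.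
Hypothesis vol_g : is_riemannian_volume g vol.
Hypothesis M_hausdorff : hausdorff_space M.
Implicit Types (i : chart_index A) (p : M) (X : vfield A) (b : M -> R).

Lemma C1_vfield_at X : C1_vfield X -> forall i k p, chart_dom i p ->
  C1at (fun x => X i (chart_inv i x) 0 k) (chart i p).
Proof. by move=> [_ CX] i k p; exact: CX. Qed.

(** Integration over K instead of the chart domain, with integrability, so that the formulas of two
    charts containing K can be subtracted. *)
Lemma green_compact i X b (K : set M) : C1_vfield X -> C1_function A b ->
  compact K -> K `<=` chart_dom i -> (forall p, ~ K p -> b p = 0) ->
  vol.-integrable (K : set (borelType M))
    (fun p => (b p * div_at g i X p + dir_at i b X p)%:E) /\
  (\int[vol]_(p in K) (b p * div_at g i X p + dir_at i b X p)%:E = 0)%E.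
Proof.
move=> CX Cb cK Ki b0; have clK : closed K by exact: compact_closed.
have mK : measurable (K : set (borelType M)) by exact: closed_measurable_borel.
set f := fun p => b p * div_at g i X p + dir_at i b X p.
have cf p : chart_dom i p -> {for p, continuous f}.
  move=> ip; apply: continuousD; last first.
    by apply: dir_at_continuous => //; [exact: Cb|exact: C1_vfield_at].
  apply: continuousM; first exact: (C1_function_continuous Cb).
  by apply: div_at_continuous => //; exact: C1_vfield_at.
have mf : measurable_fun (chart_dom i : set (borelType M)) (f : borelType M -> R).
  by apply: continuous_measurable_real => //; exact: chart_dom_open.
have [B B0 fB] := compact_continuous_bounded cK (fun p Kp => cf p (Ki p Kp)).
have f0 p : chart_dom i p -> ~ K p -> f p = 0.
  move=> ip nK; rewrite /f b0// mul0r add0r /dir_at partials_eq0// ?mul0mx ?mxE//.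
  by apply: (filterS _ (open_nbhs_nbhs (conj (closed_openC clK) nK))) => q; exact: b0.
have mfK : measurable_fun (K : set (borelType M)) (f : borelType M -> R).
  by apply: (@measurable_funS _ _ _ _ (chart_dom i : set (borelType M))) => //;
    exact: measurable_chart_dom.
split.
  apply: measurable_bounded_integrable => //; first exact: (volume_compact_lty vol_g clK cK).
  exists B; split; first exact: num_real.
  by move=> x Bx p Kp; rewrite /= (le_trans (fB p Kp))// ltW.
rewrite -(green_chart vol_g (C1_vfield_at CX (i := i)) (Cb i) cK Ki); last first.
  by move=> p _; exact: b0.
rewrite -(setIidr Ki) integral_mkcondr; apply: eq_integral => p /set_mem ip.
rewrite /patch; case: ifPn => // /negP; rewrite inE => nK.
by rewrite -/(f p) f0.
Qed.

Lemma dir_atE i b X p : is_vfield X -> C1_function A b -> chart_dom i p ->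
  dir_at i b X p = vinner g (grad g b) X p.
Proof.
move=> vX Cb ip; rewrite (@vinnerE _ _ _ _ g _ _ i)//.
  by rewrite inner_grad.
by apply: grad_is_vfield; exact: C1_function_differentiable.
Qed.

(* Both chart expressions of the divergence satisfy Green's formula against
   bump functions, and open sets have positive volume. *)
Lemma div_at_le i j X p : C1_vfield X -> chart_dom i p -> chart_dom j p ->
  div_at g i X p <= div_at g j X p.
Proof.
move=> CX ip jp; rewrite leNgt; apply/negP => ji.
have ci : {for p, continuous (div_at g i X)}.
  by apply: div_at_continuous => //; exact: C1_vfield_at.
have cj : {for p, continuous (div_at g j X)}.
  by apply: div_at_continuous => //; exact: C1_vfield_at.
have : \forall q \near p, [/\ chart_dom i q, chart_dom j q &
    0 < div_at g i X q - div_at g j X q].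
  have h1 : \forall q \near p, chart_dom i q.
    by apply: open_nbhs_nbhs; split => //; exact: chart_dom_open.
  have h2 : \forall q \near p, chart_dom j q.
    by apply: open_nbhs_nbhs; split => //; exact: chart_dom_open.
  have h3 : \forall q \near p, 0 < div_at g i X q - div_at g j X q.
    have h : \forall t \near div_at g i X p - div_at g j X p, 0 < t.
      by apply: lt_nbhsr; rewrite subr_gt0.
    exact: (continuousB ci cj h).
  by near=> q; split; near: q.
move=> Np; have [b [K [l [[cK _ KN Cb] [b0 bp bK]]]]] := bump_exists A M_hausdorff Np.
have [Ii Gi] := green_compact CX Cb cK (fun q Kq => let: And3 a _ _ := KN q Kq in a) bK.
have [Ij Gj] := green_compact CX Cb cK (fun q Kq => let: And3 _ a _ := KN q Kq in a) bK.
have clK : closed K by exact: compact_closed.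
have mK : measurable (K : set (borelType M)) by exact: closed_measurable_borel.
have vX := CX.1.
(* The derivative of b along X is the same in both charts, so in the difference of the two formulas
   only the divergences remain. *)
have iK : vol.-integrable (K : set (borelType M))
    (fun q => (b q * (div_at g i X q - div_at g j X q))%:E).
  apply: eq_integrable (integrableB mK Ii Ij) => // q /set_mem Kq.
  have [iq jq _] := KN q Kq.
  by rewrite /= -EFinB; congr EFin; rewrite (dir_atE vX Cb iq) (dir_atE vX Cb jq); ring.
have zK : (\int[vol]_(q in K) (b q * (div_at g i X q - div_at g j X q))%:E = 0)%E.
  have := integralB mK Ii Ij; rewrite Gi Gj sube0 => <-.
  apply: eq_integral => q /set_mem Kq; have [iq jq _] := KN q Kq.
  by rewrite /= -EFinB; congr EFin; rewrite (dir_atE vX Cb iq) (dir_atE vX Cb jq); ring.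
have : (\int[vol]_(q in K) `|(b q * (div_at g i X q - div_at g j X q))%:E| = 0)%E.
  rewrite -zK; apply: eq_integral => q /set_mem Kq; have [_ _ d0] := KN q Kq.
  by rewrite gee0_abs// lee_fin mulr_ge0// ltW.
have mE := measurable_int _ iK.
move/(ae_eq_integral_abs vol mK mE) => [Z [mZ Z0 sZ]].
(* The integrand is nonnegative on K with integral 0, and strictly positive on O: hence O is
   negligible, although it is open and contains p. *)
pose O := [set q | 0 < b q].
have oO : open O.
  apply: (@open_comp _ _ b [set t | 0 < t]); last exact: open_gt.
  by move=> q _; exact: (C1_function_continuous Cb).
have OK : O `<=` K.
  by move=> q bq; apply: contrapT => /bK bq0; rewrite /O/= bq0 ltxx in bq.
have := volume_open_gt0 vol_g oO (ex_intro _ p bp).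
suff -> : vol (O : set (borelType M)) = 0%E by rewrite ltxx.
apply: (subset_measure0 (open_measurable_borel oO) mZ _ Z0) => q bq.
apply: sZ => /= /(_ (OK q bq)) /eqP; have [_ _ d0] := KN q (OK q bq).
by rewrite eqe mulf_eq0 !gt_eqF.
Unshelve. all: by end_near. Qed.

Lemma div_at_eq i j X p : C1_vfield X -> chart_dom i p -> chart_dom j p ->
  div_at g i X p = div_at g j X p.
Proof. by move=> CX ip jp; apply/eqP; rewrite eq_le !div_at_le. Qed.

Lemma divergenceE i X p : C1_vfield X -> chart_dom i p ->
  divergence g X p = div_at g i X p.
Proof. by move=> CX ip; exact: (div_at_eq CX (chart_atP A p) ip). Qed.

Lemma divergence_continuous X : C1_vfield X -> continuous (divergence g X).
Proof.
move=> CX p; have ip := chart_atP A p.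
apply: (@continuous_near_eq _ _ (div_at g (chart_at A p) X)).
  apply: (filterS _ (open_nbhs_nbhs (conj (chart_dom_open (chart_at A p)) ip))) => q iq.
  by rewrite (divergenceE CX iq).
by apply: div_at_continuous => //; exact: C1_vfield_at.
Qed.

Lemma partialsD f h i p : chart_dom i p ->
  C1at (f \o chart_inv i) (chart i p) -> C1at (h \o chart_inv i) (chart i p) ->
  partials (fun q => f q + h q) i p = partials f i p + partials h i p.
Proof.
move=> ip /C1at_differentiable Cf /C1at_differentiable Ch; apply/rowP => k; rewrite !mxE.
rewrite (_ : _ \o _ = (f \o chart_inv i) + (h \o chart_inv i))//.
by rewrite deriveD//; exact: diff_derivable.
Qed.

Lemma C1_functionD f h : C1_function A f -> C1_function A h ->
  C1_function A (fun p => f p + h p).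
Proof. by move=> Cf Ch i p ip; apply: C1atD; [exact: Cf|exact: Ch]. Qed.

(** Green's formula together with the regularity and integrability that make it additive in b. *)
Definition green_for X b : Prop := [/\ C1_function A b,
  vol.-integrable [set: borelType M]
    (fun p => (b p * divergence g X p + vinner g (grad g b) X p)%:E) &
  (\int[vol]_p (b p * divergence g X p + vinner g (grad g b) X p)%:E = 0)%E].

Lemma green_for_chart i X b (K : set M) : C1_vfield X -> C1_function A b ->
  compact K -> K `<=` chart_dom i -> (forall p, ~ K p -> b p = 0) -> green_for X b.
Proof.
move=> CX Cb cK Ki b0; have clK : closed K by exact: compact_closed.
have mK : measurable (K : set (borelType M)) by exact: closed_measurable_borel.
have [IK GK] := green_compact CX Cb cK Ki b0; have vX := CX.1.
have E : (fun p => (b p * divergence g X p + vinner g (grad g b) X p)%:E) =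
    (fun p => (b p * div_at g i X p + dir_at i b X p)%:E) \_ K.
  apply/funext => p; rewrite /patch; case: ifPn => [/set_mem Kp|/negP].
    by rewrite (divergenceE CX (Ki p Kp)) (dir_atE vX Cb (Ki p Kp)).
  rewrite inE => nK; have jp := chart_atP A p.
  rewrite -(dir_atE vX Cb jp) b0// mul0r add0r /dir_at partials_eq0// ?mul0mx ?mxE//.
  by apply: (filterS _ (open_nbhs_nbhs (conj (closed_openC clK) nK))) => q; exact: b0.
split; first exact: Cb.
- by rewrite E; apply/(integrable_mkcond _ mK).
- by rewrite E -integral_mkcond.
Qed.

Lemma green_forD X b1 b2 : C1_vfield X -> green_for X b1 -> green_for X b2 ->
  green_for X (fun p => b1 p + b2 p).
Proof.
move=> CX [C1 I1 G1] [C2 I2 G2]; have C12 := C1_functionD C1 C2; have vX := CX.1.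
pose F b (p : borelType M) := (b p * divergence g X p + vinner g (grad g b) X p)%:E.
have E : F (fun p => b1 p + b2 p) = (F b1 \+ F b2)%E.
  apply/funext => p; have ip := chart_atP A p; rewrite /F -EFinD; congr EFin.
  rewrite -!(dir_atE vX _ ip)// /dir_at partialsD; [|exact: ip|exact: C1|exact: C2].
  by rewrite mulmxDl mxE; ring.
split; first exact: C12.
- rewrite -/(F (fun p => b1 p + b2 p)) E; exact: (integrableD measurableT I1 I2).
- rewrite -/(F (fun p => b1 p + b2 p)) E (integralD measurableT I1 I2).
  by rewrite [X in (X + _)%E]G1 [X in (_ + X)%E]G2 adde0.
Qed.

Lemma green_for_sum X (s : seq M) (f : M -> M -> R) : C1_vfield X ->
  (forall p, green_for X (f p)) -> green_for X (fun q => \sum_(p <- s) f p q).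
Proof.
move=> CX Gf; elim: s => [|p s IH].
  have Z : (fun q => \sum_(p <- [::]) f p q) = cst 0.
    by apply/funext => q; rewrite big_nil.
  have C0 : C1_function A (cst 0 : M -> R) by move=> i q iq; exact: C1at_cst.
  rewrite Z; apply: (@green_for_chart (chart_at A point) X (cst 0) set0) => //.
  exact: compact0.
have -> : (fun q => \sum_(p <- p :: s) f p q) = (fun q => f p q + \sum_(p <- s) f p q).
  by apply/funext => q; rewrite big_cons.
exact: (green_forD CX (Gf p) IH).
Qed.

Lemma C1_function_sum (s : seq M) (f : M -> M -> R) :
  (forall p, C1_function A (f p)) -> C1_function A (fun q => \sum_(p <- s) f p q).
Proof. by move=> Cf i q iq; apply: C1at_sum => p _; exact: Cf. Qed.

(* Partition of b into the functions b c_p / (sum of the c_q), where finitely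
   many bump functions c_p, each supported in a chart, cover K. *)
Lemma green X b (K : set M) : C1_vfield X -> C1_function A b ->
  compact K -> (forall p, ~ K p -> b p = 0) -> green_for X b.
Proof.
move=> CX Cb cK b0; have clK : closed K by exact: compact_closed.
have h p : exists w : (M -> R) * set M * chart_index A,
  [/\ compact w.1.2, w.1.2 `<=` chart_dom w.2 & C1_function A w.1.1] /\
  [/\ forall q, 0 <= w.1.1 q, 0 < w.1.1 p & forall q, ~ w.1.2 q -> w.1.1 q = 0].
  have [c [K' [i [[? ? _ ?] [? ? ?]]]]] := bump_exists A M_hausdorff (@filterT _ (nbhs p) _).
  by exists (c, K', i).
have [w hw] := choice h.
pose B p := (w p).1.1.
have CB p : C1_function A (B p) by have [[_ _ h0] _] := hw p.
have B0 p q : 0 <= B p q by have [_ [h0 _ _]] := hw p; exact: h0.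
have [|s sK KU] := @compact_pointwise_cover M K (fun p => [set q | 0 < B p q]) cK.
  move=> p Kp; split; last by have [_ [_ h0 _]] := hw p.
  apply: (@open_comp _ _ (B p) [set t | 0 < t]); last exact: open_gt.
  by move=> q _; exact: (C1_function_continuous (CB p)).
pose S q := \sum_(p <- s) B p q.
have S0 q : K q -> 0 < S q.
  move=> /KU[p /= ps Bpq]; rewrite /S (big_rem p)//=.
  by rewrite ltr_pwDl// sumr_ge0.
have CS : C1_function A S by exact: C1_function_sum.
pose f p q := B p q * (b q / S q).
(* S may vanish off K, where the quotient is not regular by itself; but K is closed, so b and with
   it the whole product vanish near such points. *)
have Cf p : C1_function A (f p).
  move=> i q iq; have [Kq|nK] := pselect (K q).
    apply: C1atM; first exact: CB.
    apply: C1atM; first exact: Cb.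
    by apply: C1atV; [exact: CS|rewrite /= chartK// gt_eqF// S0].
  apply: (@C1at_near_eq _ _ (cst 0)); last exact: C1at_cst.
  apply: filterS (near_chart iq (open_nbhs_nbhs (conj (closed_openC clK) nK))).
  by move=> x [_ nKx]; rewrite /= /f b0// mul0r mulr0.
have -> : b = (fun q => \sum_(p <- s) f p q).
  apply/funext => q; rewrite -mulr_suml -/(S q).
  have [Kq|nK] := pselect (K q); last by rewrite b0// mul0r mulr0.
  by rewrite mulrC divfK// gt_eqF// S0.
apply: green_for_sum => // p; have [[cKp Kpi _] [_ _ Bp0]] := hw p.
apply: (@green_for_chart (w p).2 X (f p) (w p).1.2) => // q nq.
by rewrite /f /B Bp0// mul0r.
Qed.

End divergence.

(** * Distance and Lipschitz functions *)

Section curves.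
Variable R : realType.

Lemma derive1_comp_rV n m (c : R -> 'rV[R]_n) (T : 'rV[R]_n -> 'rV[R]_m) (t : R) :
  derivable c t 1 -> differentiable T (c t) ->
  derivable (T \o c) t 1 /\ derive1 (T \o c) t = derive1 c t *m 'J T (c t).
Proof.
move=> /derivable1_diffP dc dT.
have dTc : differentiable (T \o c) t by exact: differentiable_comp.
split; first exact/derivable1_diffP.
by rewrite derive1E' // diff_comp//= -derive1E'// -deriveEjacobian// deriveE.
Qed.

Lemma derive1_near_eq (W : normedModType R) (f h : R -> W) (t : R) :
  (\forall s \near t, f s = h s) -> derive1 f t = derive1 h t.
Proof. by move=> fh; rewrite !derive1E; exact: near_eq_derive. Qed.

End curves.

Section distance.
Variables (R : realType) (n : nat) (M : ptopologicalType).
Variables (A : smooth_atlas R n M) (g : riemannian_metric A).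
Implicit Types (i j : chart_index A) (p : M) (c : R -> M).
Local Notation dist := (riemannian_dist g).

Lemma curve_length_ge0 c : (0 <= curve_length g c)%E.
Proof. by apply: integral_ge0 => t _; rewrite lee_fin sqrtr_ge0. Qed.

Lemma riemannian_dist_ge0 p q : (0 <= dist p q)%E.
Proof.
apply: le_ereal_inf_tmp => _ [s _ ->].
by apply: sume_ge0 => c _; exact: curve_length_ge0.
Qed.

Lemma riemannian_dist_le_curve c : C1_curve A c -> (dist (c 0%R) (c 1%R) <= curve_length g c)%E.
Proof.
move=> Cc; apply: ereal_inf_lbound; exists [:: c]; first by split.
by rewrite big_seq1.
Qed.

(** [speed] switches charts from one time to the next. Velocities transform by the Jacobian, so any
    fixed chart around a piece of the curve computes it as well. *)
Lemma speed_chart i c t : chart_dom i (c t) -> {for t, continuous c} ->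
  derivable (chart i \o c) t 1 ->
  speed g c t = Num.sqrt (inner_at g i (c t) (derive1 (chart i \o c) t)
                                             (derive1 (chart i \o c) t)).
Proof.
move=> ip cc dc; have jp := chart_atP A (c t); set j := chart_at A (c t) in jp.
have oi := chart_dom_open i.
have cE : \forall s \near t, (chart j \o c) s =
    ((chart j \o chart_inv i) \o (chart i \o c)) s.
  have : \forall s \near t, chart_dom i (c s).
    by apply: (cc (chart_dom i)); exact: open_nbhs_nbhs.
  by apply: filterS => s si; rewrite /= chartK.
have dT : differentiable (chart j \o chart_inv i) ((chart i \o c) t).
  by apply: transition_differentiable; exact: overlapP.
have [_ dE] := derive1_comp_rV dc dT.
rewrite /speed -/j (derive1_near_eq cE) dE.
rewrite -[RHS](congr1 Num.sqrt (inner_at_transition g _ _ ip jp)).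
by [].
Qed.

(** Joint continuity yields one neighbourhood of base points and one of vectors on which a strict
    bound persists; the length estimates move both. *)
Lemma inner_at_continuous i (x w : 'rV[R]_n) : chart_img i x ->
  {for (x, w), continuous (fun z : 'rV[R]_n * 'rV[R]_n =>
     inner_at g i (chart_inv i z.1) z.2 z.2)}.
Proof.
move=> ix.
rewrite (_ : (fun z => _) = (fun z : 'rV[R]_n * 'rV[R]_n => \sum_l (\sum_k z.2 0 k *
    gmat g i (chart_inv i z.1) k l) * z.2 0 l)); last first.
  apply/funext => z; rewrite /inner_at mxE; apply: eq_bigr => l _; rewrite !mxE.
  by [].
have c2 k : {for (x, w), continuous (fun z : 'rV[R]_n * 'rV[R]_n => z.2 0 k)}.
  apply: (@continuous_comp _ _ _ snd (fun v : 'rV[R]_n => v 0 k)); first exact: cvg_snd.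
  exact: coord_continuous.
apply: continuous_sum => l _; apply: continuousM; last exact: c2.
apply: continuous_sum => k _; apply: continuousM; first exact: c2.
apply: (@continuous_comp _ _ _ fst (fun y => gmat g i (chart_inv i y) k l)).
  exact: cvg_fst.
by case: ix => p ip <-; apply: C1at_continuous; exact: gmat_C1.
Qed.

Lemma C1_curve_chart_near c i t : C1_curve A c -> 0 <= t <= 1 -> chart_dom i (c t) ->
  \forall s \near t, chart_dom i (c s) /\ derivable (chart i \o c) s 1.
Proof.
move=> Cc t01 ip; have [cc dc] := Cc t t01; have [d1 _] := dc i ip.
apply: filterI; last exact: d1.
by apply: (cc (chart_dom i)); apply: open_nbhs_nbhs; split => //; exact: chart_dom_open.
Qed.

Lemma speed_continuous c : C1_curve A c -> {within `[0, 1], continuous (speed g c)}.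
Proof.
move=> Cc; apply/subspace_continuousP => t; rewrite /= in_itv/= => t01.
set i := chart_at A (c t); have ip : chart_dom i (c t) := chart_atP A (c t).
have [cc dc] := Cc t t01; have [_ cd] := dc i ip.
(* The speed near t, expressed in the single chart chosen at time t. *)
pose h s := Num.sqrt (inner_at g i (chart_inv i (chart i (c s)))
  (derive1 (chart i \o c) s) (derive1 (chart i \o c) s)).
have ch : {for t, continuous h}.
  apply: continuous_comp; last exact: sqrt_continuous.
  apply: (@continuous_comp _ _ _ (fun s => (chart i (c s), derive1 (chart i \o c) s))
    (fun z : 'rV[R]_n * 'rV[R]_n => inner_at g i (chart_inv i z.1) z.2 z.2)).
    have c1 : {for t, continuous (fun s => chart i (c s))}.
      by apply: (continuous_comp cc); exact: chart_continuous.
    exact: (cvg_pair c1 cd).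
  by apply: inner_at_continuous; exact: chart_imgP.
have sE : \forall s \near t, s \in `[0, 1] -> speed g c s = h s.
  apply: filterS (C1_curve_chart_near Cc t01 ip) => s [si ds]; rewrite in_itv/= => s01.
  rewrite (speed_chart si _ ds); first by rewrite /h chartK.
  by have [] := Cc s s01.
have st : speed g c t = h t.
  by have := nbhs_singleton sE; apply; rewrite in_itv.
have {}ch : h s @[s --> within `[0, 1]%classic (nbhs t)] --> speed g c t.
  by rewrite st; exact: cvg_within_filter ch.
apply: cvg_trans ch; apply: near_eq_cvg.
by apply: filterS sE => s sE s01; exact: (esym (sE s01)).
Qed.

(** The straight segment in the chart competes in the infimum that defines the distance. Its
    coordinate velocity is constantly y - x, so B bounds its speed and its length over [0, 1]. *)
Lemma segment_dist i (x y : 'rV[R]_n) (e B : R) : 0 <= B ->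
  ball x e `<=` chart_img i -> ball x e y ->
  (forall z, ball x e z -> inner_at g i (chart_inv i z) (y - x) (y - x) <= B ^+ 2) ->
  (dist (chart_inv i x) (chart_inv i y) <= B%:E)%E.
Proof.
move=> B0 xi xy zB; set v := y - x.
pose l (t : R) := x + t *: v.
have cl : continuous l.
  by move=> t; apply: (@continuousD _ _ _ (cst x) (fun t : R => t *: v)); [exact: cst_continuous|exact: scalel_continuous].
have lb (t : R) : 0 <= t <= 1 -> ball x e (l t).
  move=> /andP[t0 t1]; move: xy; rewrite -!ball_normE /ball_/= /l.
  rewrite opprD addNKr normrN normrZ (ger0_norm t0) distrC => ve.
  by apply: le_lt_trans ve; rewrite ler_piMl.
have dl t : is_derive t (1 : R) l v.
  have di : derivable (id : 'rV[R]_n -> 'rV[R]_n) (x + t *: v) v by exact: derivable_id.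
  have := is_derive_line di.
  by rewrite derive_id.
pose c t := chart_inv i (l t).
have lnear (t : R) : 0 <= t <= 1 -> \forall s \near t, chart_img i (l s).
  move=> /lb/xi il; have oU : open (chart_img i) by exact: chart_img_open.
  exact: (cl t _ (open_nbhs_nbhs (conj oU il))).
have cc (t : R) : 0 <= t <= 1 -> {for t, continuous c}.
  move=> t01; apply: (@continuous_comp _ _ _ l (chart_inv i)); first exact: cl.
  by apply: chart_inv_cts; exact/xi/lb.
have ic (t : R) : 0 <= t <= 1 -> chart_dom i (c t).
  by move=> /lb/xi; exact: chart_inv_dom.
have ciE (t : R) : 0 <= t <= 1 -> \forall s \near t, (chart i \o c) s = l s.
  by move=> /lnear; apply: filterS => s il; rewrite /= /c chart_invK.
have Cc : C1_curve A c.
  (* [C1_curve] concerns every chart that meets the curve, so the segment is followed by a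
     transition map. *)
  move=> t t01; split; first exact: cc.
  move=> j jc; have ict := ic t t01.
  have oij := @open_overlap _ _ _ A i j.
  have lij : overlap i j (l t).
    exists (c t) => //; rewrite /c chart_invK//; exact/xi/lb.
  have nl : \forall s \near t, overlap i j (l s).
    exact: (cl t _ (open_nbhs_nbhs (conj oij lij))).
  have dT s : overlap i j (l s) -> derivable (chart j \o c) s 1 /\
      derive1 (chart j \o c) s = v *m 'J (chart j \o chart_inv i) (l s).
    move=> ls; have [] := @derive1_comp_rV R n n l (chart j \o chart_inv i) s _ _.
    - by have [] := dl s.
    - exact: transition_differentiable.
    - by move=> h1 h2; split; [exact: h1|apply: (etrans h2); rewrite derive1E; have [_ ->] := dl s].
  split.
    by apply: filterS nl => s /dT[].
  apply: (@continuous_near_eq _ _ (fun s => 'D_v (chart j \o chart_inv i) (l s))).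
    apply: filterS nl => s ls; rewrite (dT s ls).2.
    by rewrite deriveEjacobian//; exact: transition_differentiable.
  apply: continuous_rV => k.
  apply: (@continuous_near_eq _ _ (fun s => \sum_a v 0 a *
      'D_(delta_mx 0 a) (fun y => (chart j \o chart_inv i) y 0 k) (l s))).
    apply: filterS nl => s ls; have dTl := transition_differentiable ls.
    rewrite derive_coord; last exact: diff_derivable.
    by rewrite [RHS]derive_partials//; apply: differentiable_coord_comp.
  apply: continuous_sum => a _; apply: continuousM; first exact: cst_continuous.
  have [_ cT] := transition_C1 k lij.
  exact: (@continuous_comp _ _ _ l _ t (cl t) (cT a)).
have c0 : c 0 = chart_inv i x by rewrite /c /l scale0r addr0.
have c1 : c 1 = chart_inv i y by rewrite /c /l scale1r addrC subrK.
rewrite -c0 -c1; apply: (le_trans (riemannian_dist_le_curve Cc)).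
have sB (t : R) : 0 <= t <= 1 -> speed g c t <= B.
  move=> t01; rewrite (speed_chart (ic t t01) (cc t t01)).
    rewrite (derive1_near_eq (ciE t t01)) derive1E; have [_ ->] := dl t.
    rewrite -(ger0_norm B0) -sqrtr_sqr ler_wsqrtr//.
    exact: zB (lb t t01).
  by apply: (near_eq_derivable (f := l)); [apply: filterS (ciE t t01) => s ->|have [] := dl t].
have ms : measurable_fun (`[0%R, 1%R] : set R) (speed g c).
  by apply: subspace_continuous_measurable_fun => //; exact: speed_continuous.
rewrite /curve_length.
apply: (@le_trans _ _ (\int[@lebesgue_measure R]_(t in `[0%R, 1%R]) (cst B%:E t))%E).
  apply: ge0_le_integral => //.
  - by move=> t _; rewrite lee_fin sqrtr_ge0.
  - exact/measurable_EFinP.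
by rewrite integral_cst//= lebesgue_measure_itv/= lte_fin ltr01 -EFinD subr0 mule1.
Qed.

End distance.

(** Continuous induction, with no differentiability of f: at the supremum m of the times where the
    estimate from 0 holds, the bound to the left of m carries the estimate to m, and the bound to
    its right carries it beyond m unless m = 1. *)
Lemma local_to_global (R : realType) (f H : R -> R) :
  (forall t : R, 0 <= t <= 1 -> \forall s \near t, 0 <= s <= 1 ->
     (t <= s -> `|f s - f t| <= H s - H t) /\ (s <= t -> `|f t - f s| <= H t - H s)) ->
  `|f 1 - f 0| <= H 1 - H 0.
Proof.
move=> loc.
pose E := [set t : R | 0 <= t <= 1 /\ `|f t - f 0| <= H t - H 0].
have E0 : E 0 by split; rewrite ?lexx ?ler01// !subrr normr0.
have supE : has_sup E.
  split; first by exists 0.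
  by exists 1 => t [/andP[]].
set m := sup E.
have m0 : 0 <= m by apply: ub_le_sup => //; case: supE.
have m1 : m <= 1 by apply: ge_sup; [exists 0|move=> t [/andP[]]].
have m01 : 0 <= m <= 1 by rewrite m0 m1.
have /nbhs_ballP[d /= d0 hd] := loc m m01.
have step (t s : R) : `|f t - f 0| <= H t - H 0 -> `|f s - f t| <= H s - H t ->
    `|f s - f 0| <= H s - H 0.
  move=> h1 h2; have -> : f s - f 0 = (f s - f t) + (f t - f 0) by ring.
  by have := ler_normD (f s - f t) (f t - f 0); lra.
have [t [[t01 ht] mt]] : exists t : R, E t /\ m - d < t.
  have [t Et mt] := sup_adherent d0 supE.
  by exists t.
have tm : t <= m by apply: ub_le_sup => //; case: supE.
have Em : `|f m - f 0| <= H m - H 0.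
  have bt : ball m d t.
    by rewrite -ball_normE /ball_/= ger0_norm ?subr_ge0// ltrBlDl -ltrBlDr.
  by have [_ h] := hd t bt t01; apply: (step t) => //; exact: h.
have [m1'|] := ltP m 1; last by move=> ?; have <- : m = 1 by apply/eqP; rewrite eq_le m1.
exfalso.
pose s := Num.min 1 (m + d / 2).
have ms : m < s by rewrite lt_min m1' ltrDl divr_gt0.
have s01 : 0 <= s <= 1 by rewrite (le_trans m0 (ltW ms)) ge_min lexx.
have Es : E s.
  have bs : ball m d s.
    rewrite -ball_normE /ball_/= distrC gtr0_norm ?subr_gt0// ltrBlDl.
    by rewrite gt_min; apply/orP; right; rewrite ltrD2l gtr_pMr// invf_lt1// ltr1n.
  have [h _] := hd s bs s01.
  by split => //; apply: (step m) => //; apply: h; exact: ltW.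
have : s <= m by apply: ub_le_sup => //; case: supE.
by rewrite leNgt ms.
Qed.

(** * Lipschitz estimates along curves *)

Section curve_lipschitz.
Variables (R : realType) (n : nat) (M : ptopologicalType).
Variables (A : smooth_atlas R n M) (g : riemannian_metric A).
Implicit Types (i j : chart_index A) (p : M) (c : R -> M) (f : M -> R).
Local Notation dist := (riemannian_dist g).

(** The metric vanishes on the zero vector, hence by joint continuity it is small on short
    coordinate vectors based near the image of p, and [segment_dist] applies. *)
Lemma dist_chart_near p (e : R) : 0 < e ->
  \forall q \near p, (dist p q <= e%:E)%E.
Proof.
move=> e0; have ip := chart_atP A p; set i := chart_at A p in ip *.
have ix := chart_imgP ip.
have cI := @inner_at_continuous R n M A g i (chart i p) 0 ix.
have h0 : \forall z \near (chart i p, 0 : 'rV[R]_n),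
    inner_at g i (chart_inv i z.1) z.2 z.2 < e ^+ 2.
  have h : \forall t \near (inner_at g i (chart_inv i (chart i p)) 0 0), t < e ^+ 2.
    by apply: lt_nbhsl; rewrite /inner_at !mul0mx mxE exprn_gt0.
  exact: (cI _ h).
move: h0 => [[P Q] [/= /nbhs_ballP[d1 /= d10 P1] /nbhs_ballP[d2 /= d20 Q2]] PQ].
have [d3 /= d30 I3] : exists2 d, 0 < d & ball (chart i p) d `<=` chart_img i.
  have oU : open (chart_img i) by exact: chart_img_open.
  by have /nbhs_ballP[d /= d0 ?] := open_nbhs_nbhs (conj oU ix); exists d.
pose d := Num.min d1 (Num.min d2 d3).
have d0 : 0 < d by rewrite !lt_min d10 d20.
have dd1 : d <= d1 by rewrite ge_min lexx.
have dd2 : d <= d2 by rewrite !ge_min lexx orbT.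
have dd3 : d <= d3 by rewrite !ge_min lexx !orbT.
have nb : \forall q \near p, chart_dom i q /\ ball (chart i p) d (chart i q).
  apply: filterI.
    by apply: open_nbhs_nbhs; split => //; exact: chart_dom_open.
  exact: (chart_continuous ip (nbhsx_ballx _ _ d0)).
apply: filterS nb => q [iq xq].
rewrite -[in leLHS](chartK ip) -(chartK iq).
apply: (@segment_dist R n M A g i _ _ d); first exact: ltW.
- by move=> z /(le_ball dd3)/I3.
- exact: xq.
- move=> z xz; apply/ltW/(PQ (z, chart i q - chart i p)); split => /=.
    exact/P1/(le_ball dd1).
  apply/Q2/(le_ball dd2); move: xq; rewrite -!ball_normE /ball_/= sub0r normrN.
  by rewrite distrC.
Qed.

(** The coordinate segment from [c t] to [c s] replaces the curve: its direction is s - t times a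
    difference quotient close to the velocity v, and the metric changes little between nearby base
    points. *)
Lemma dist_curve c (t e : R) : C1_curve A c -> 0 <= t <= 1 -> 0 < e ->
  \forall s \near t, (dist (c t) (c s) <= (`|s - t| * (speed g c t + e))%:E)%E.
Proof.
move=> Cc t01 e0; set i := chart_at A (c t).
have ip : chart_dom i (c t) := chart_atP A (c t).
have ix := chart_imgP ip; have [cc dc] := Cc t t01; have [dn _] := dc i ip.
have dt := nbhs_singleton dn.
pose c' := chart i \o c; set x := chart i (c t) in ix; pose v := derive1 c' t.
have spE : speed g c t = Num.sqrt (inner_at g i (chart_inv i x) v v).
  by rewrite (speed_chart g ip cc dt) chartK.
set sp := speed g c t in spE *.
have sp0 : 0 <= sp by exact: sqrtr_ge0.
have spe : 0 <= sp + e by rewrite addr_ge0// ltW.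
have cI := @inner_at_continuous R n M A g i x v ix.
have h0 : \forall z \near (x, v), inner_at g i (chart_inv i z.1) z.2 z.2 < (sp + e) ^+ 2.
  have h : \forall t \near inner_at g i (chart_inv i x) v v, t < (sp + e) ^+ 2.
    apply: lt_nbhsl; rewrite -(@sqr_sqrtr _ (inner_at _ _ _ _ _)); last first.
      by apply: inner_at_ge0; rewrite chartK.
    by rewrite -spE ltrXn2r// ltrDl.
  exact: (cI _ h).
move: h0 => [[P Q] [/= /nbhs_ballP[d1 /= d10 P1] /nbhs_ballP[d2 /= d20 Q2]] PQ].
have [d3 /= d30 I3] : exists2 d, 0 < d & ball x d `<=` chart_img i.
  have oU : open (chart_img i) by exact: chart_img_open.
  by have /nbhs_ballP[d /= d0 ?] := open_nbhs_nbhs (conj oU ix); exists d.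
pose d := Num.min d1 d3.
have d0 : 0 < d by rewrite lt_min d10.
have dd1 : d <= d1 by rewrite ge_min lexx.
have dd3 : d <= d3 by rewrite !ge_min lexx orbT.
have n1 : \forall s \near t, chart_dom i (c s) /\ ball x d (c' s).
  apply: filterI.
    by apply: (cc (chart_dom i)); apply: open_nbhs_nbhs; split => //; exact: chart_dom_open.
  have cc' : {for t, continuous c'} by apply: (continuous_comp cc); exact: chart_continuous.
  exact: (cc' _ (nbhsx_ballx _ _ d0)).
have n2 : \forall s \near t, `|c' s - c' t - (s - t) *: v| <= d2 / 2 * `|s - t|.
  have dfc : differentiable c' t by exact/derivable1_diffP.
  have d220 : 0 < d2 / 2 by rewrite divr_gt0.
  have := differentiable_littleo dfc d220.
  rewrite (near_shift t 0) => h; near=> s.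
  have : `|c' ((s - t) + t) - c' t - 'd c' t (s - t)| <= d2 / 2 * `|s - t|.
    by near: s; apply: filterS h => s /=; rewrite sub0r.
  by rewrite subrK deriv1E.
near=> s.
have [si xs] : chart_dom i (c s) /\ ball x d (c' s) by near: s.
(* A point is joined to itself by the empty list of curves; otherwise s - t can be inverted. *)
have [->|st] := eqVneq s t.
  rewrite subrr normr0 mul0r; apply: ereal_inf_lbound; exists [::] => //.
  by rewrite big_nil.
have st0 : 0 < `|s - t| by rewrite normr_gt0 subr_eq0.
rewrite -[in leLHS](chartK ip) -(chartK si).
apply: (@segment_dist R n M A g i _ _ d); first by rewrite mulr_ge0.
- by move=> z /(le_ball dd3)/I3.
- exact: xs.
(* The difference quotient, which [n2] keeps within d2 of v. *)
- move=> z xz; pose w := (s - t)^-1 *: (c' s - x).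
  have st1 : s - t != 0 by rewrite subr_eq0.
  have -> : chart i (c s) - chart i (c t) = (s - t) *: w by rewrite scalerA mulfV// scale1r.
  rewrite inner_atZl inner_atZr mulrA -expr2 exprMn real_normK ?num_real//.
  rewrite ler_wpM2l ?sqr_ge0//; apply/ltW/(PQ (z, w)); split => /=.
    exact/P1/(le_ball dd1).
  apply: Q2; rewrite -ball_normE /ball_/= distrC.
  have -> : w - v = (s - t)^-1 *: (c' s - c' t - (s - t) *: v).
    by rewrite scalerBr [in RHS]scalerA mulVf// scale1r.
  rewrite normrZ normfV ltr_pdivrMl//.
  have h : `|c' s - c' t - (s - t) *: v| <= d2 / 2 * `|s - t| by near: s.
  apply: (le_lt_trans h); rewrite mulrC ltr_pM2l// gtr_pMr// invf_lt1// ltr1n.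
Unshelve. all: by end_near. Qed.

(* Infinitesimal form of the Lipschitz condition along curves. *)
Definition curve_lipschitz f (L : R) : Prop :=
  forall c, C1_curve A c -> forall t : R, 0 <= t <= 1 -> forall e : R, 0 < e ->
    \forall s \near t, `|f (c s) - f (c t)| <= `|s - t| * (L * speed g c t + e).

Lemma measurable_speed c (D : set R) : C1_curve A c -> measurable D ->
  D `<=` `[0, 1] -> measurable_fun D (speed g c).
Proof.
move=> Cc mD D01; apply: (@measurable_funS _ _ _ _ (`[0, 1]%classic : set R)) => //.
by apply: subspace_continuous_measurable_fun => //; exact: speed_continuous.
Qed.

Lemma speed_integral_ge c (a b m : R) : C1_curve A c -> 0 <= a -> a <= b -> b <= 1 ->
  (forall s, a <= s <= b -> m <= speed g c s) ->
  (((b - a) * m)%:E <= \int[@lebesgue_measure R]_(s in `]a, b]) (speed g c s)%:E)%E.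
Proof.
(* m is later the speed minus a small constant and may be negative, whereas monotonicity of the
   integral is applied to nonnegative functions. *)
move=> Cc a0 ab b1 ms; pose m' := Num.max m 0.
apply: (@le_trans _ _ ((b - a) * m')%:E).
  by rewrite lee_fin ler_wpM2l ?subr_ge0// le_max lexx.
have sub01 : `]a, b]%classic `<=` (`[0, 1]%classic : set R).
  move=> s; rewrite /= !in_itv/= => /andP[sa sb].
  by rewrite (le_trans a0 (ltW sa)) (le_trans sb b1).
apply: (@le_trans _ _ (\int[@lebesgue_measure R]_(s in `]a, b]) (cst m'%:E s))%E).
  rewrite integral_cst//= lebesgue_measure_itv/= lte_fin -EFinD.
  case: ltP => [_|ba]; first by rewrite -EFinM mulrC.
  by rewrite mule0 lee_fin mulr_le0_ge0// ?subr_le0// le_max lexx orbT.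
apply: ge0_le_integral => //.
- by move=> s _; rewrite /= lee_fin le_max lexx orbT.
- by apply/measurable_EFinP; exact: measurable_speed.
- move=> s; rewrite /= in_itv/= => /andP[sa sb].
  by rewrite lee_fin ge_max sqrtr_ge0 andbT ms// (ltW sa) sb.
Qed.

Definition arclength c (t : R) : R :=
  fine (\int[@lebesgue_measure R]_(s in `[0%R, t]) (speed g c s)%:E)%E.

Lemma integrable_speed c : C1_curve A c ->
  (@lebesgue_measure R).-integrable `[0, 1] (EFin \o speed g c).
Proof.
move=> Cc; apply: continuous_compact_integrable; first exact: segment_compact.
exact: speed_continuous.
Qed.

Lemma arclength_ge c (a b m : R) : C1_curve A c -> 0 <= a -> a <= b -> b <= 1 ->
  (forall s, a <= s <= b -> m <= speed g c s) ->
  (b - a) * m <= arclength c b - arclength c a.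
Proof.
move=> Cc a0 ab b1 ms; have I01 := integrable_speed Cc.
have sub (u v : R) b1' b2' : 0 <= u -> v <= 1 ->
    [set` Interval (BSide b1' u) (BSide b2' v)] `<=` (`[0, 1]%classic : set R).
  move=> u0 v1 s; rewrite /= itv_boundlr => /andP[su sv]; rewrite in_itv/=.
  have -> : 0 <= s by apply: (le_trans u0); move: su; case: b1' => //= /ltW.
  by apply: le_trans v1; move: sv; case: b2' => //= /ltW.
have fin (D : set (measurableTypeR R)) : measurable D -> D `<=` `[0, 1]%classic ->
    (\int[@lebesgue_measure R]_(s in D) (speed g c s)%:E)%E \is a fin_num.
  move=> mD D01; apply: (integrable_fin_num mD).
  by apply: (integrableS _ mD D01 I01); exact: measurable_itv.
have E : (\int[@lebesgue_measure R]_(s in `[0%R, b]) (speed g c s)%:E =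
    \int[@lebesgue_measure R]_(s in `[0%R, a]) (speed g c s)%:E +
    \int[@lebesgue_measure R]_(s in `]a, b]) (speed g c s)%:E)%E.
  have U : `[0, b]%classic = `[0, a]%classic `|` `]a, b]%classic :> set R.
    by rewrite -itv_bndbnd_setU// bnd_simp.
  rewrite U ge0_integral_setU//=.
  - apply/measurable_EFinP; apply: measurable_speed => //; rewrite -U.
      exact: measurable_itv.
    exact: sub.
  - by move=> s _; rewrite lee_fin sqrtr_ge0.
  - apply/disj_setPS => s [/=]; rewrite !in_itv/= => /andP[_ sa] /andP[as' _].
    by rewrite leNgt as' in sa.
rewrite /arclength E fineD; [|by apply: fin => //; apply: sub => //; exact: le_trans b1|
  by apply: fin => //; exact: sub].
rewrite addrAC subrr add0r -lee_fin fineK; last by apply: fin => //; exact: sub.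
exact: speed_integral_ge.
Qed.

(** [local_to_global] applied to f along c, with L times the arc length, plus a small linear term,
    as majorant. The linear term absorbs the errors of the infinitesimal estimates and then tends to
    0. *)
Lemma curve_lipschitz_length f (L : R) c : 0 <= L -> curve_lipschitz f L ->
  C1_curve A c -> ((`|f (c 1) - f (c 0)|)%:E <= L%:E * curve_length g c)%E.
Proof.
move=> L0 fL Cc; have I01 := integrable_speed Cc.
have lE : curve_length g c = (arclength c 1)%:E.
  by rewrite /arclength fineK//; apply: integrable_fin_num => //; exact: measurable_itv.
rewrite lE -EFinM lee_fin; apply/ler_addgt0Pr => e' e'0.
pose e := e' / 2; have e0 : 0 < e by rewrite divr_gt0.
(* The tolerance on the speed, chosen so that L d <= e even when L = 0. *)
pose d := e / (L + 1); have L1 : 0 < L + 1 by rewrite ltr_wpDl.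
have d0 : 0 < d by rewrite divr_gt0.
have Ld : L * d <= e.
  rewrite /d mulrCA ler_piMr ?(ltW e0)// ler_pdivrMr// mul1r.
  by rewrite lerDl.
(* One e pays for the error in [curve_lipschitz], the other for bounding the speed below by its
   value at t minus d. *)
pose H t := L * arclength c t + 2 * e * t.
have : `|f (c 1) - f (c 0)| <= H 1 - H 0.
  apply: (@local_to_global R (fun t => f (c t)) H) => t t01.
  have h1 := fL c Cc t t01 e e0.
  have h2 : \forall s \near t, 0 <= s <= 1 -> speed g c t - d <= speed g c s.
    have sc := (subspace_continuousP _ _).1 (speed_continuous (g := g) Cc).
    have tI : `[0, 1]%classic t by rewrite /= in_itv.
    have cs := sc t tI.
    have h : \forall r \near speed g c t, speed g c t - d < r.
      by apply: lt_nbhsr; rewrite ltrBlDr ltrDl.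
    have hw : \forall s \near t, `[0, 1]%classic s -> speed g c t - d < speed g c s.
      exact: (cs _ h).
    apply: filterS hw => s hs s01.
    by apply: ltW; apply: hs; rewrite /= in_itv.
  have /nbhs_ballP[r /= r0 hr] : \forall s \near t,
      `|f (c s) - f (c t)| <= `|s - t| * (L * speed g c t + e) /\
      (0 <= s <= 1 -> speed g c t - d <= speed g c s) by apply: filterI.
  have key (a b : R) : 0 <= a -> a <= b -> b <= 1 ->
      (forall s, a <= s <= b -> speed g c t - d <= speed g c s) ->
      (b - a) * (L * speed g c t + e) <= H b - H a.
    move=> a0 ab b1 hs; have := arclength_ge Cc a0 ab b1 hs => hI.
    have := ler_wpM2l L0 hI.
    have : (b - a) * (L * d) <= (b - a) * e by rewrite ler_wpM2l ?subr_ge0.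
    rewrite /H; lra.
  apply/nbhs_ballP; exists r => //= s ts s01.
  have [hs _] := hr s ts; have [s0 s1] := andP s01; have [t0 t1] := andP t01.
  split=> st.
    apply: (le_trans hs); rewrite ger0_norm ?subr_ge0//.
    apply: key => // u /andP[tu us]; have [|_] := hr u; last first.
      by apply; rewrite (le_trans t0 tu) (le_trans us s1).
    move: ts; rewrite -!ball_normE /ball_/= !ler0_norm ?subr_le0// !opprB.
    by apply: le_lt_trans; rewrite lerD2r.
  rewrite distrC; apply: (le_trans hs); rewrite ler0_norm ?subr_le0// opprB.
  apply: key => // u /andP[su ut]; have [|_] := hr u; last first.
    by apply; rewrite (le_trans s0 su) (le_trans ut t1).
  move: ts; rewrite -!ball_normE /ball_/= !ger0_norm ?subr_ge0//.
  by apply: le_lt_trans; rewrite lerD2l lerN2.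
have a0 : arclength c 0 = 0.
  by rewrite /arclength set_itv1 integral_set1.
rewrite /H a0 !mulr0 addr0 subr0 mulr1 => /le_trans; apply.
by rewrite lerD2l /e mulrC divfK.
Qed.

Lemma curve_lipschitz_within f (L : R) : 0 <= L -> curve_lipschitz f L ->
  lipschitz_within g setT f.
Proof.
(* A positive constant can be divided out under the infimum. It also keeps the bound infinite
   between distinct components, where 0 times +oo would be 0. *)
move=> L0 fL; exists (L + 1) => x y _ _.
have L1 : 0 < L + 1 by rewrite ltr_wpDl.
have path s : forall x, piecewise_C1 A x s y ->
    ((`|f x - f y|)%:E <= (L + 1)%:E * \sum_(c <- s) curve_length g c)%E.
  elim: s => [|c s IH] x0 /=; first by move=> ->; rewrite subrr normr0 big_nil mule0.
  move=> [Cc c0 cs]; rewrite big_cons ge0_muleDr; last 2 first.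
  - exact: curve_length_ge0.
  - by apply: sume_ge0 => ? _; exact: curve_length_ge0.
  apply: (@le_trans _ _ ((`|f (c 1) - f (c 0)|)%:E + (`|f (c 1) - f y|)%:E)%E).
    rewrite -EFinD lee_fin -c0 (distrC (f (c 1)) (f (c 0))).
    exact: ler_distD.
  apply: leeD; last exact: IH.
  apply: (le_trans (curve_lipschitz_length L0 fL Cc)).
  by rewrite lee_wpmul2r ?curve_length_ge0// lee_fin lerDl.
rewrite -lee_pdivrMl//; apply: le_ereal_inf_tmp => _ [s xs ->].
by rewrite lee_pdivrMl//; exact: path.
Qed.

End curve_lipschitz.

(** * Locally Lipschitz functions and products with compact support *)

Section lipschitz.
Variables (R : realType) (n : nat) (M : ptopologicalType).
Variables (A : smooth_atlas R n M) (g : riemannian_metric A).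
Hypothesis M_hausdorff : hausdorff_space M.
Implicit Types (i j : chart_index A) (p : M) (c : R -> M) (f : M -> R).

Lemma locally_lipschitz_continuous f : locally_lipschitz g f -> continuous f.
Proof.
move=> lf p; have [U Up [L fL]] := lf p.
apply/cvgrPdist_le => e e0.
pose d := e / (`|L| + 1); have L1 : 0 < `|L| + 1 by rewrite ltr_wpDl.
have d0 : 0 < d by rewrite divr_gt0.
near=> q.
have Uq : U q by near: q.
have dq : (riemannian_dist g p q <= d%:E)%E by near: q; exact: dist_chart_near.
rewrite -lee_fin (le_trans (fL p q (nbhs_singleton Up) Uq))//.
apply: (@le_trans _ _ ((`|L| + 1)%:E * d%:E)%E).
  apply: (@le_trans _ _ ((`|L| + 1)%:E * riemannian_dist g p q)%E).
    rewrite lee_wpmul2r ?riemannian_dist_ge0// lee_fin.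
    by rewrite (le_trans (ler_norm L))// lerDl.
  by rewrite lee_wpmul2l// lee_fin ltW.
by rewrite -EFinM lee_fin /d mulrC divfK// gt_eqF.
Unshelve. all: by end_near. Qed.

(** The derivative of f along c is the inner product of its gradient with the velocity, at most G
    times the speed by Cauchy-Schwarz. *)
Lemma C1_function_curve (f : M -> R) (G : R) : C1_function A f ->
  (forall p, vnorm g (grad g f) p <= G) -> curve_lipschitz g f G.
Proof.
move=> Cf fG c Cc t t01 e e0; set i := chart_at A (c t).
have ip : chart_dom i (c t) := chart_atP A (c t).
have [cc dc] := Cc t t01; have [dn _] := dc i ip; have dt := nbhs_singleton dn.
pose c' := chart i \o c; pose F := f \o chart_inv i.
have dF : differentiable F (c' t) by exact/C1at_differentiable/Cf.
have dc' : differentiable c' t by exact/derivable1_diffP.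
have dFc : differentiable (F \o c') t by exact: differentiable_comp.
have m1 : 'd (F \o c') t 1 = inner_at g i (c t) (grad g f i (c t)) (derive1 c' t).
  rewrite diff_comp//= diff_partials// inner_grad// mxE.
  by apply: eq_bigr => k _; rewrite !mxE derive1E' // mulrC.
have m2 : `|'d (F \o c') t 1| <= G * speed g c t.
  rewrite m1 (le_trans (cauchy_schwarz_at g _ _ ip))//.
  rewrite (speed_chart g ip cc dt) ler_wpM2r ?sqrtr_ge0//.
  exact: fG.
have nE : \forall s \near t, f (c s) = (F \o c') s.
  have : \forall s \near t, chart_dom i (c s).
    by apply: (cc (chart_dom i)); apply: open_nbhs_nbhs; split => //; exact: chart_dom_open.
  by apply: filterS => s si; rewrite /= /F/= chartK.
have := differentiable_littleo dFc e0; rewrite (near_shift t 0) => h.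
have ft : f (c t) = (F \o c') t := nbhs_singleton nE.
near=> s.
have -> : f (c s) = (F \o c') s by near: s.
have hs : `|(F \o c') ((s - t) + t) - (F \o c') t - 'd (F \o c') t (s - t)| <= e * `|s - t|.
  by near: s; apply: filterS h => s /=; rewrite sub0r.
move: hs; rewrite subrK ft.
have -> : 'd (F \o c') t (s - t) = (s - t) * 'd (F \o c') t 1.
  by rewrite -[in LHS](mulr1 (s - t)) -[(s - t) * 1]/((s - t) *: (1 : R)) linearZ.
set D := 'd _ _ _ in m2 *; set a := (F \o c') s; set b := (F \o c') t => hs.
have -> : a - b = (a - b - (s - t) * D) + (s - t) * D by ring.
rewrite (le_trans (ler_normD _ _))// addrC mulrDr (mulrC _ e) lerD// normrM.
by rewrite ler_wpM2l.
Unshelve. all: by end_near. Qed.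

(** Each constant of a finite subcover is bounded by the sum of all their absolute values. The
    estimate stays local: two distant points of K need not share a neighbourhood. *)
Lemma uniform_local_lipschitz f (K : set M) : compact K -> locally_lipschitz g f ->
  exists2 L, 0 <= L & forall p, K p -> \forall q \near p,
    ((`|f p - f q|)%:E <= L%:E * riemannian_dist g p q)%E.
Proof.
move=> cK lf.
have h p : exists UL : set M * R, nbhs p UL.1 /\ forall x y, UL.1 x -> UL.1 y ->
    ((`|f x - f y|)%:E <= UL.2%:E * riemannian_dist g x y)%E.
  by have [U Up [L fL]] := lf p; exists (U, L).
have [u hu] := choice h.
have [|s sK Ks] := @compact_pointwise_cover M K (fun p => interior (u p).1) cK.
  move=> p _; split; first exact: open_interior.
  by have [] := hu p.
exists (\sum_(p <- s) `|(u p).2|); first by apply: sumr_ge0.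
move=> p /Ks[q /= qs Up]; have [_ hq] := hu q.
apply: filterS (Up) => r Ur; apply: (le_trans (hq p r (nbhs_singleton Up) Ur)).
rewrite lee_wpmul2r ?riemannian_dist_ge0// lee_fin (le_trans (ler_norm _))//.
by rewrite (big_rem q)//= lerDl sumr_ge0.
Qed.

Lemma vnorm_grad_eq0 f p : (\forall q \near p, f q = 0) -> vnorm g (grad g f) p = 0.
Proof.
move=> f0; rewrite /vnorm vinner_at inner_grad; last exact: chart_atP.
by rewrite partials_eq0 ?mul0mx ?mxE ?sqrtr0//; exact: chart_atP.
Qed.

(** Only an infinitesimal bound along curves is needed, and it follows from the Leibniz rule: at
    times when the curve is in K, E bounds eta, Rb bounds rho, G bounds grad eta and L is a local
    constant of rho; at other times the product vanishes nearby. *)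
Lemma lipschitz_mul (eta rho : M -> R) (K : set M) : smooth_function A eta ->
  compact K -> (forall p, ~ K p -> eta p = 0) -> locally_lipschitz g rho ->
  lipschitz_within g setT (fun p => eta p * rho p).
Proof.
move=> seta cK eta0 lrho; have Ceta := smooth_function_C1 seta.
have clK : closed K by exact: compact_closed.
have crho := locally_lipschitz_continuous lrho.
have ceta := C1_function_continuous Ceta.
have nearK p : ~ K p -> \forall q \near p, eta q = 0.
  move=> nK; apply: (filterS _ (open_nbhs_nbhs (conj (closed_openC clK) nK))).
  by move=> q; exact: eta0.
have [E E0 hE] := compact_continuous_bounded cK (fun p _ => ceta p).
have [Rb Rb0 hR] := compact_continuous_bounded cK (fun p _ => crho p).
have cG : continuous (vnorm g (grad g eta)) by apply: vnorm_continuous; exact: grad_C1.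
have [G G0 hG] := compact_continuous_bounded cK (fun p _ => cG p).
have [L L0 hL] := uniform_local_lipschitz cK lrho.
have etaE p : `|eta p| <= E.
  by have [/hE//|/eta0 ->] := pselect (K p); rewrite normr0.
have etaG p : vnorm g (grad g eta) p <= G.
  have [/hG|/nearK/vnorm_grad_eq0 -> //] := pselect (K p).
  exact/le_trans/ler_norm.
apply: (@curve_lipschitz_within R n M A g (fun p => eta p * rho p) (E * L + Rb * G)).
  by rewrite addr_ge0// mulr_ge0.
move=> c Cc t t01 e e0; have [cc _] := Cc t t01.
have [Kt|nKt] := pselect (K (c t)); last first.
  have h : \forall s \near t, eta (c s) = 0 := cc _ (nearK _ nKt).
  have e1 : eta (c t) = 0 := nbhs_singleton h.
  apply: filterS h => s ->; rewrite e1 !mul0r subrr normr0 mulr_ge0//.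
  by rewrite addr_ge0 ?(ltW e0)// mulr_ge0 ?sqrtr_ge0// addr_ge0// mulr_ge0.
(* Chosen so that E L e1 and Rb e2 are at most e / 2 each; the added 1 allows for zero constants. *)
pose e1 := e / (2 * (E * L + 1)); pose e2 := e / (2 * (Rb + 1)).
have EL : 0 < E * L + 1 by rewrite ltr_wpDl// mulr_ge0.
have Rb1 : 0 < Rb + 1 by rewrite ltr_wpDl.
have e10 : 0 < e1 by rewrite divr_gt0// mulr_gt0.
have e20 : 0 < e2 by rewrite divr_gt0// mulr_gt0.
have h1 := dist_curve g Cc t01 e10.
have h2 := C1_function_curve Ceta etaG Cc t01 e20.
have h3 : \forall s \near t, ((`|rho (c t) - rho (c s)|)%:E <=
    L%:E * riemannian_dist g (c t) (c s))%E := cc _ (hL _ Kt).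
near=> s.
have d1 : (riemannian_dist g (c t) (c s) <= (`|s - t| * (speed g c t + e1))%:E)%E by near: s.
have d2 : `|eta (c s) - eta (c t)| <= `|s - t| * (G * speed g c t + e2) by near: s.
have d3 : `|rho (c t) - rho (c s)| <= L * (`|s - t| * (speed g c t + e1)).
  rewrite -lee_fin; apply: (@le_trans _ _ (L%:E * riemannian_dist g (c t) (c s))%E).
    by near: s.
  by rewrite EFinM lee_wpmul2l ?lee_fin.
(* In this splitting rho is evaluated at [c t], which lies in K where rho is bounded by Rb; [c s]
   may leave K, but the bound E on eta is global. *)
have -> : eta (c s) * rho (c s) - eta (c t) * rho (c t) =
  eta (c s) * (rho (c s) - rho (c t)) + rho (c t) * (eta (c s) - eta (c t)) by ring.
apply: (le_trans (ler_normD _ _)); rewrite !normrM.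
apply: (@le_trans _ _ (E * (L * (`|s - t| * (speed g c t + e1))) +
    Rb * (`|s - t| * (G * speed g c t + e2)))).
  by apply: lerD; apply: ler_pM => //; [rewrite distrC|exact: hR].
have half (a : R) : 0 <= a -> a * (e / (2 * (a + 1))) <= e / 2.
  move=> a0; have a1 : 0 < a + 1 by rewrite ltr_wpDl.
  have -> : a * (e / (2 * (a + 1))) = e / 2 * (a / (a + 1)) by field; rewrite gt_eqF.
  by rewrite ler_piMr ?divr_ge0 ?(ltW e0)// ler_pdivrMr// mul1r lerDl.
have E1 : E * L * e1 <= e / 2 by apply: half; rewrite mulr_ge0.
have E2 : Rb * e2 <= e / 2 by exact: half.
have -> : E * (L * (`|s - t| * (speed g c t + e1))) + Rb * (`|s - t| * (G * speed g c t + e2))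
  = `|s - t| * ((E * L + Rb * G) * speed g c t + (E * L * e1 + Rb * e2)) by ring.
by rewrite ler_wpM2l// lerD2l [leRHS]splitr lerD.
Unshelve. all: by end_near. Qed.

End lipschitz.

(** * Weak gradients of products *)

Section weak_gradient.
Variables (R : realType) (n : nat) (M : ptopologicalType).
Variables (A : smooth_atlas R n M) (g : riemannian_metric A).
Variable vol : {measure set (borelType M) -> \bar R}.
Hypothesis vol_g : is_riemannian_volume g vol.
Hypothesis M_hausdorff : hausdorff_space M.
Implicit Types (i j : chart_index A) (p : M) (f : M -> R) (X Y W : vfield A).

Lemma continuous_support_integrable f (K : set M) : continuous f -> compact K ->
  (forall p, ~ K p -> f p = 0) ->
  vol.-integrable [set: borelType M] (fun p => (f p)%:E).
Proof.
move=> cf cK f0; have clK : closed K by exact: compact_closed.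
have [B B0 fB] := compact_continuous_bounded cK (fun p _ => cf p).
apply: (@integrable_bounded_support _ _ _ vol K f B) => //.
- exact: closed_measurable_borel.
- exact: (volume_compact_lty vol_g clK cK).
- by apply: continuous_measurable_real => [|p _]; [exact: openT|exact: cf].
Qed.

(** The form in which components of vector fields give measurability. Finitely many charts then
    settle it on a compact set, hence on M for functions that vanish off one. *)
Definition chartwise_measurable f : Prop := forall i,
  measurable_fun (chart_dom i : set (borelType M)) (f : borelType M -> R).

Lemma chartwise_measurable_compact f (K : set M) : chartwise_measurable f ->
  compact K -> measurable_fun (K : set (borelType M)) (f : borelType M -> R).
Proof.
move=> mf cK.
have [|s sK Ks] := @compact_pointwise_cover M K (fun p => chart_dom (chart_at A p)) cK.
  by move=> p _; split; [exact: chart_dom_open|exact: chart_atP].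
pose D (s : seq M) : set (borelType M) := \big[setU/set0]_(p <- s) chart_dom (chart_at A p).
have mD s' : measurable (D s').
  by apply: bigsetU_measurable => p _; exact: measurable_chart_dom.
have mfD : measurable_fun (D s) (f : borelType M -> R).
  elim: (s) => [|p s' IH]; first by rewrite /D big_nil; exact: measurable_fun_set0.
  rewrite /D big_cons.
  exact: ((measurable_funU (f : borelType M -> R) (measurable_chart_dom (chart_at A p)) (mD s')).2 (conj (mf _) IH)).
apply: measurable_funS mfD => // p /Ks[q /= qs Uq].
by rewrite /D -bigcup_seq; exists q.
Qed.

Lemma chartwise_measurable_support f (K : set M) : chartwise_measurable f ->
  compact K -> (forall p, ~ K p -> f p = 0) ->
  measurable_fun [set: borelType M] (f : borelType M -> R).
Proof.
move=> mf cK f0; have clK : closed K by exact: compact_closed.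
have mK : measurable (K : set (borelType M)) by exact: closed_measurable_borel.
have -> : f = f \_ K.
  apply/funext => p; rewrite /patch; case: ifPn => // /negP; rewrite inE.
  exact: f0.
by apply/(measurable_restrictT _ mK); exact: chartwise_measurable_compact.
Qed.

Lemma continuous_chartwise f : continuous f -> chartwise_measurable f.
Proof.
by move=> cf i; apply: continuous_measurable_real => [|p _]; [exact: chart_dom_open|exact: cf].
Qed.

Definition measurable_vfield X : Prop := is_vfield X /\
  forall i k, measurable_fun (chart_dom i : set (borelType M))
    ((fun p => X i p 0 k) : borelType M -> R).

Lemma C1_measurable_vfield X : C1_vfield X -> measurable_vfield X.
Proof.
move=> [vX CX]; split => // i k; apply: continuous_measurable_real.
  exact: chart_dom_open.
move=> p ip; apply: (continuous_chart ip (F := fun x => X i (chart_inv i x) 0 k)).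
  by move=> q iq; rewrite chartK.
by apply: C1at_continuous; exact: CX.
Qed.

Lemma vinner_measurable X Y : measurable_vfield X -> measurable_vfield Y ->
  chartwise_measurable (vinner g X Y).
Proof.
move=> [vX mX] [vY mY] i.
apply: (@eq_measurable_fun _ _ _ _ _ (fun p : borelType M =>
    \sum_l (\sum_k X i p 0 k * gmat g i p k l) * Y i p 0 l)).
  move=> p /set_mem ip; rewrite (vinnerE g vX vY ip) /inner_at mxE.
  by apply: eq_bigr => l _; rewrite !mxE.
apply: measurable_sum => l; apply: measurable_funM; last exact: mY.
apply: measurable_sum => k; apply: measurable_funM; first exact: mX.
apply: continuous_measurable_real; first exact: chart_dom_open.
move=> p ip; apply: (continuous_chart ip (F := fun x => gmat g i (chart_inv i x) k l)).
  by move=> q iq; rewrite chartK.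
by apply: C1at_continuous; exact: gmat_C1.
Qed.

Lemma vnorm_measurable X : measurable_vfield X -> chartwise_measurable (vnorm g X).
Proof.
move=> mX i; apply: measurableT_comp; last exact: vinner_measurable.
by apply: continuous_measurable_fun; exact: sqrt_continuous.
Qed.

Lemma vinner_ge0 X p : 0 <= vinner g X X p.
Proof. by apply: inner_at_ge0; exact: chart_atP. Qed.

Lemma vnorm_ge0 X p : 0 <= vnorm g X p.
Proof. exact: sqrtr_ge0. Qed.

Lemma sqr_vnorm X p : vnorm g X p ^+ 2 = vinner g X X p.
Proof. by rewrite sqr_sqrtr// vinner_ge0. Qed.

Lemma cauchy_schwarz X Y p : `|vinner g X Y p| <= vnorm g X p * vnorm g Y p.
Proof. by apply: cauchy_schwarz_at; exact: chart_atP. Qed.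

Lemma vnorm_scale f X p : vnorm g (scale_vfield f X) p = `|f p| * vnorm g X p.
Proof.
rewrite /vnorm !vinner_at /scale_vfield inner_atZl inner_atZr mulrA -expr2.
by rewrite sqrtrM ?sqr_ge0// sqrtr_sqr.
Qed.

Definition add_vfield X Y : vfield A := fun i p => X i p + Y i p.

Lemma vnorm_triangle X Y p :
  vnorm g (add_vfield X Y) p <= vnorm g X p + vnorm g Y p.
Proof. by apply: norm_at_triangle; exact: chart_atP. Qed.

Lemma vinnerDl X Y Z p : vinner g (add_vfield X Y) Z p = vinner g X Z p + vinner g Y Z p.
Proof. by rewrite !vinner_at inner_atDl. Qed.

Lemma vinnerZl f X Y p : vinner g (scale_vfield f X) Y p = f p * vinner g X Y p.
Proof. by rewrite !vinner_at inner_atZl. Qed.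

Lemma vinnerZr f X Y p : vinner g X (scale_vfield f Y) p = f p * vinner g X Y p.
Proof. by rewrite !vinner_at inner_atZr. Qed.

Lemma measurable_vfield_scale f X : continuous f -> measurable_vfield X ->
  measurable_vfield (scale_vfield f X).
Proof.
move=> cf [vX mX]; split=> [i j p ip jp|i k].
  by rewrite /scale_vfield (vX i j)// scalemxAl.
rewrite (_ : (fun p => _) = (fun p => f p * X i p 0 k)); last first.
  by apply/funext => p; rewrite mxE.
by apply: measurable_funM; [exact: continuous_chartwise|exact: mX].
Qed.

Lemma measurable_vfieldD X Y : measurable_vfield X -> measurable_vfield Y ->
  measurable_vfield (add_vfield X Y).
Proof.
move=> [vX mX] [vY mY]; split=> [i j p ip jp|i k].
  by rewrite /add_vfield (vX i j)// (vY i j)// mulmxDl.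
rewrite (_ : (fun p => _) = (fun p => X i p 0 k + Y i p 0 k)); last first.
  by apply/funext => p; rewrite mxE.
by apply: measurable_funD; [exact: mX|exact: mY].
Qed.

Lemma locally_integrable_measurable W : locally_integrable_vfield g vol W ->
  measurable_vfield W.
Proof. by move=> [vW mW _]. Qed.

(** [vsupport] looks only at the chart chosen at each point; the transformation law spreads the
    vanishing to all charts, so that one fixed chart can be used on a neighbourhood. *)
Lemma vsupport_near X p : is_vfield X -> ~ vsupport X p ->
  \forall q \near p, forall i, chart_dom i q -> X i q = 0.
Proof.
move=> vX nX; have oX : open (~` vsupport X) by apply: closed_openC; exact: closed_closure.
apply: (filterS _ (open_nbhs_nbhs (conj oX nX))) => q nq i iq.
have jq := chart_atP A q; rewrite (vX _ _ q jq iq).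
suff -> : X (chart_at A q) q = 0 by rewrite mul0mx.
by apply/eqP/negPn/negP => h; apply: nq; exact: subset_closure.
Qed.

Lemma vsupport_vinner W X p : is_vfield X -> ~ vsupport X p -> vinner g W X p = 0.
Proof.
move=> vX /(vsupport_near vX)/nbhs_singleton h.
rewrite /vinner; have -> : X (chart_at A p) p = 0 by apply: h; exact: chart_atP.
by rewrite trmx0 mulmx0 mxE.
Qed.

Lemma divergence_eq0 X p :
  (\forall q \near p, forall i, chart_dom i q -> X i q = 0) -> divergence g X p = 0.
Proof.
move=> X0; rewrite /divergence big1 ?mulr0// => k _.
rewrite (@near_eq_derive _ _ _ _ (cst 0)) ?derive_cst//.
apply: filterS (near_chart (chart_atP A p) X0) => x [ix h].
by rewrite h ?mxE ?mulr0//; exact: chart_inv_dom.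
Qed.

Lemma divergence_scale f X p : C1_function A f -> C1_vfield X ->
  divergence g (scale_vfield f X) p = f p * divergence g X p + vinner g (grad g f) X p.
Proof.
move=> Cf CX; have ip := chart_atP A p; set i := chart_at A p in ip *.
rewrite -(dir_atE g CX.1 Cf ip) -[divergence g X p]/(div_at g i X p).
rewrite -[LHS]/(div_at g i (scale_vfield f X) p) /div_at /dir_at mxE.
have d0 := vol_density_gt0 g ip.
pose G k x := vol_density g i (chart_inv i x) * X i (chart_inv i x) 0 k.
pose F := f \o chart_inv i.
have dF : differentiable F (chart i p) by exact/C1at_differentiable/Cf.
have dG k : differentiable (G k) (chart i p).
  apply: C1at_differentiable; apply: C1atM; first exact: vol_density_C1.
  exact: (C1_vfield_at CX).
have E k : 'D_(delta_mx 0 k) (fun x => vol_density g i (chart_inv i x) *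
     scale_vfield f X i (chart_inv i x) 0 k) (chart i p) =
   f p * 'D_(delta_mx 0 k) (G k) (chart i p) + vol_density g i p *
     ('D_(delta_mx 0 k) F (chart i p) * X i p 0 k).
  rewrite (_ : (fun x => _) = F * G k); last first.
    by apply/funext => x; rewrite mxE /F /G mulrCA.
  rewrite deriveM; [|exact: diff_derivable|exact: diff_derivable].
  rewrite /F /G /= chartK// -/F -/(G k); congr (_ + _).
  by rewrite -[LHS]/(_ * _ * _) -mulrA [X in _ * X]mulrC.
under eq_bigr do rewrite E.
rewrite big_split/= -!mulr_sumr mulrDr; congr (_ + _); first by rewrite mulrCA.
rewrite mulKf ?gt_eqF//.
by apply: eq_bigr => k _; rewrite !mxE.
Qed.

Lemma smooth_vfield_scale f X : smooth_function A f -> smooth_vfield X ->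
  smooth_vfield (scale_vfield f X).
Proof.
move=> sf [vX sX]; split=> [i j p ip jp|i].
  by rewrite /scale_vfield (vX i j)// scalemxAl.
by apply: smooth_on_scale (sf i) (sX i); exact: chart_img_open.
Qed.

Lemma vsupport_scale f X : vsupport (scale_vfield f X) `<=` vsupport X.
Proof.
apply: closure_subset => p /=; apply: contra => /eqP X0.
by rewrite /scale_vfield X0 scaler0.
Qed.

Lemma vinner_integrable W X : locally_integrable_vfield g vol W -> C1_vfield X ->
  compact (vsupport X) ->
  vol.-integrable [set: borelType M] (fun p => (vinner g W X p)%:E).
Proof.
move=> LW CX cK; set K := vsupport X in cK; have vX := CX.1.
have clK : closed K by exact: closed_closure.
have mK : measurable (K : set (borelType M)) by exact: closed_measurable_borel.
have mW := locally_integrable_measurable LW.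
have mWX := vinner_measurable mW (C1_measurable_vfield CX).
have WX0 p : ~ K p -> vinner g W X p = 0 by exact: vsupport_vinner.
have cX : continuous (vnorm g X) by exact: vnorm_continuous.
have [B B0 hB] := compact_continuous_bounded cK (fun p _ => cX p).
have mN : measurable_fun (K : set (borelType M)) (vnorm g W : borelType M -> R).
  by apply: chartwise_measurable_compact => //; exact: vnorm_measurable.
have IK : vol.-integrable (K : set (borelType M)) (fun p => (B * vnorm g W p)%:E).
  under eq_fun do rewrite EFinM.
  apply: integrableZl => //; apply/integrableP; split; first exact/measurable_EFinP.
  have [_ _ /(_ K cK)] := LW; apply: le_lt_trans.
  rewrite le_eqVlt; apply/orP; left; apply/eqP; apply: eq_integral => p _.
  by rewrite gee0_abs// lee_fin vnorm_ge0.
have E : (fun p => (vinner g W X p)%:E) = (fun p => (vinner g W X p)%:E) \_ K.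
  apply/funext => p; rewrite /patch; case: ifPn => // /negP; rewrite inE.
  by move=> /WX0 ->.
rewrite E; apply/(integrable_mkcond _ mK).
apply: (le_integrable mK _ _ IK).
  by apply/measurable_EFinP; exact: chartwise_measurable_compact.
move=> p Kp; rewrite lee_fin (le_trans (cauchy_schwarz _ _ _))//.
rewrite ger0_norm ?mulr_ge0 ?vnorm_ge0// mulrC ler_wpM2r ?vnorm_ge0//.
by apply: le_trans (hB p Kp); exact: ler_norm.
Qed.

Definition product_gradient f rho W : vfield A :=
  add_vfield (scale_vfield f W) (scale_vfield rho (grad g f)).

(* Test the weak gradient of rho against the field f X. *)
Lemma weak_gradient_product f rho W : smooth_function A f -> continuous rho ->
  is_weak_gradient g vol rho W ->
  is_weak_gradient g vol (fun p => f p * rho p) (product_gradient f rho W).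
Proof.
move=> sf crho [LW wW]; have Cf := smooth_function_C1 sf.
have cf := C1_function_continuous Cf; have Cg := grad_C1 g sf.
have mW := locally_integrable_measurable LW.
have mg := C1_measurable_vfield Cg.
have mZ : measurable_vfield (product_gradient f rho W).
  by apply: measurable_vfieldD; apply: measurable_vfield_scale.
split.
  split; [exact: mZ.1|exact: mZ.2|move=> K cK].
  have clK : closed K by exact: compact_closed.
  have mK : measurable (K : set (borelType M)) by exact: closed_measurable_borel.
  have cN : continuous (fun p => rho p * vnorm g (grad g f) p).
    by move=> p; apply: continuousM; [exact: crho|exact: vnorm_continuous].
  have [E E0 hE] := compact_continuous_bounded cK (fun p _ => cf p).
  have [B B0 hB] := compact_continuous_bounded cK (fun p _ => cN p).
  have mNW : measurable_fun (K : set (borelType M)) (vnorm g W : borelType M -> R).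
    by apply: chartwise_measurable_compact => //; exact: vnorm_measurable.
  apply: (@le_lt_trans _ _ (\int[vol]_(p in K) (E%:E * (vnorm g W p)%:E + B%:E))%E).
    apply: ge0_le_integral => //.
    - by move=> p _; rewrite lee_fin vnorm_ge0.
    - apply/measurable_EFinP; apply: chartwise_measurable_compact => //.
      exact: vnorm_measurable.
    - apply: emeasurable_funD; last exact: measurable_cst.
      by apply: emeasurable_funM; [exact: measurable_cst|exact/measurable_EFinP].
    - move=> p Kp; rewrite -EFinM -EFinD lee_fin (le_trans (vnorm_triangle _ _ _))//.
      rewrite !vnorm_scale lerD// ?ler_wpM2r ?vnorm_ge0 ?hE//.
      by have := hB p Kp; rewrite normrM (ger0_norm (vnorm_ge0 _ _)).
  rewrite ge0_integralD//; last 2 first.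
  - by move=> p _; rewrite mule_ge0// lee_fin// vnorm_ge0.
  - by apply: emeasurable_funM; [exact: measurable_cst|exact/measurable_EFinP].
  rewrite ge0_integralZl//; last 2 first.
  - exact/measurable_EFinP.
  - by move=> p _; rewrite lee_fin vnorm_ge0.
  rewrite integral_cst//; apply: lte_add_pinfty.
    have [_ _ /(_ K cK) WK] := LW.
    by apply: lte_mul_pinfty => //; rewrite ?lee_fin.
  apply: lte_mul_pinfty => //; rewrite ?lee_fin//.
  exact: (volume_compact_lty vol_g clK cK).
move=> X sX cX; have CX := smooth_vfield_C1 sX; have vX := CX.1.
have sX' := smooth_vfield_scale sf sX.
have cX' : compact (vsupport (scale_vfield f X)).
  by apply: (subclosed_compact _ cX (@vsupport_scale f X)); exact: closed_closure.
have divX0 p : ~ vsupport X p -> divergence g X p = 0.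
  by move=> nX; apply: divergence_eq0; exact: vsupport_near.
have I1 : vol.-integrable [set: borelType M] (fun p => (f p * rho p * divergence g X p)%:E).
  apply: (continuous_support_integrable (K := vsupport X)) => //.
    move=> p; apply: (@continuousM _ _ (fun p => f p * rho p) (divergence g X)); last exact: (divergence_continuous vol_g M_hausdorff CX).
    by apply: continuousM; [exact: cf|exact: crho].
  by move=> p nX; rewrite divX0// mulr0.
have I2 : vol.-integrable [set: borelType M]
    (fun p => (rho p * vinner g (grad g f) X p)%:E).
  apply: (continuous_support_integrable (K := vsupport X)) => //.
    have cI := C1_function_continuous (vinner_C1 g Cg CX).
    by move=> p; apply: continuousM; [exact: crho|exact: cI].
  by move=> p nX; rewrite vsupport_vinner// mulr0.
have I3 : vol.-integrable [set: borelType M] (fun p => (f p * vinner g W X p)%:E).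
  have := vinner_integrable LW (smooth_vfield_C1 sX') cX'.
  by apply: eq_integrable => // p _; rewrite vinnerZr.
have F1 := integrable_fin_num measurableT I1.
have F2 := integrable_fin_num measurableT I2.
have F3 := integrable_fin_num measurableT I3.
have := wW _ sX' cX'.
have -> : (\int[vol]_p (rho p * divergence g (scale_vfield f X) p)%:E =
   \int[vol]_p (f p * rho p * divergence g X p)%:E +
   \int[vol]_p (rho p * vinner g (grad g f) X p)%:E)%E.
  rewrite -(integralD measurableT I1 I2); apply: eq_integral => p _.
  by rewrite divergence_scale// -EFinD; congr EFin; ring.
have -> : (\int[vol]_p (vinner g W (scale_vfield f X) p)%:E =
   \int[vol]_p (f p * vinner g W X p)%:E)%E.
  by apply: eq_integral => p _; rewrite vinnerZr.
have -> : (\int[vol]_p (vinner g (product_gradient f rho W) X p)%:E =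
   \int[vol]_p (f p * vinner g W X p)%:E +
   \int[vol]_p (rho p * vinner g (grad g f) X p)%:E)%E.
  rewrite -(integralD measurableT I3 I2); apply: eq_integral => p _.
  by rewrite vinnerDl !vinnerZl EFinD.
(* All three integrals are finite, so the identity is one between real numbers. *)
rewrite -(fineK F1) -(fineK F2) -(fineK F3) -!EFinD -!EFinN => -[h].
by congr EFin; move: h; lra.
Qed.

End weak_gradient.

(** * The inequalities *)

(** The value s = K / (2 J) is enough and stays rational in the data, unlike the minimiser, the
    square root of G / J, which moreover degenerates when G = 0. *)
Lemma square_le_of_forall_pos (R : realFieldType) (K J G : R) : 0 <= K -> 0 <= J -> 0 <= G ->
  (forall s, 0 < s -> K <= s * J + G / s) -> K ^+ 2 <= 4 * (J * G).
Proof.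
move=> K0 J0 G0 h.
have [->|Kn0] := eqVneq K 0; first by rewrite expr0n !mulr_ge0.
have {K0} Kp : 0 < K by rewrite lt0r Kn0.
have [J00|Jn0] := eqVneq J 0.
  (* For J = 0 this s yields K <= K G / (G + 1), which is less than K. *)
  have s0 : 0 < (G + 1) / K by rewrite divr_gt0// ltr_wpDl.
  have G1 : 0 < G + 1 by rewrite ltr_wpDl.
  have h1 := h _ s0; rewrite J00 mulr0 add0r invf_div mulrA ler_pdivlMr// in h1.
  by exfalso; move: h1; rewrite mulrC ler_pM2r// leNgt ltrDl ltr01.
have Jp : 0 < J by rewrite lt0r Jn0.
have s0 : 0 < K / (2 * J) by rewrite divr_gt0// mulr_gt0.
have := h _ s0.
have -> : K / (2 * J) * J + G / (K / (2 * J)) = K / 2 + 2 * (J * G) / K.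
  by field; rewrite Kn0 Jn0.
move=> h1; have : K / 2 <= 2 * (J * G) / K by lra.
by rewrite ler_pdivlMr// => hK; lra.
Qed.

(** The discriminant criterion. It gives Cauchy-Schwarz for integrals, the quadratic being the
    integral of a weighted square. *)
Lemma square_le_of_quadratic_ge0 (R : realFieldType) (P J I : R) : 0 <= P -> 0 <= I ->
  (forall s, 0 <= P - 2 * s * J + s ^+ 2 * I) -> J ^+ 2 <= P * I.
Proof.
move=> P0 I0 h; have [I00|In0] := eqVneq I 0.
  have [->|Jn0] := eqVneq J 0; first by rewrite expr0n mulr_ge0.
  (* With I = 0 the expression is affine in s, and takes the value -1 here. *)
  have := h ((P + 1) / (2 * J)); rewrite I00 mulr0 addr0.
  have -> : P - 2 * ((P + 1) / (2 * J)) * J = -1 by field.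
  by rewrite lerNr oppr0 ler10.
have Ip : 0 < I by rewrite lt0r In0.
have := h (J / I).
have -> : P - 2 * (J / I) * J + (J / I) ^+ 2 * I = (P * I - J ^+ 2) / I by field.
by rewrite pmulr_lge0 ?invr_gt0// subr_ge0.
Qed.

(** c^2 I^4 <= J^2 G^2 <= (P I) (I Q), divided by I^2 unless I = 0, when the conclusion is
    trivial. *)
Lemma second_order_ineq (R : realFieldType) (c I J G P Q : R) : 0 <= c ->
  0 <= I -> 0 <= J -> 0 <= G -> 0 <= P -> 0 <= Q ->
  c * I ^+ 2 <= J * G -> J ^+ 2 <= P * I -> G ^+ 2 <= I * Q ->
  c ^+ 2 * I ^+ 2 <= P * Q.
Proof.
move=> c0 I0 J0 G0 P0 Q0 h1 h2 h3.
have [->|In0] := eqVneq I 0; first by rewrite expr0n mulr0 mulr_ge0.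
have Ip : 0 < I ^+ 2 by rewrite exprn_gt0// lt0r In0.
rewrite -(ler_pM2r Ip).
have e1 : c ^+ 2 * I ^+ 2 * I ^+ 2 <= (J * G) ^+ 2.
  have -> : c ^+ 2 * I ^+ 2 * I ^+ 2 = (c * I ^+ 2) ^+ 2 by ring.
  by apply: lerXn2r => //; rewrite nnegrE mulr_ge0// sqr_ge0.
apply: (le_trans e1); rewrite exprMn.
have -> : P * Q * I ^+ 2 = (P * I) * (I * Q) by ring.
by apply: ler_pM; rewrite ?sqr_ge0.
Qed.

(** * The weighted integrals and their inequalities *)

Section main.
Variables (R : realType) (n : nat) (M : ptopologicalType).
Variables (A : smooth_atlas R n M) (g : riemannian_metric A).
Variable vol : {measure set (borelType M) -> \bar R}.
Hypothesis vol_g : is_riemannian_volume g vol.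
Hypothesis M_hausdorff : hausdorff_space M.
Variables (u : M -> R) (lam mu C : R).
Hypothesis u_smooth : smooth_function A u.
Hypothesis C_gt0 : 0 < C.
Variable rho : M -> R.
Hypothesis rho_ge0 : forall p, 0 <= rho p.
Hypothesis rho_eikonal : aff_eikonal g vol u lam mu rho.
Hypothesis rho_laplacian : aff_laplacian_ge g vol u lam mu C rho.

Let tau := aff_tau n lam mu.
Let a p := affV u p `^ (mu - lam).
Let w p := affV u p `^ (tau + lam - mu).

Lemma affV_powR x p : affV u p `^ x = expR (u p * x).
Proof. by rewrite /affV -expRM. Qed.

Lemma affV_powR_C1 x : C1_function A (fun p => affV u p `^ x).
Proof.
move=> i p ip; apply: (@C1at_near_eq _ _ (fun y => expR ((u \o chart_inv i) y * x))).
  by near=> y; rewrite /= affV_powR.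
apply: C1at_expR; apply: C1atM; last exact: C1at_cst.
exact: (smooth_function_C1 u_smooth).
Unshelve. all: by end_near. Qed.

Lemma affV_powR_continuous x : continuous (fun p => affV u p `^ x).
Proof. exact: C1_function_continuous (affV_powR_C1 x). Qed.

Lemma weight_tau p : affV u p `^ tau = a p * w p.
Proof. by rewrite /a /w !affV_powR -expRD -mulrDr; congr (expR (_ * _)); ring. Qed.

Lemma weight_lap p : affV u p `^ (tau + mu - lam) = a p ^+ 2 * w p.
Proof.
by rewrite /a /w !affV_powR expr2 -!expRD -!mulrDr; congr (expR (_ * _)); ring.
Qed.

Lemma a_gt0 p : 0 < a p. Proof. by rewrite /a affV_powR expR_gt0. Qed.
Lemma w_gt0 p : 0 < w p. Proof. by rewrite /w affV_powR expR_gt0. Qed.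

Variable phi : M -> R.
Hypothesis phi_smooth : smooth_function A phi.
Hypothesis phi_compact : compact (fsupport phi).
Hypothesis phi_rho : fsupport phi `<=` ~` (rho @^-1` [set 0]).

Let K := fsupport phi.

Let phiC1 : C1_function A phi. Proof. exact: smooth_function_C1. Qed.
Let phi_cts : continuous phi. Proof. exact: (C1_function_continuous phiC1). Qed.
Let rho_cts : continuous rho.
Proof. by case: rho_eikonal => lrho _; exact: locally_lipschitz_continuous lrho. Qed.
Let clK : closed K. Proof. exact: closed_closure. Qed.

Let phi0 p : ~ K p -> phi p = 0.
Proof. by move=> nK; apply/eqP/negPn/negP => h; apply: nK; exact: subset_closure. Qed.

Let phi_near0 p : ~ K p -> \forall q \near p, phi q = 0.
Proof.
move=> nK; apply: (filterS _ (open_nbhs_nbhs (conj (closed_openC clK) nK))).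
by move=> q; exact: phi0.
Qed.

Let gradN p := vinner g (grad g phi) (grad g phi) p.

Let gradN_cts : continuous gradN.
Proof. by apply: C1_function_continuous; apply: vinner_C1; exact: grad_C1. Qed.

Let gradN0 p : ~ K p -> gradN p = 0.
Proof.
by move=> /phi_near0/(vnorm_grad_eq0 g) h; rewrite /gradN -sqr_vnorm h expr0n.
Qed.

Lemma aff_grad_sq p : vnorm g (aff_grad g u lam mu phi) p ^+ 2 = a p ^+ 2 * gradN p.
Proof.
rewrite -[aff_grad _ _ _ _ _]/(scale_vfield a (grad g phi)) vnorm_scale exprMn.
by rewrite real_normK ?num_real// sqr_vnorm.
Qed.

Let w_cts : continuous w. Proof. exact: affV_powR_continuous. Qed.
Let a_cts : continuous a. Proof. exact: affV_powR_continuous. Qed.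

Let fI p := phi p ^+ 2 * w p.
Let fJ p := rho p ^+ 2 * phi p ^+ 2 * w p.
Let fP p := rho p ^+ 4 * phi p ^+ 2 * w p.
Let fG p := a p ^+ 2 * gradN p * w p.

Let exp_cts (f : M -> R) k : continuous f -> continuous (fun p => f p ^+ k).
Proof.
move=> cf p; apply: (@continuous_comp _ _ _ f (fun t : R => t ^+ k)); first exact: cf.
exact: exprn_continuous.
Qed.

Let mul_cts (f h : M -> R) : continuous f -> continuous h -> continuous (fun p => f p * h p).
Proof. by move=> cf ch p; apply: continuousM; [exact: cf|exact: ch]. Qed.

Let integrable_cs (f : M -> R) : continuous f -> (forall p, ~ K p -> f p = 0) ->
  vol.-integrable [set: borelType M] (fun p => (f p)%:E).
Proof. by move=> cf f0; apply: (continuous_support_integrable vol_g M_hausdorff cf phi_compact). Qed.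

Let intI : vol.-integrable [set: borelType M] (fun p => (fI p)%:E).
Proof.
apply: integrable_cs; first by rewrite /fI; do ?[apply: mul_cts|apply: exp_cts] => //.
by move=> p /phi0 h; rewrite /fI h expr0n mul0r.
Qed.

Let intJ : vol.-integrable [set: borelType M] (fun p => (fJ p)%:E).
Proof.
apply: integrable_cs; first by rewrite /fJ; do ?[apply: mul_cts|apply: exp_cts] => //.
by move=> p /phi0 h; rewrite /fJ h expr0n mulr0 mul0r.
Qed.

Let intP : vol.-integrable [set: borelType M] (fun p => (fP p)%:E).
Proof.
apply: integrable_cs; first by rewrite /fP; do ?[apply: mul_cts|apply: exp_cts] => //.
by move=> p /phi0 h; rewrite /fP h expr0n mulr0 mul0r.
Qed.

Let intG : vol.-integrable [set: borelType M] (fun p => (fG p)%:E).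
Proof.
apply: integrable_cs; first by rewrite /fG; do ?[apply: mul_cts|apply: exp_cts] => //.
by move=> p /gradN0 h; rewrite /fG h mulr0 mul0r.
Qed.



Let Rintegral_lincomb (f h k : M -> R) (x y z : R) :
  vol.-integrable [set: borelType M] (fun p => (f p)%:E) ->
  vol.-integrable [set: borelType M] (fun p => (h p)%:E) ->
  vol.-integrable [set: borelType M] (fun p => (k p)%:E) ->
  vol.-integrable [set: borelType M] (fun p => (x * f p + y * h p + z * k p)%:E) /\
  \int[vol]_p (x * f p + y * h p + z * k p) =
  x * (\int[vol]_p f p) + y * (\int[vol]_p h p) + z * (\int[vol]_p k p).
Proof.
have IZ c (l : M -> R) : vol.-integrable [set: borelType M] (fun p => (l p)%:E) ->
    vol.-integrable [set: borelType M] (EFin \o (fun p => c * l p)).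
  by move=> Il; rewrite /comp; under eq_fun do rewrite EFinM; exact: integrableZl.
have ID (l1 l2 : M -> R) : vol.-integrable [set: borelType M] (EFin \o l1) ->
    vol.-integrable [set: borelType M] (EFin \o l2) ->
    vol.-integrable [set: borelType M] (EFin \o (fun p => l1 p + l2 p)).
  by move=> I1 I2; rewrite /comp; under eq_fun do rewrite EFinD; exact: integrableD.
move=> If Ih Ik; have I2 := ID _ _ (IZ x _ If) (IZ y _ Ih).
split; first exact: (ID _ _ I2 (IZ z _ Ik)).
rewrite (RintegralD measurableT I2 (IZ z _ Ik)).
rewrite (RintegralD measurableT (IZ x _ If) (IZ y _ Ih)).
by rewrite (RintegralZl _ measurableT If) (RintegralZl _ measurableT Ih) (RintegralZl _ measurableT Ik).
Qed.

Let integralE (f : M -> R) :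
  vol.-integrable [set: borelType M] (fun p => (f p)%:E) ->
  (\int[vol]_p (f p)%:E = (\int[vol]_p f p)%:E)%E.
Proof. by move=> If; rewrite /Rintegral fineK//; exact: (integrable_fin_num measurableT If). Qed.

Let rI := \int[vol]_p fI p.
Let rJ := \int[vol]_p fJ p.
Let rP := \int[vol]_p fP p.
Let rG := \int[vol]_p fG p.

Lemma first_order_linear s : 0 < s -> (C + 1) * rI <= s * rJ + rG / s.
Proof.
move=> s0; have [lrho [W wW eW]] := rho_eikonal.
(* Multiplying twice by phi makes the Lipschitz bound and the weak gradient of rho phi^2 two
   applications each of the result on products with a smooth factor. *)
have phirho : locally_lipschitz g (fun p => phi p * rho p).
  have [l hl] := lipschitz_mul M_hausdorff phi_smooth phi_compact phi0 lrho.
  by move=> p; exists setT; [exact: filterT|exists l].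
have lpsi := lipschitz_mul M_hausdorff phi_smooth phi_compact phi0 phirho.
have cphirho : continuous (fun p => phi p * rho p) by exact: mul_cts.
have wW1 := weak_gradient_product vol_g M_hausdorff phi_smooth rho_cts wW.
have wW2 := weak_gradient_product vol_g M_hausdorff phi_smooth cphirho wW1.
set psi := fun p => phi p * (phi p * rho p) in lpsi wW2.
set Wpsi := product_gradient g phi _ _ in wW2.
have psi_supp : fsupport psi `<=` K.
  apply: closure_subset => p /=; apply: contra => /eqP h.
  by rewrite /psi h mul0r.
have cpsi : compact (fsupport psi).
  by apply: (subclosed_compact _ phi_compact psi_supp); exact: closed_closure.
have psi_ge0 p : 0 <= psi p by rewrite /psi mulrA -expr2 mulr_ge0// sqr_ge0.
have := rho_laplacian wW wW2 psi_ge0 lpsi cpsi (subset_trans psi_supp phi_rho).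
have mW := locally_integrable_measurable wW.1.
have mWpsi := locally_integrable_measurable wW2.1.
pose h p := vinner g Wpsi (to_affine u lam mu W) p * affV u p `^ tau.
have -> : (\int[vol]_p (C / rho p * psi p * affV u p `^ (aff_tau n lam mu + lam - mu))%:E =
    (C * rI)%:E)%E.
  rewrite EFinM -(integralE intI) -(integralZl measurableT intI).
  apply: eq_integral => p _; rewrite -EFinM; congr EFin; rewrite /fI /psi /w -/tau.
  (* At a zero of rho the quotient C / rho does not cancel, but the support of phi avoids these
     points. *)
  have [rp0|rp0] := eqVneq (rho p) 0; last by field.
  have -> : phi p = 0 by apply: phi0 => /phi_rho; exact.
  by rewrite !(mul0r, mulr0, expr0n).
have hE p : h p = a p ^+ 2 * w p * (phi p ^+ 2 * vinner g W W p +
    2 * phi p * rho p * vinner g (grad g phi) W p).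
  rewrite /h weight_tau -[to_affine _ _ _ _]/(scale_vfield a W) vinnerZr.
  rewrite /Wpsi /product_gradient !(vinnerDl, vinnerZl).
  by ring.
(* Almost everywhere h is phi^2 w plus a cross term of absolute value at most s fJ + fG / s. So - k
   bounds h below, which gives the claim after integration; k2, with the other sign of fI, bounds h
   above and dominates the truncation of h, which is thereby integrable. *)
pose k p := s * fJ p + s^-1 * fG p + (-1) * fI p.
have [intk intkE] := Rintegral_lincomb s s^-1 (-1) intJ intG intI.
pose k2 p := s * fJ p + s^-1 * fG p + 1 * fI p.
have [intk2 _] := Rintegral_lincomb s s^-1 1 intJ intG intI.
have fI0 p : 0 <= fI p by rewrite /fI mulr_ge0 ?sqr_ge0// ltW// w_gt0.
have fJ0 p : 0 <= s * fJ p.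
  by apply/mulr_ge0/mulr_ge0/ltW/w_gt0; [exact: ltW|exact/mulr_ge0/sqr_ge0/sqr_ge0].
have fG0 p : 0 <= s^-1 * fG p.
  apply/mulr_ge0/mulr_ge0/ltW/w_gt0; first by rewrite invr_ge0 ltW.
  exact/mulr_ge0/vinner_ge0/sqr_ge0.
have hbound p : vnorm g (to_affine u lam mu W) p = 1 -> - k p <= h p <= k2 p.
  rewrite -[to_affine _ _ _ _]/(scale_vfield a W) vnorm_scale (ger0_norm (ltW (a_gt0 p))) => aW.
  pose x := rho p * phi p; pose y := vinner g (grad g phi) W p.
  pose N := vnorm g (grad g phi) p.
  have haW : a p ^+ 2 * vinner g W W p = 1 by rewrite -sqr_vnorm -exprMn aW expr1n.
  have hy : `|a p ^+ 2 * y| <= a p * N.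
    rewrite normrM ger0_norm ?sqr_ge0// expr2 -mulrA ler_pM2l ?a_gt0//.
    rewrite (le_trans (ler_wpM2l (ltW (a_gt0 p)) (cauchy_schwarz _ _ _ _)))//.
    by rewrite mulrCA aW mulr1.
  have hxy : `|2 * x * (a p ^+ 2 * y)| <= s * x ^+ 2 + s^-1 * (a p * N) ^+ 2.
    rewrite normrM (le_trans (ler_wpM2l (normr_ge0 _) hy))//.
    (* The weighted AM-GM inequality for |x| and a N, as the expansion of a square. *)
    have sq : 0 <= s^-1 * (s * `|x| - a p * N) ^+ 2.
      by rewrite mulr_ge0 ?sqr_ge0// invr_ge0 ltW.
    have e : s^-1 * (s * `|x| - a p * N) ^+ 2 =
       s * x ^+ 2 + s^-1 * (a p * N) ^+ 2 - `|2 * x| * (a p * N).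
      rewrite (normrM 2 x) normr_nat -[x ^+ 2](real_normK (num_real x)).
      by field; rewrite gt_eqF.
    by rewrite -subr_ge0 -e.
  have hhE : h p = fI p + w p * (2 * x * (a p ^+ 2 * y)).
    rewrite hE /fI /x /y.
    transitivity (w p * phi p ^+ 2 * (a p ^+ 2 * vinner g W W p) +
      w p * (2 * (rho p * phi p) * (a p ^+ 2 * vinner g (grad g phi) W p))); first by ring.
    by rewrite haW; ring.
  have hJG : s * fJ p + s^-1 * fG p = w p * (s * x ^+ 2 + s^-1 * (a p * N) ^+ 2).
    by rewrite /fJ /fG /x /gradN exprMn -sqr_vnorm -/N exprMn; ring.
  have : `|w p * (2 * x * (a p ^+ 2 * y))| <= s * fJ p + s^-1 * fG p.
    by rewrite hJG normrM (ger0_norm (ltW (w_gt0 p))) ler_pM2l ?w_gt0.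
  rewrite ler_norml => /andP[h1 h2]; rewrite hhE /k /k2; apply/andP; split; lra.
(* The bounds on h hold almost everywhere only; truncating h makes them hold
   everywhere without changing its integral. *)
pose h' p := Num.max (- k p) (Num.min (h p) (k2 p)).
have mh : measurable_fun [set: borelType M] (h : borelType M -> R).
  apply: (@chartwise_measurable_support _ _ _ A M_hausdorff h K) => //.
    move=> i; apply: measurable_funM.
      by apply: vinner_measurable => //; exact: measurable_vfield_scale.
    by apply: continuous_chartwise; exact: affV_powR_continuous.
  by move=> p /phi0 p0; rewrite hE p0 expr0n !(mul0r, mulr0, addr0).
have mk : measurable_fun [set: borelType M] (k : borelType M -> R).
  by apply/measurable_EFinP; exact: measurable_int intk.
have mk2 : measurable_fun [set: borelType M] (k2 : borelType M -> R).
  by apply/measurable_EFinP; exact: measurable_int intk2.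
have mh' : measurable_fun [set: borelType M] (h' : borelType M -> R).
  apply: measurable_maxr; first exact: measurableT_comp.
  exact: measurable_minr.
have kk2 p : - k p <= k2 p.
  by have := fJ0 p; have := fG0 p; rewrite /k /k2; lra.
have k2k p : - k2 p <= - k p by have := fI0 p; rewrite /k /k2; lra.
have inth' : vol.-integrable [set: borelType M] (fun p => (h' p)%:E).
  apply: (le_integrable measurableT _ _ intk2); first exact/measurable_EFinP.
  move=> p _; rewrite lee_fin -/(k2 p) [leRHS]ger0_norm; last first.
    by have := kk2 p; have := k2k p; lra.
  rewrite ler_norml /h'; apply/andP; split.
    by rewrite le_max k2k.
  by rewrite ge_max kk2 ge_min lexx orbT.
have hh' : (\int[vol]_p (h p)%:E = \int[vol]_p (h' p)%:E)%E.
  apply: ae_eq_integral; [exact: measurableT|exact/measurable_EFinP|exact/measurable_EFinP|].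
  have [Z [mZ Z0 sZ]] := eW; exists Z; split; [exact: mZ|exact: Z0|].
  move=> p hp; apply: sZ => eWp; apply: hp => _; congr EFin.
  by have /andP[h1 h2] := hbound p eWp; rewrite /h' min_l// max_r.
rewrite -[X in (- X)%E]/(\int[vol]_p (h p)%:E)%E hh' (integralE inth') -EFinN lee_fin.
have : - (\int[vol]_p k p) <= \int[vol]_p h' p.
  have [intnk] := Rintegral_lincomb (-1) 0 0 intk intk intk.
  rewrite !mul0r !addr0 mulN1r => e; rewrite -[leLHS]e.
  apply: le_Rintegral; [exact: measurableT|exact: intnk|exact: inth'|].
  by move=> p _; rewrite !mul0r !addr0 mulN1r -/(k p) /h' le_max lexx.
rewrite /k intkE -/rI -/rJ -/rG; move=> h1 h2; rewrite [_ / s]mulrC; lra.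
Qed.

Let nonneg_Rintegral (f : M -> R) : (forall p, 0 <= f p) -> 0 <= \int[vol]_p f p.
Proof. by move=> f0; apply: Rintegral_ge0 => p _; exact: f0. Qed.

Let rI_ge0 : 0 <= rI.
Proof.
by apply: nonneg_Rintegral => p; exact: mulr_ge0 (sqr_ge0 _) (ltW (w_gt0 p)).
Qed.

Let rJ_ge0 : 0 <= rJ.
Proof.
apply: nonneg_Rintegral => p; apply/mulr_ge0/ltW/w_gt0.
exact/mulr_ge0/sqr_ge0/sqr_ge0.
Qed.

Let rP_ge0 : 0 <= rP.
Proof.
apply: nonneg_Rintegral => p; apply/mulr_ge0/ltW/w_gt0.
by apply/mulr_ge0/sqr_ge0; exact: exprn_ge0.
Qed.

Let rG_ge0 : 0 <= rG.
Proof.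
apply: nonneg_Rintegral => p; apply/mulr_ge0/ltW/w_gt0.
exact/mulr_ge0/vinner_ge0/sqr_ge0.
Qed.

Lemma first_order_real : (C + 1) ^+ 2 / 4 * rI ^+ 2 <= rJ * rG.
Proof.
have C1 : 0 <= (C + 1) * rI by rewrite mulr_ge0// addr_ge0// ltW.
have := square_le_of_forall_pos C1 rJ_ge0 rG_ge0 first_order_linear.
by rewrite exprMn; lra.
Qed.

Lemma first_order_ineq :
  ((\int[vol]_p (rho p ^+ 2 * phi p ^+ 2 * affV u p `^ (tau + lam - mu))%:E) *
   (\int[vol]_p (vnorm g (aff_grad g u lam mu phi) p ^+ 2 *
                 affV u p `^ (tau + lam - mu))%:E) >=
   ((C + 1) ^+ 2 / 4)%:E *
   (\int[vol]_p (phi p ^+ 2 * affV u p `^ (tau + lam - mu))%:E) ^+ 2)%E.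
Proof.
have -> : (\int[vol]_p (vnorm g (aff_grad g u lam mu phi) p ^+ 2 *
    affV u p `^ (tau + lam - mu))%:E = \int[vol]_p (fG p)%:E)%E.
  by apply: eq_integral => p _; rewrite aff_grad_sq.
rewrite (integralE intI) (integralE intJ) (integralE intG).
by rewrite -EFin_expe -!EFinM lee_fin first_order_real.
Qed.

(** The exponent for which div (V^m grad phi) = V^tau (Delta^D phi): it equals 2 mu + n lam, the
    coefficient of the first-order term in [aff_laplacian]. *)
Let m := tau + mu - lam.

Lemma partials_affV p i : chart_dom i p ->
  partials (A := A) (fun p => affV u p `^ m) i p = (m * affV u p `^ m) *: partials u i p.
Proof.
move=> ip; apply/rowP => k; rewrite !mxE.
set U := u \o chart_inv i.
have -> : (fun p => affV u p `^ m) \o chart_inv i = expR \o (m *: U).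
  by apply/funext => x; rewrite /= affV_powR mulrC.
have dU : differentiable U (chart i p).
  by apply: C1at_differentiable; exact: (smooth_function_C1 u_smooth).
have dmU : differentiable (m *: U) (chart i p) by exact: differentiableZ.
rewrite derive_comp_real//.
rewrite derive1E derive_val deriveZ; last exact: diff_derivable.
have -> : (m *: U) (chart i p) = u p * m.
  by rewrite -[LHS]/(m * u (chart_inv i (chart i p))) chartK// mulrC.
by rewrite affV_powR -[m *: _]/(m * _); ring.
Qed.


Let L p := aff_laplacian g u lam mu phi p.
Let fC p := phi p * (a p * L p) * w p.
Let fQ p := (a p * L p) ^+ 2 * w p.

Let lap_cts : continuous (laplacian g phi).
Proof. exact: (divergence_continuous vol_g M_hausdorff (grad_C1 g phi_smooth)). Qed.

Let lap0 p : ~ K p -> laplacian g phi p = 0.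
Proof.
move=> nK; apply: divergence_eq0.
have := open_nbhs_nbhs (conj (closed_openC clK) nK); apply: filterS => q nq i iq.
by rewrite /grad partials_eq0 ?mul0mx//; exact: phi_near0.
Qed.

Let inner_u_cts : continuous (vinner g (grad g u) (grad g phi)).
Proof.
exact: C1_function_continuous (vinner_C1 g (grad_C1 g u_smooth) (grad_C1 g phi_smooth)).
Qed.

Let inner_u0 p : ~ K p -> vinner g (grad g u) (grad g phi) p = 0.
Proof.
move=> /phi_near0/(vnorm_grad_eq0 g) h; apply/eqP; rewrite -normr_le0.
by rewrite (le_trans (cauchy_schwarz _ _ _ _))// h mulr0.
Qed.

Let L_cts : continuous L.
Proof.
apply: mul_cts => //= p; apply: (@continuousD _ _ _ (laplacian g phi)); first exact: lap_cts.
by apply: continuousM; [exact: cst_continuous|exact: inner_u_cts].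
Qed.

Let L0 p : ~ K p -> L p = 0.
Proof. by move=> nK; rewrite /L /aff_laplacian lap0// inner_u0// mulr0 addr0 mulr0. Qed.

Let intC : vol.-integrable [set: borelType M] (fun p => (fC p)%:E).
Proof.
apply: integrable_cs; first by apply: (mul_cts _ w_cts); apply: (mul_cts phi_cts); exact: mul_cts.
by move=> p /phi0 h; rewrite /fC h !mul0r.
Qed.

Let intQ : vol.-integrable [set: borelType M] (fun p => (fQ p)%:E).
Proof.
apply: integrable_cs.
  by apply: (mul_cts _ w_cts); apply: exp_cts; exact: mul_cts.
by move=> p /L0 h; rewrite /fQ h mulr0 expr0n mul0r.
Qed.

Let rQ := \int[vol]_p fQ p.

(** Green's formula for the field grad phi and the function b = phi V^m: differentiating V^m
    produces the first-order term of the affine Laplacian, and the integrand becomes fG + fC. *)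
Lemma green_affine : \int[vol]_p fC p = - rG.
Proof.
pose b p := phi p * affV u p `^ m.
have Cb : C1_function A b by apply: C1_functionM => //; exact: affV_powR_C1.
have b0 p : ~ K p -> b p = 0 by move=> /phi0 h; rewrite /b h mul0r.
have [_ _ Gb] := green vol_g M_hausdorff (grad_C1 g phi_smooth) Cb phi_compact b0.
have E p : b p * divergence g (grad g phi) p + vinner g (grad g b) (grad g phi) p =
    1 * fG p + 1 * fC p + 0 * fC p.
  have ip := chart_atP A p.
  have -> : vinner g (grad g b) (grad g phi) p = affV u p `^ m *
      (phi p * m * vinner g (grad g u) (grad g phi) p + gradN p).
    have lin (x y : R) (P Q : 'M[R]_1) : (x *: P + y *: Q) 0 0 = x * P 0 0 + y * Q 0 0.
      by rewrite !mxE.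
    rewrite /gradN !vinner_at !inner_grad// partialsM//; last 2 first.
    - exact: phiC1.
    - exact: affV_powR_C1.
    by rewrite partials_affV// mulmxDl -!scalemxAl lin [X in _ * X + _]mxE; ring.
  rewrite /fG /fC /L /aff_laplacian /b /m weight_lap /laplacian -/(a p) /tau /aff_tau.
  ring.
have [I3 R3] := Rintegral_lincomb 1 1 0 intG intC intC.
have := Gb; under eq_integral do rewrite E.
rewrite (integralE I3) R3 => -[]; rewrite !mul1r mul0r addr0 -/rG.
by move=> h; lra.
Qed.

Let rQ_ge0 : 0 <= rQ.
Proof. by apply: nonneg_Rintegral => p; exact: mulr_ge0 (sqr_ge0 _) (ltW (w_gt0 p)). Qed.

Lemma second_order_real : ((C + 1) ^+ 2 / 4) ^+ 2 * rI ^+ 2 <= rP * rQ.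
Proof.
apply: (@second_order_ineq _ _ rI rJ rG rP rQ) => //.
- by rewrite divr_ge0// sqr_ge0.
- exact: first_order_real.
(* J^2 <= P I: the quadratic in s is the integral of ((rho^2 - s) phi)^2 w. *)
- apply: square_le_of_quadratic_ge0 => // s.
  have [_ R3] := Rintegral_lincomb 1 (- (2 * s)) (s ^+ 2) intP intJ intI.
  have : 0 <= \int[vol]_p (1 * fP p + - (2 * s) * fJ p + s ^+ 2 * fI p).
    apply: nonneg_Rintegral => p.
    have -> : 1 * fP p + - (2 * s) * fJ p + s ^+ 2 * fI p =
        ((rho p ^+ 2 - s) * phi p) ^+ 2 * w p by rewrite /fP /fJ /fI; ring.
    exact: mulr_ge0 (sqr_ge0 _) (ltW (w_gt0 p)).
  by rewrite R3 mul1r mulNr.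
(* G^2 <= I Q: the quadratic is the integral of (s phi + a L)^2 w, whose cross term is - 2 s G by
   Green's formula. *)
- rewrite mulrC; apply: square_le_of_quadratic_ge0 => // s.
  have [_ R3] := Rintegral_lincomb 1 (2 * s) (s ^+ 2) intQ intC intI.
  have : 0 <= \int[vol]_p (1 * fQ p + (2 * s) * fC p + s ^+ 2 * fI p).
    apply: nonneg_Rintegral => p.
    have -> : 1 * fQ p + (2 * s) * fC p + s ^+ 2 * fI p =
        (s * phi p + a p * L p) ^+ 2 * w p by rewrite /fQ /fC /fI; ring.
    exact: mulr_ge0 (sqr_ge0 _) (ltW (w_gt0 p)).
  by rewrite R3 mul1r green_affine mulrN.
Qed.

Lemma second_order_integral_ineq :
  ((\int[vol]_p (rho p ^+ 4 * phi p ^+ 2 * affV u p `^ (tau + lam - mu))%:E) *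
   (\int[vol]_p (aff_laplacian g u lam mu phi p ^+ 2 *
                 affV u p `^ (tau + mu - lam))%:E) >=
   ((C + 1) ^+ 4 / 16)%:E *
   (\int[vol]_p (phi p ^+ 2 * affV u p `^ (tau + lam - mu))%:E) ^+ 2)%E.
Proof.
have -> : (\int[vol]_p (aff_laplacian g u lam mu phi p ^+ 2 *
    affV u p `^ (tau + mu - lam))%:E = \int[vol]_p (fQ p)%:E)%E.
  by apply: eq_integral => p _; congr EFin; rewrite weight_lap /fQ /L; ring.
rewrite (integralE intI) (integralE intP) (integralE intQ).
rewrite -EFin_expe -!EFinM lee_fin.
by have := second_order_real; rewrite expr_div_n -exprM -natrX.
Qed.

End main.

Theorem theorem5p3 (R : realType) (n : nat) (M : ptopologicalType)
  (A : smooth_atlas R n M) (g : riemannian_metric A)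
  (vol : {measure set (borelType M) -> \bar R})
  (M_hausdorff : hausdorff_space M)
  (M_countable : @second_countable M)
  (M_complete : metrically_complete g)
  (M_noncompact : ~ compact [set: M])
  (vol_g : is_riemannian_volume g vol)
  (u : M -> R) (u_smooth : smooth_function A u)
  (lam mu C : R) (C_gt0 : 0 < C)
  (rho : M -> R) (rho_ge0 : forall p, 0 <= rho p)
  (rho_eikonal : aff_eikonal g vol u lam mu rho)
  (rho_laplacian : aff_laplacian_ge g vol u lam mu C rho) :
  let V := affV u in
  let tau := aff_tau n lam mu in
  (forall phi : M -> R, smooth_function A phi ->
     compact (fsupport phi) -> fsupport phi `<=` ~` (rho @^-1` [set 0]) ->
     ((\int[vol]_p (rho p ^+ 2 * phi p ^+ 2 * V p `^ (tau + lam - mu))%:E) *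
      (\int[vol]_p (vnorm g (aff_grad g u lam mu phi) p ^+ 2 *
                    V p `^ (tau + lam - mu))%:E) >=
      ((C + 1) ^+ 2 / 4)%:E *
      (\int[vol]_p (phi p ^+ 2 * V p `^ (tau + lam - mu))%:E) ^+ 2)%E) /\
  (1 < C ->
   forall phi : M -> R, smooth_function A phi ->
     compact (fsupport phi) -> fsupport phi `<=` ~` (rho @^-1` [set 0]) ->
     ((\int[vol]_p (rho p ^+ 4 * phi p ^+ 2 * V p `^ (tau + lam - mu))%:E) *
      (\int[vol]_p (aff_laplacian g u lam mu phi p ^+ 2 *
                    V p `^ (tau + mu - lam))%:E) >=
      ((C + 1) ^+ 4 / 16)%:E *
      (\int[vol]_p (phi p ^+ 2 * V p `^ (tau + lam - mu))%:E) ^+ 2)%E).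
Proof.
move=> V tau; split=> [|_] phi phi_smooth phi_compact phi_rho.
  exact: first_order_ineq.
exact: second_order_integral_ineq.
Qed.
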